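(* Let $n\ge 2$ be an integer. For every $\varepsilon>0$ there is a constant $C=C(n,\varepsilon)$ such that for all real $T\ge 1$, all $N\in 2^{\mathbb N}$ and all $\phi\in L^2(\mathbb R\times\mathbb T^n)$, $$\|e^{it\Delta}P_{\le N}\phi\|_{L^4_{t,x}([0,T]\times\mathbb R\times\mathbb T^n)}\le C N^{\varepsilon}\left(T^{\frac18}N^{\frac{n-2}{4}}+N^{\frac{n-1}{4}}\right)\|\phi\|_{L^2(\mathbb R\times\mathbb T^n)}.$$
   Context: $\mathbb T^n=(\mathbb R/\mathbb Z)^n$, and $\Delta$ is the Laplace–Beltrami operator on $\mathbb R\times\mathbb T^n$, whose frequency space is $\mathbb R\times\mathbb Z^n$. $e^{it\Delta}$ is the solution operator of the linear Schrödinger equation $i\partial_t u+\Delta u=0$, a Fourier multiplier (the paper normalizes it by the phase $e^{2\pi i(x\cdot\xi-t|\xi|^2)}$; constant rescalings of time are immaterial). For dyadic $N$, $P_{\le N}$ is the Littlewood–Paley (Fourier) projection to frequencies $|\xi|\lesssim N$. (The paper writes $\lessapprox$ for $\lesssim_\varepsilon N^\varepsilon$ for every $\varepsilon>0$.) *)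

(* Defs.v *)
From HB Require Import structures.
From mathcomp Require Import all_boot all_order all_algebra.
From mathcomp Require Export complex.
From mathcomp Require Import all_classical all_reals all_analysis.
Import Order.TTheory GRing.Theory Num.Theory.
Import numFieldNormedType.Exports.

Set Implicit Arguments.
Unset Strict Implicit.
Unset Printing Implicit Defensive.

Local Open Scope classical_set_scope.
Local Open Scope complex_scope.
Local Open Scope ring_scope.

(** T^n = (R/Z)^n is represented by R^n with the probability measure carried
    by the fundamental domain [0,1]^n: a function on T^n is a function on R^n,
    up to equality almost everywhere on the cube, its values off the cube
    being irrelevant. *)
Section torus.
Variable R : realType.
Local Notation rline := (measurableTypeR R).

Definition cons_pair n (z : rline * n.-tuple rline) : n.+1.-tuple rline :=
  [tuple of z.1 :: z.2].

Lemma measurable_cons_pair n : measurable_fun setT (@cons_pair n).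
Proof. exact: (measurable_cons measurable_fst measurable_snd). Qed.

HB.instance Definition _ n := @isMeasurableFun.Build _ _
  (rline * n.-tuple rline)%type (n.+1.-tuple rline) (@cons_pair n)
  (@measurable_cons_pair n).

(** The n-fold product of the uniform probability on [0,1], i.e. the
    normalized Haar measure of T^n. *)
Fixpoint torus_measure n : probability (n.-tuple rline) R :=
  match n with
  | 0 => \d_[tuple] : probability (0.-tuple rline) R
  | m.+1 => distribution
      (uniform_prob (@ltr01 R) \x torus_measure m)%E (@cons_pair m)
  end.

Definition RT n := (rline * n.-tuple rline)%type.

Definition RT_measure n : set (RT n) -> \bar R :=
  (@lebesgue_measure R \x torus_measure n)%E.

HB.instance Definition _ n := Measure.on (@RT_measure n).

Lemma RT_measure_sigma_finite n : sigma_finite setT (@RT_measure n).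
Proof.
have /sigma_finiteP[F [TF ndF Foo]] := sigma_finiteT (@lebesgue_measure R).
exists (fun k => F k `*` setT).
  by rewrite -setXTT TF predeqE => -[x y]; split=> [[[k _ Fkx] _]|[k _ [Fkx _]]];
    [exists k | split=> //; exists k].
move=> k; have [mF Fk] := Foo k; split; first exact: measurableX.
rewrite /RT_measure product_measure1E// lte_mul_pinfty//.
  by rewrite ge0_fin_numE.
by apply: (le_lt_trans (probability_le1 _ measurableT)); rewrite ltry.
Qed.

HB.instance Definition _ n := Measure_isSigmaFinite.Build _ _ _
  (@RT_measure n) (RT_measure_sigma_finite n).

(** The measure of [0,T] x R x T^n. *)
Definition slab_measure n (T : R) : {measure set (rline * RT n) -> \bar R} :=
  (mrestr (@lebesgue_measure R) (@measurable_itv R `[0, T]%R) \x @RT_measure n)%E.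

End torus.

Section complex_valued.
Context d (X : measurableType d) (R : realType).
Variable mu : {measure set X -> \bar R}.
Implicit Types (f : X -> R[i]) (D : set X).

Definition cmeasurable f :=
  measurable_fun setT (fun x => complex.Re (f x)) /\
  measurable_fun setT (fun x => complex.Im (f x)).

Definition cintegral D f : R[i] :=
  (\int[mu]_(x in D) complex.Re (f x)) +i* (\int[mu]_(x in D) complex.Im (f x)).

Definition cLnorm (p : R) f : \bar R :=
  Lnorm mu p%:E (fun x => (ComplexField.Normc.normc (f x))%:E).

Definition in_L2 f := cmeasurable f /\ (cLnorm 2 f < +oo)%E.

End complex_valued.

Section fourier.
Variables (R : realType) (n : nat).
Local Notation rline := (measurableTypeR R).
Local Notation RT := (RT R n).
Local Notation normc := ComplexField.Normc.normc.
Implicit Types (phi : RT -> R[i]) (z : RT) (xi : rline).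

(** The frequency space of R x T^n is R x Z^n. *)
Definition Zn := n.-tuple int.
Implicit Types (k : Zn) (g m : rline -> Zn -> R[i]).

Definition expi (theta : R) : R[i] := cos theta +i* sin theta.

Definition pairing z xi k : R :=
  z.1 * xi + \sum_(j < n) tnth z.2 j * (tnth k j)%:~R.

Definition freq_norm xi k : R :=
  Num.sqrt (xi ^+ 2 + \sum_(j < n) ((tnth k j)%:~R) ^+ 2).

Definition trunc_fourier phi (A : R) xi k : R[i] :=
  cintegral (@RT_measure R n) (`[- A, A] `*` setT)
    (fun z => phi z * expi (- (2 * pi * pairing z xi k))).

(** The square of the norm of L^2(R x Z^n). *)
Definition freq_L2sq g : \bar R :=
  (\esum_(k in setT) \int[@lebesgue_measure R]_xi (normc (g xi k) ^+ 2)%:E)%E.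

(** [g] is the Fourier-Plancherel transform of [phi]: the limit in L^2(R x Z^n)
    of the transforms of the truncations of [phi] to [-A,A] x T^n. *)
Definition is_fourier phi g :=
  [/\ forall k, cmeasurable (g^~ k), (freq_L2sq g < +oo)%E &
      freq_L2sq (fun xi k => g xi k - trunc_fourier phi A xi k)
        @[A --> +oo] --> 0%E].

(** For [phi] in L^2(R x T^n) the transform exists by the Plancherel theorem,
    and is unique up to a null set, which no multiplier below sees. *)
Definition fourier phi : rline -> Zn -> R[i] :=
  xget (fun _ _ => 0) [set g | is_fourier phi g].

(** The operator with Fourier multiplier [m], in the form of the Fourier
    inversion integral. Only used for [m] bounded with bounded support: for
    [phi] in L^2 the sum over Z^n is then finite and the integrals converge
    absolutely. *)
Definition fourier_multiplier m phi z : R[i] :=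
  \sum_(k \in [set: Zn]) cintegral (@lebesgue_measure R) setT
    (fun xi => m xi k * fourier phi xi k * expi (2 * pi * pairing z xi k)).

Definition smooth (f : R -> R) := forall (j : nat) (x : R), derivable (derive1n j f) x 1.

(** Radial profile of a Littlewood-Paley cutoff. *)
Definition LP_profile (eta : R -> R) :=
  [/\ smooth eta,
      forall r, 0 <= eta r <= 1,
      forall r, 0 <= r <= 1 -> eta r = 1 &
      forall r, 2 <= r -> eta r = 0].

Definition LP_symbol (eta : R -> R) (N : R) xi k : R[i] :=
  (eta (freq_norm xi k / N))%:C.

Definition schrodinger_symbol (t : R) xi k : R[i] :=
  expi (- (2 * pi * (t * freq_norm xi k ^+ 2))).

(** (t,x) |-> (e^{it Delta} P_{<= N} phi)(x). *)
Definition schrodinger_LP eta N phi (w : rline * RT) : R[i] :=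
  fourier_multiplier
    (fun xi k => schrodinger_symbol w.1 xi k * LP_symbol eta N xi k) phi w.2.

End fourier.

(* Main.v *)
Require Import Defs.
From HB Require Import structures.
From mathcomp Require Import all_boot all_order all_algebra.
From mathcomp Require Import all_classical all_reals all_analysis.
From mathcomp Require Import measurable_realfun zify ring lra.
Import Order.TTheory GRing.Theory Num.Theory.
Import numFieldNormedType.Exports.

Set Implicit Arguments.
Unset Strict Implicit.
Unset Printing Implicit Defensive.

(** Write [u] for the solution. Its fourth power is the square of [u ^ 2], and
    [u ^ 2] is a superposition of the plane waves

      exp (2 pi i ((xi1 + xi2) x + (k1 + k2) . y
                   - (xi1 ^ 2 + |k1| ^ 2 + xi2 ^ 2 + |k2| ^ 2) t)),

    indexed by pairs of frequencies (xi1, k1), (xi2, k2), whose amplitudes have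
    as L^2 mass the square of the mass of the transform of [phi]. So an L^4
    bound for [u] is an L^2 bound for an extension operator on pairs, and Schur's
    test for T T^* applies ([ttstar]): against a weight w(t, x) >= 0, the bound is
    the largest row sum of the Fourier transform of w at differences of phases.

    The weight is a product of compactly supported [bump]s at scale T in time and A
    in x. Their Fourier transforms are at most a multiple of the Poisson kernel
    [poisson] ([osc_bump]), while the integral over T^n leaves only the pairs
    with the same sum k1 + k2 ([osc_torus]). With (tau, s, k) the phase of a
    fixed pair, its row sum is thus, up to constants, the sum over k1 + k2 = k of

      int int P_A (s - xi1 - xi2) P_T (tau - xi1^2 - xi2^2 - |k1|^2 - |k2|^2).

    Integrating over xi1 + xi2 costs the mass pi of P_A, uniformly in A. For a
    given value of xi1 + xi2 the remaining integral sees the parabola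
    rho - 2 v ^ 2, and is at most about T ^ (1/2) if |rho| < 1 and
    |rho| ^ (- 1/2) otherwise ([spike], [integral_poisson_parabola]). There
    remains the sum over k1. By the parallelogram law the k1 for which
    |k1|^2 + |k2|^2 has a given value l lie on a sphere about k / 2; fixing n - 2
    coordinates leaves a sum of two squares, and the divisor bound shows that
    there are O(N ^ (n - 2 + eps)) of them ([two_squares_bound],
    [card_sphere_box]). Finally the sum over l = O(N ^ 2) of spike (rho - l) is
    O(T ^ (1/2) + N) ([sum_spike]). Hence the fourth power of the norm of [u] is
    O(N ^ (n - 2 + eps) (T ^ (1/2) + N)) times the fourth power of the L^2 norm
    of the transform ([bilinear_L4]), which is the claim. The weight is removed
    by letting A tend to infinity ([slab_integral_le]).

    The L^2 norm of the transform is bounded by that of [phi] ([plancherel_le])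
    through the same T T^* inequality, read by duality ([bessel]) for the plane
    waves on R x T^n, where the row sums are integrals of one Poisson kernel. *)

Local Open Scope ring_scope.

(** * Lattice points on spheres *)

Section counting.
Local Open Scope nat_scope.

Lemma leq_size_fibers (T U : eqType) (f : T -> U) (s : seq T) (t : seq U) b :
  {in s, forall x, f x \in t} ->
  (forall v, size [seq x <- s | f x == v] <= b) ->
  size s <= b * size t.
Proof.
elim: t s => [|v t IH] s st sb.
  by case: s st {sb} => // x s /(_ x); rewrite inE eqxx => /(_ isT).
rewrite -(count_predC (fun x => f x == v) s) /= mulnS -!size_filter leq_add//.
apply: IH => [x|u].
  by rewrite mem_filter /= => /andP[fxv /st]; rewrite inE (negbTE fxv).
rewrite -filter_predI; apply: leq_trans (sb u).
by rewrite !size_filter; apply: sub_count => x /= /andP[].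
Qed.

(** A divisor of m is determined by its p-adic valuation and its p'-part. *)
Lemma leq_size_divisors_partn p m : 0 < m ->
  size (divisors m) <= (logn p m).+1 * size (divisors m`_p^').
Proof.
move=> m0; rewrite mulnC -[(logn p m).+1](size_iota 0).
apply: (leq_size_fibers (f := logn p)) => [d|v].
  rewrite -dvdn_divisors// mem_iota add0n ltnS => dm.
  exact: dvdn_leq_log.
set s := seq.filter _ _.
have -> : size s = size [seq d`_p^' | d <- s] by rewrite size_map.
apply: uniq_leq_size => [|x /mapP[d]].
  rewrite map_inj_in_uniq ?filter_uniq ?divisors_uniq// => d d'.
  rewrite !mem_filter -!dvdn_divisors// => /andP[/eqP dv dm] /andP[/eqP d'v d'm].
  have d0 := dvdn_gt0 m0 dm; have d'0 := dvdn_gt0 m0 d'm.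
  by rewrite -{2}(partnC p d0) -{2}(partnC p d'0) !p_part dv d'v => ->.
rewrite mem_filter -!dvdn_divisors ?part_gt0// => /andP[_ dm] ->.
exact: partn_dvd.
Qed.

(** Any exponential beats any power. This constant is paid once for each prime
    below 2 ^ k in [divisor_bound]. *)
Lemma leq_exp_succ k e : 0 < k -> e.+1 ^ k <= k ^ k * 2 ^ e.
Proof.
(* Compare e with its multiple of k: e + 1 <= k (e %/ k + 1). *)
move=> k0; have h : e.+1 <= k * 2 ^ (e %/ k).
  apply: (@leq_trans (k * (e %/ k).+1)); last by rewrite leq_mul2l ltn_expl ?orbT.
  by rewrite {1}(divn_eq e k) mulnS addnC mulnC ltn_add2r ltn_mod.
rewrite -(leq_exp2r _ _ k0) in h; apply: leq_trans h _.
rewrite expnMn leq_mul2l -expnM leq_exp2l//.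
by rewrite leq_divM orbT.
Qed.

(** For a prime power p ^ e the count is e + 1, and (e + 1) ^ k <= p ^ e as soon
    as p >= 2 ^ k. Only the fewer than 2 ^ k smaller primes cost a constant, and
    that constant is k ^ k by [leq_exp_succ]. *)
Lemma divisor_bound k : 0 < k ->
  exists C, forall m, 0 < m -> size (divisors m) ^ k <= C * m.
Proof.
move=> k0; pose small m := [seq p <- primes m | p < 2 ^ k].
exists ((k ^ k) ^ (2 ^ k)) => m m0.
have: size (divisors m) ^ k <= (k ^ k) ^ size (small m) * m.
  elim/ltn_ind: m m0 => m IH m0.
  have [->|m1] := eqVneq m 1; first by rewrite muln1 exp1n expn_gt0 expn_gt0 k0.
  have {}m1 : 1 < m by lia.
  pose p := pdiv m; have pp : prime p := pdiv_prime m1.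
  have pm : p %| m := pdiv_dvd m.
  have e0 : 0 < logn p m by rewrite logn_gt0 mem_primes pp m0.
  set e := logn p m in e0 *; pose m' := m`_p^'.
  have mE : m = p ^ e * m' by rewrite -p_part partnC.
  have m'0 : 0 < m' by rewrite part_gt0.
  have ltm : m' < m.
    by rewrite [ltnRHS]mE ltn_Pmull// -{1}(expn0 p) ltn_exp2l// prime_gt1.
  have pm' : ~~ (p %| m').
    have : p^'.-nat m' by rewrite part_pnat.
    by rewrite p'natE.
  have sE : perm_eq (primes m) (p :: primes m').
    apply: uniq_perm; [exact: primes_uniq| |move=> q].
      by rewrite /= primes_uniq mem_primes (negbTE pm') !andbF.
    rewrite {1}mE primesM ?expn_gt0 ?(prime_gt0 pp)//.
    by rewrite primesX// (primes_prime pp) !inE.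
  have szE : size (small m) = (p < 2 ^ k) + size (small m').
    rewrite /small (perm_size (perm_filter _ sE)) /=.
    by case: ifP.
  rewrite szE expnD.
  have := leq_size_divisors_partn p m0; rewrite -(leq_exp2r _ _ k0).
  move=> /leq_trans; apply.
  rewrite -/e -/m' expnMn [X in _ <= _ * X]mE -mulnA (mulnCA _ (p ^ e)) mulnA.
  apply: leq_mul; last exact: IH.
  have [pk|pk] := ltnP p (2 ^ k).
    rewrite expn1; apply: leq_trans (leq_exp_succ e k0) _.
    by rewrite leq_mul2l leq_exp2r// prime_gt1 ?orbT.
  rewrite expn0 mul1n; apply: (@leq_trans ((2 ^ k) ^ e)); last by rewrite leq_exp2r.
  by rewrite -expnM mulnC expnM leq_exp2r// ltn_expl.
move=> /leq_trans; apply; rewrite leq_mul2r leq_pexp2l ?orbT ?expn_gt0 ?k0//.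
rewrite -[leqRHS](size_iota 0); apply: uniq_leq_size => [|p].
  by rewrite filter_uniq// primes_uniq.
by rewrite mem_filter mem_iota add0n => /andP[].
Qed.

End counting.

Section two_squares.
Local Open Scope int_scope.
Local Open Scope ring_scope.

Definition sum2sq (p : int * int) : int := p.1 ^+ 2 + p.2 ^+ 2.

(** Since a^2 + b^2 = a0^2 + b0^2 = M, the integer M divides
    (a b0 - b a0) (a b0 + b a0). Thus h := gcd (a b0 - b a0, M) splits M as h m'
    with m' dividing the second factor. If (c, d) gives the same h, then both h
    and m' divide a d - b c, as (a0, b0) is primitive; and gcd (h, m') divides 2,
    hence the claim. *)
Lemma dvdz_cross_two_squares (M a b a0 b0 c d : int) : M != 0 ->
  coprimez a b -> coprimez a0 b0 ->
  sum2sq (a, b) = M -> sum2sq (c, d) = M -> sum2sq (a0, b0) = M ->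
  gcdz (a * b0 - b * a0) M = gcdz (c * b0 - d * a0) M ->
  (M %| 2 * (a * d - b * c))%Z.
Proof.
rewrite /sum2sq/= => M0 cab cab0 abM cdM abM0 hE.
set Q1 := a * b0 - b * a0 in hE; set Q2 := c * b0 - d * a0 in hE.
set h := gcdz Q1 M in hE.
have h0 : h != 0 by rewrite gcdz_eq0 negb_and M0 orbT.
have hQ1 : (h %| Q1)%Z by exact: dvdz_gcdl.
have hQ2 : (h %| Q2)%Z by rewrite hE dvdz_gcdl.
have /dvdzP[m' ME] : (h %| M)%Z by exact: dvdz_gcdr.
have m'0 : m' != 0 by apply: contraNneq M0 => m'E; rewrite ME m'E mul0r.
pose S1 := a * b0 + b * a0; pose S2 := c * b0 + d * a0.
(* h takes all of gcd (Q, M), so that m' is coprime to Q / h and divides S. *)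
have key u v Q S : u ^+ 2 + v ^+ 2 = M -> Q = u * b0 - v * a0 ->
    S = u * b0 + v * a0 -> h = gcdz Q M -> (m' %| S)%Z.
  move=> uvM QE SE hQ.
  have /dvdzP[q qE] : (h %| Q)%Z by rewrite hQ dvdz_gcdl.
  have cq : coprimez m' q.
    have := mulz_gcdl q m' h; rewrite -qE -ME -hQ gez0_abs ?gcdz_ge0// => hh.
    by rewrite coprimez_sym /coprimez -(inj_eq (mulIf h0)) mul1r; apply/eqP.
  rewrite -(Gauss_dvdzr _ cq).
  have QS : Q * S = M * (u ^+ 2 - a0 ^+ 2).
    have -> : Q * S = u ^+ 2 * b0 ^+ 2 - v ^+ 2 * a0 ^+ 2.
      by rewrite QE SE; ring.
    have -> : b0 ^+ 2 = M - a0 ^+ 2 by rewrite -abM0; ring.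
    have -> : v ^+ 2 = M - u ^+ 2 by rewrite -uvM; ring.
    by ring.
  have : h * (q * S) = h * (m' * (u ^+ 2 - a0 ^+ 2)).
    by rewrite mulrA (mulrC h q) -qE QS ME; ring.
  by move=> /(mulfI h0) ->; rewrite dvdz_mulr.
have S1m : (m' %| S1)%Z by apply: (key a b Q1).
have S2m : (m' %| S2)%Z by apply: (key c d Q2) => //; rewrite -hE.
pose D := a * d - b * c.
(* As a0 and b0 are coprime, it is enough to divide a0 D and b0 D. *)
have bez g : (g %| b0 * D)%Z -> (g %| a0 * D)%Z -> (g %| D)%Z.
  move=> gb ga; have /coprimezP[[u v] uv] := cab0.
  by rewrite -(mul1r D) -uv/= mulrDl -!mulrA rpredD 1?dvdz_mull.
have hD : (h %| D)%Z.
  apply: bez.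
    have -> : b0 * D = d * Q1 - b * Q2 by rewrite /D /Q1 /Q2; ring.
    by rewrite rpredB 1?dvdz_mull.
  have -> : a0 * D = c * Q1 - a * Q2 by rewrite /D /Q1 /Q2; ring.
  by rewrite rpredB 1?dvdz_mull.
have m'D : (m' %| D)%Z.
  apply: bez.
    have -> : b0 * D = d * S1 - b * S2 by rewrite /D /S1 /S2; ring.
    by rewrite rpredB 1?dvdz_mull.
  have -> : a0 * D = a * S2 - c * S1 by rewrite /D /S1 /S2; ring.
  by rewrite rpredB 1?dvdz_mull.
pose e := gcdz h m'.
have eM : (e %| M)%Z by rewrite ME dvdz_mull ?dvdz_gcdl.
have cop x y z : coprimez x y -> x ^+ 2 + y ^+ 2 = M -> (z %| M)%Z -> coprimez z x.
  move=> cxy xyM zM; rewrite /coprimez.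
  set g := gcdz z x.
  have gx : (g %| x)%Z by exact: dvdz_gcdr.
  have gM : (g %| M)%Z by apply: dvdz_trans zM; exact: dvdz_gcdl.
  have gy2 : (g %| y ^+ 2)%Z.
    have -> : y ^+ 2 = M - x ^+ 2 by rewrite -xyM addrAC subrr add0r.
    by rewrite rpredB// expr2 dvdz_mull.
  have cgy : coprimez g y := coprimez_dvdl gx cxy.
  have : (g %| 1)%Z by rewrite -(Gauss_dvdzr _ cgy) mulr1 -(Gauss_dvdzr _ cgy).
  by rewrite dvdz1 => /eqP gE; rewrite -[g]gez0_abs ?gE// gcdz_ge0.
have ea : coprimez e a by apply: (cop a b).
have eb0 : coprimez e b0.
  by apply: (cop b0 a0); rewrite 1?coprimez_sym 1?addrC.
(* e divides both Q1 and S1, whose sum is 2 a b0, and is coprime to a and b0. *)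
have e2 : (e %| 2)%Z.
  rewrite -(Gauss_dvdzl _ ea) -(Gauss_dvdzl _ eb0).
  have -> : 2 * a * b0 = Q1 + S1 by rewrite /Q1 /S1; ring.
  rewrite rpredD//; [apply: dvdz_trans hQ1|apply: dvdz_trans S1m].
    exact: dvdz_gcdl.
  exact: dvdz_gcdr.
(* h m' = gcd (h, m') lcm (h, m'), with the gcd dividing 2 and the lcm dividing D. *)
apply: (@dvdz_trans (e * D)); last by rewrite dvdz_mul.
rewrite -/D dvdzE ME !abszM.
rewrite mulnC -muln_lcm_gcd mulnC dvdn_mul//.
by rewrite dvdn_lcm -!dvdzE hD.
Qed.

(** In a fibre of the map to the divisors of M of [dvdz_cross_two_squares], fix
    one representation (a, b). For any other (c, d) the number 2 (a d - b c) is a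
    multiple of M which is at most 2 M in absolute value, since
    (a d - b c)^2 + (a c + b d)^2 = M^2. Together with the sign of a c + b d, it
    determines (c, d): there are at most 5 * 2 possibilities. *)
Lemma size_primitive_two_squares (M : nat) (s : seq (int * int)) : (0 < M)%N ->
  uniq s -> {in s, forall p, sum2sq p = M /\ coprimez p.1 p.2} ->
  (size s <= 10 * size (divisors M))%N.
Proof.
move=> M0 us sP.
have [->|] := eqVneq s [::]; first by [].
case: s us sP => // p0 s0; set s := p0 :: s0 => us sP _.
have [p0M p0c] := sP p0 (mem_head _ _).
have MZ0 : M%:Z != 0 by lia.
pose h (p : int * int) := `|gcdz (p.1 * p0.2 - p.2 * p0.1) M|%N.
apply: (leq_size_fibers (f := h)) => [p /sP _|v].
  by rewrite -dvdn_divisors// /h; have := dvdz_gcdr (p.1 * p0.2 - p.2 * p0.1) M.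
set t := seq.filter _ _.
have ut : uniq t by rewrite filter_uniq.
have tP p : p \in t -> [/\ sum2sq p = M, coprimez p.1 p.2 & h p = v].
  by rewrite mem_filter => /andP[/eqP -> /sP[]].
have [->//|] := eqVneq t [::].
case: t ut tP => // q0 t0; set t := q0 :: t0 => ut tP _.
have [q0M q0c q0h] := tP q0 (mem_head _ _).
pose f (p : int * int) : int * bool :=
  (2 * (q0.1 * p.2 - q0.2 * p.1), 0 <= q0.1 * p.1 + q0.2 * p.2).
pose l : seq (int * bool) := [seq (i * M%:Z, b) | i <- [:: -2; -1; 0; 1; 2], b <- [:: true; false]].
have <- : size [seq f p | p <- t] = size t by rewrite size_map.
have -> : 10%N = size l by [].
have crossE (p : int * int) : sum2sq p = M ->
    (q0.1 * p.2 - q0.2 * p.1) ^+ 2 + (q0.1 * p.1 + q0.2 * p.2) ^+ 2 = M%:Z ^+ 2.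
  by move=> pM; rewrite [in RHS]expr2 -{1}q0M -pM /sum2sq; ring.
apply: uniq_leq_size => [|x /mapP[p pt ->]].
  rewrite map_inj_in_uniq// => p q /tP[pM _ _] /tP[qM _ _] /eqP.
  rewrite xpair_eqE => /andP[/eqP e1 /eqP e2].
  have {}e1 : q0.1 * p.2 - q0.2 * p.1 = q0.1 * q.2 - q0.2 * q.1.
    by apply: (@mulfI _ (2 : int)).
  have e3 : q0.1 * p.1 + q0.2 * p.2 = q0.1 * q.1 + q0.2 * q.2.
    have := crossE _ pM; rewrite -(crossE _ qM) e1 => /addrI /eqP.
    rewrite eqf_sqr => /orP[/eqP//|/eqP e4]; move: e2 e4.
    by set u := _ + _; set w := _ + _; lia.
  have i1 : M%:Z * p.1 = M%:Z * q.1.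
    have E (z : int * int) : M%:Z * z.1 = q0.1 * (q0.1 * z.1 + q0.2 * z.2)
        - q0.2 * (q0.1 * z.2 - q0.2 * z.1) by rewrite -q0M /sum2sq; ring.
    by rewrite !E e1 e3.
  have i2 : M%:Z * p.2 = M%:Z * q.2.
    have E (z : int * int) : M%:Z * z.2 = q0.2 * (q0.1 * z.1 + q0.2 * z.2)
        + q0.1 * (q0.1 * z.2 - q0.2 * z.1) by rewrite -q0M /sum2sq; ring.
    by rewrite !E e1 e3.
  by case: p q i1 i2 {pM qM e1 e2 e3} => [a b] [c d] /= /(mulfI MZ0) -> /(mulfI MZ0) ->.
have [pM pc ph] := tP p pt.
have /dvdzP[i iE] : (M %| 2 * (q0.1 * p.2 - q0.2 * p.1))%Z.
  apply: (@dvdz_cross_two_squares M q0.1 q0.2 p0.1 p0.2 p.1 p.2) => //.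
  have : h q0 = h p by rewrite q0h ph.
  by rewrite /h => /(congr1 Posz); rewrite !gez0_abs ?gcdz_ge0.
apply/allpairsP; exists (i, (f p).2); rewrite /f /= iE; split=> //; last first.
  by case: (0 <= _).
have iM : i ^+ 2 <= 4.
  have := crossE _ pM; set X := _ - _ in iE *; set Y := _ + _.
  move=> XY; have : (i * M) ^+ 2 <= 4 * M%:Z ^+ 2.
    by rewrite -iE -XY exprMn mulrDr lerDl mulr_ge0// sqr_ge0.
  by rewrite exprMn ler_pM2r// exprn_gt0.
have : -2 <= i <= 2 by rewrite -ler_norml -(@ler_pXn2r _ 2)// ?nnegrE// real_normK// num_real.
by rewrite !inE; lia.
Qed.

Lemma divisors_le (d m : nat) : (0 < m)%N -> (d %| m)%N ->
  (size (divisors d) <= size (divisors m))%N.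
Proof.
move=> m0 dm; apply: uniq_leq_size; first exact: divisors_uniq.
by move=> x; rewrite -!dvdn_divisors ?(dvdn_gt0 m0)// => /dvdn_trans; exact.
Qed.

(** The gcd g of a representation satisfies g^2 | M, and dividing by g makes the
    representation primitive. *)
Lemma size_two_squares (M : nat) (s : seq (int * int)) : (0 < M)%N ->
  uniq s -> {in s, forall p, sum2sq p = M} ->
  (size s <= 10 * size (divisors M) ^ 2)%N.
Proof.
move=> M0 us sP; rewrite expnS expn1 mulnA.
pose g (p : int * int) := `|gcdz p.1 p.2|%N.
have gp p : p \in s -> [/\ dvdn (g p ^ 2)%N M, (0 < g p)%N, p.1 = (p.1 %/ g p)%Z * g p & p.2 = (p.2 %/ g p)%Z * g p].
  move=> /sP pM.
  have g1 : (g p %| p.1)%Z by rewrite /g; exact: dvdz_gcdl.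
  have g2 : (g p %| p.2)%Z by rewrite /g; exact: dvdz_gcdr.
  have gM : dvdn (g p ^ 2)%N M.
    have : ((g p)%:Z ^+ 2 %| M%:Z)%Z by rewrite -pM /sum2sq rpredD// dvdz_exp2r.
    by rewrite dvdzE abszX.
  split=> //; [|by rewrite divzK|by rewrite divzK].
  rewrite lt0n; apply: contraTneq gM => ->.
  by rewrite dvd0n; lia.
apply: (leq_size_fibers (f := g)) => [p /gp[gM _ _ _]|v].
  by rewrite -dvdn_divisors// (dvdn_trans _ gM)// dvdn_exp.
set t := seq.filter _ _.
pose f (p : int * int) := ((p.1 %/ v)%Z, (p.2 %/ v)%Z).
have [->//|] := eqVneq t [::]; rewrite -has_filter => /hasP[q qs /eqP qv].
have [gM v0 _ _] := gp q qs; rewrite qv in gM v0.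
have M'0 : (0 < M %/ v ^ 2)%N by rewrite divn_gt0 ?expn_gt0 ?v0// dvdn_leq.
apply: (@leq_trans (10 * size (divisors (M %/ v ^ 2)))%N); last first.
  by rewrite leq_mul2l divisors_le// -{2}(divnK gM) dvdn_mulr.
have <- : size [seq f p | p <- t] = size t by rewrite size_map.
apply: size_primitive_two_squares => //.
  rewrite map_inj_in_uniq ?filter_uniq// => p p'.
  rewrite !mem_filter => /andP[/eqP pv /gp[_ _ p1 p2]] /andP[/eqP p'v /gp[_ _ p'1 p'2]].
  rewrite pv in p1 p2; rewrite p'v in p'1 p'2.
  move=> [e1 e2]; rewrite e1 -p'1 in p1; rewrite e2 -p'2 in p2.
  by move: p1 p2; case: (p) (p') => [? ?] [? ?] /= -> ->.
move=> x /mapP[p]; rewrite mem_filter => /andP[/eqP pv ps] ->.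
have [_ _ p1 p2] := gp p ps; rewrite pv in p1 p2.
have vZ0 : v%:Z != 0 by lia.
split.
  apply: (@mulIf _ (v%:Z ^+ 2)); first by rewrite expf_neq0.
  rewrite [in RHS]expr2 -PoszM -PoszM mulnn divnK// -(sP _ ps) /sum2sq /f/= [in RHS]p1 [in RHS]p2.
  by ring.
rewrite /coprimez /= -(inj_eq (mulIf vZ0)) mul1r -{3}[v]absz_nat mulz_gcdl -p1 -p2.
by rewrite -pv /g gez0_abs ?gcdz_ge0.
Qed.

(** The number of representations is at most 10 d(M)^2, to which [divisor_bound]
    applies with the exponent 2 k. The [.+1] takes care of M = 0. *)
Lemma two_squares_bound k : (0 < k)%N ->
  exists C, forall (M : int) (s : seq (int * int)),
    uniq s -> {in s, forall p, sum2sq p = M} ->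
    (size s ^ k <= C * (`|M|%N).+1)%N.
Proof.
move=> k0; have [C CP] := @divisor_bound (2 * k) ltac:(lia).
exists (10 ^ k * C + 1)%N => M s us sP.
have [s0|] := eqVneq s [::]; first by rewrite s0 exp0n.
case: s us sP => // p s us sP _.
have MM : M = `|M|%N.
  by rewrite gez0_abs// -(sP p (mem_head _ _)) addr_ge0 ?sqr_ge0.
have [M0|M0] := posnP `|M|%N.
  have -> : s = [::].
    have z q : q \in p :: s -> q = 0.
      move=> /sP; rewrite MM M0 /sum2sq => /eqP.
      rewrite paddr_eq0 ?sqr_ge0// !sqrf_eq0 => /andP[/eqP q1 /eqP q2].
      by rewrite [q]surjective_pairing q1 q2.
    case: s us {sP} z => // q s us z.
    have p0 : p = 0 by apply: z; rewrite mem_head.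
    have q0 : q = 0 by apply: z; rewrite !inE eqxx orbT.
    by move: us; rewrite p0 q0.
  by rewrite M0 exp1n muln1 addn1.
have h : (size (p :: s) <= 10 * size (divisors `|M|%N) ^ 2)%N.
  by apply: size_two_squares => // q /sP; rewrite -MM.
rewrite -(leq_exp2r _ _ k0) expnMn -expnM in h.
apply: leq_trans h _; have := CP _ M0; nia.
Qed.

End two_squares.

Section box.
Local Open Scope ring_scope.

(** A box of integer frequencies is parametrized by a finite type, so that sums
    over it are finite sums and its subsets can be counted. *)
Definition centered K (j : 'I_(K.*2.+1)) : int := j%:Z - K%:Z.

Definition box_int n K (i : n.-tuple 'I_(K.*2.+1)) : n.-tuple int :=
  [tuple of map (@centered K) i].

Lemma centered_inj K : injective (@centered K).
Proof. by move=> i j; rewrite /centered => ?; apply: ord_inj; lia. Qed.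

Lemma centered_le K (j : 'I_(K.*2.+1)) : `|centered j| <= K%:Z.
Proof. by rewrite /centered; have := ltn_ord j; lia. Qed.

Lemma box_int_inj n K : injective (@box_int n K).
Proof.
move=> i j ij; apply: eq_from_tnth => u; apply: (@centered_inj K).
by have := congr1 (fun t => tnth t u) ij; rewrite !tnth_map.
Qed.

Lemma box_int_surj n K (k : n.-tuple int) :
  (forall j, `|tnth k j| <= K%:Z) -> exists i, k = @box_int n K i.
Proof.
move=> kK; exists [tuple inord (absz (tnth k j + K%:Z)) | j < n].
apply: eq_from_tnth => j; rewrite /box_int tnth_map tnth_mktuple /centered.
by have := kK j => ?; rewrite inordK; lia.
Qed.

(** The range of M is the one in which [card_sphere_box] needs the count: a
    coordinate of 2 i - k is at most 4 K in size when i and k - i lie in the box. *)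
Definition few_two_squares K B := forall (M : int) (s : seq (int * int)),
  uniq s -> {in s, forall p, sum2sq p = M} ->
  (`|M|%N <= 32 * K ^ 2)%N -> (size s <= B)%N.

(** By the parallelogram law, |i|^2 + |k - i|^2 = l says that 2 i - k lies on the
    sphere of squared radius 2 l - |k|^2. Once all coordinates but the first two
    are chosen, freely in the box, those two form a representation of a fixed
    integer as a sum of two squares. *)
Lemma card_sphere_box n K B (k : n.+2.-tuple int) (l : int) :
  (forall j, `|tnth k j| <= K%:Z *+ 2) ->
  few_two_squares K B ->
  (#|[set i : n.+2.-tuple 'I_(K.*2.+1) | (\sum_j (tnth (box_int i) j ^+ 2
       + (tnth k j - tnth (box_int i) j) ^+ 2) == l)%R]|
    <= B * K.*2.+1 ^ n)%N.
Proof.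
move=> kK BP; set S := finset _.
pose f (i : n.+2.-tuple 'I_(K.*2.+1)) : n.-tuple 'I_(K.*2.+1) :=
  [tuple of behead [tuple of behead i]].
have -> : (K.*2.+1 ^ n = size (enum {: n.-tuple 'I_(K.*2.+1)}))%N.
  by rewrite -cardE card_tuple card_ord.
rewrite cardE.
apply: (leq_size_fibers (f := f)) => [i _|v]; first by rewrite mem_enum.
set t := seq.filter _ _.
have ut : uniq t by rewrite filter_uniq// enum_uniq.
have tP i : i \in t -> f i = v /\ \sum_j (tnth (box_int i) j ^+ 2
       + (tnth k j - tnth (box_int i) j) ^+ 2) = l.
  by rewrite mem_filter mem_enum inE => /andP[/eqP ? /eqP].
pose o1 : 'I_n.+2 := lift ord0 ord0.
pose g (i : n.+2.-tuple 'I_(K.*2.+1)) : int * int :=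
  (2 * tnth (box_int i) ord0 - tnth k ord0, 2 * tnth (box_int i) o1 - tnth k o1).
have tlE i (j : 'I_n) : i \in t ->
    tnth (box_int i) (lift ord0 (lift ord0 j)) = centered (tnth v j).
  move=> /tP[<- _]; rewrite /box_int tnth_map /f.
  rewrite !tnth_behead; congr (centered (tnth _ _)); apply: val_inj.
  by rewrite /= !inordK ?inordK /bump //=; have := ltn_ord j; lia.
have ginj : {in t &, injective g}.
  move=> i i' it i't /eqP; rewrite xpair_eqE => /andP[/eqP e0 /eqP e1].
  apply: box_int_inj; apply: eq_from_tnth => j.
  case: (unliftP ord0 j) => [{}j|] ->; last by move: e0 => /=; lia.
  by case: (unliftP ord0 j) => [{}j|] ->; rewrite ?tlE//; move: e1; rewrite /o1; lia.
have <- : size [seq g i | i <- t] = size t by rewrite size_map.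
pose M := 2 * l - \sum_(j < n) ((2 * centered (tnth v j) - tnth k (lift ord0 (lift ord0 j))) ^+ 2)
    - \sum_j tnth k j ^+ 2.
have gM i : i \in t -> sum2sq (g i) = M.
  move=> it; have [_ lE] := tP i it; rewrite /M -lE !big_ord_recl /= -/o1.
  rewrite /sum2sq /g /=.
  under [X in 2 * (_ + (_ + X))]eq_bigr do rewrite tlE//.
  set x0 := tnth (box_int i) ord0; set x1 := tnth (box_int i) o1.
  rewrite !mulrDr !mulr_sumr.
  have -> : \sum_(i0 < n) 2 * (centered (tnth v i0) ^+ 2 +
      (tnth k (lift ord0 (lift ord0 i0)) - centered (tnth v i0)) ^+ 2) =
    \sum_(i0 < n) (2 * centered (tnth v i0) - tnth k (lift ord0 (lift ord0 i0))) ^+ 2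
    + \sum_(i0 < n) tnth k (lift ord0 (lift ord0 i0)) ^+ 2.
    by rewrite -big_split; apply: eq_bigr => j _ /=; ring.
  by ring.
have [->//|] := eqVneq t [::].
move=> tn0; have [i it] : exists i, i \in t.
  by move: tn0; case: (t) => // i ? _; exists i; rewrite mem_head.
apply: (BP M) => [|p /mapP[j jt ->]|].
- by rewrite map_inj_in_uniq//.
- exact: gM.
have bnd j : (2 * tnth (box_int i) j - tnth k j) ^+ 2 <= 16 * K%:Z ^+ 2.
  have -> : 16 * K%:Z ^+ 2 = (4 * K%:Z) ^+ 2 by ring.
  rewrite -[leLHS]real_normK ?num_real// ler_pXn2r ?nnegrE//.
  have := kK j; have := @centered_le K (tnth i j); rewrite tnth_map mulr2n;
    move: (centered _) (tnth k j) => a b; lia.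
have : M <= 32 * K%:Z ^+ 2.
  rewrite -(gM i it) /sum2sq/=.
  have -> : 32 * K%:Z ^+ 2 = 16 * K%:Z ^+ 2 + 16 * K%:Z ^+ 2 by ring.
  by rewrite lerD.
have : 0 <= M by rewrite -(gM i it) addr_ge0 ?sqr_ge0.
by move: (M) => m ? ?; rewrite -lez_nat PoszM expnS expn1 PoszM gez0_abs//; lia.
Qed.
End box.

Section pairs.
Variables (n K : nat).
Local Notation box := (n.-tuple 'I_(K.*2.+1)).

Definition nsq (i : box) : nat := \sum_j `|tnth (box_int i) j|%N ^ 2.

Definition freq2 (p : box * box) (j : 'I_n) : int :=
  tnth (box_int p.1) j + tnth (box_int p.2) j.

Definition same_freq (p q : box * box) : bool :=
  [tuple freq2 p j - freq2 q j | j < n] == [tuple 0 | _ < n].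

Lemma same_freqP p q : reflect (forall j, freq2 p j = freq2 q j) (same_freq p q).
Proof.
apply: (iffP eqP) => [pq j|pq].
  have := congr1 (fun t => tnth t j) pq; rewrite !tnth_mktuple => /eqP.
  by rewrite subr_eq0 => /eqP.
by apply: eq_from_tnth => j; rewrite !tnth_mktuple pq subrr.
Qed.

Lemma same_freq_sym p q : same_freq p q = same_freq q p.
Proof. by apply/same_freqP/same_freqP => pq j; rewrite pq. Qed.

Lemma nsqE (i : box) : (nsq i)%:Z = \sum_j tnth (box_int i) j ^+ 2.
Proof.
rewrite /nsq -natz natr_sum; apply: eq_bigr => j _.
by rewrite natrX natr_absz -[in RHS]real_normK ?num_real// intz.
Qed.

Lemma nsqRE (R : realType) (i : box) :
  (nsq i)%:R = \sum_j (tnth (box_int i) j)%:~R ^+ 2 :> R.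
Proof.
rewrite /nsq natr_sum; apply: eq_bigr => j _.
by rewrite natrX natr_absz -[in RHS]real_normK ?num_real// intr_norm.
Qed.

Lemma nsq_le (i : box) : (nsq i <= n * K ^ 2)%N.
Proof.
have -> : (n * K ^ 2 = \sum_(j < n) K ^ 2)%N by rewrite sum_nat_const card_ord.
apply: leq_sum => j _; rewrite leq_exp2r//.
by have := centered_le (tnth i j); rewrite tnth_map; lia.
Qed.

End pairs.

(** The second frequency is determined by the first and the sum, so that pairs
    are counted by [card_sphere_box]. *)
Lemma card_pairs n K B (q : (n.+2.-tuple 'I_(K.*2.+1)) * (n.+2.-tuple 'I_(K.*2.+1)))
    (l : nat) :
  few_two_squares K B ->
  (#|[set p | same_freq q p & (nsq p.1 + nsq p.2 == l)%N]| <= B * K.*2.+1 ^ n)%N.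
Proof.
move=> BP; pose k : n.+2.-tuple int := [tuple freq2 q j | j < n.+2].
have kK j : `|tnth k j| <= K%:Z *+ 2.
  rewrite tnth_mktuple /freq2 !tnth_map mulr2n.
  by rewrite (le_trans (ler_normD _ _))// lerD// centered_le.
apply: leq_trans (card_sphere_box l%:Z kK BP).
set S := [set p | _ & _].
have Sk p : p \in S -> forall j, tnth (box_int p.2) j = tnth k j - tnth (box_int p.1) j.
  rewrite inE => /andP[/same_freqP pq _] j.
  by rewrite tnth_mktuple pq /freq2 addrC addKr.
have inj1 : {in S &, injective fst}.
  move=> p p' pS p'S pp'; have e2 : p.2 = p'.2.
    apply: box_int_inj; apply: eq_from_tnth => j.
    by rewrite (Sk p)// (Sk p')// pp'.
  by rewrite (surjective_pairing p) (surjective_pairing p') pp' e2.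
rewrite -(card_in_imset inj1); apply: subset_leq_card.
apply/fintype.subsetP => i /imsetP[p pS ->]; rewrite inE; apply/eqP.
have := pS; rewrite inE => /andP[_ /eqP <-].
rewrite PoszD !nsqE -big_split/=; apply: eq_bigr => j _.
by rewrite -(Sk p).
Qed.

Local Open Scope classical_set_scope.
Local Open Scope ring_scope.

(** * Schur's test for oscillatory integrals *)

Lemma measurable_cos_comp d (X : measurableType d) (R : realType) (f : X -> R) :
  measurable_fun setT f -> measurable_fun setT (fun x => cos (f x)).
Proof.
move=> mf; apply: (measurableT_comp (f := cos)) => //.
by apply: continuous_measurable_fun; exact: continuous_cos.
Qed.

Lemma measurable_sin_comp d (X : measurableType d) (R : realType) (f : X -> R) :
  measurable_fun setT f -> measurable_fun setT (fun x => sin (f x)).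
Proof.
move=> mf; apply: (measurableT_comp (f := sin)) => //.
by apply: continuous_measurable_fun; exact: continuous_sin.
Qed.

Section real_integrals.
Context d (X : measurableType d) (R : realType).
Variable mu : {measure set X -> \bar R}.
Implicit Types f g : X -> R.

(** Integrability of a real function, so that the real-valued integral can be
    manipulated without passing through extended reals at each step. *)
Definition rintegrable f := mu.-integrable setT (EFin \o f).

Lemma rintegrable_measurable f : rintegrable f -> measurable_fun setT f.
Proof. by move=> /measurable_int /measurable_EFinP. Qed.

Lemma rintegrable_le f g : measurable_fun setT f -> (forall x, `|f x| <= g x) ->
  rintegrable g -> rintegrable f.
Proof.
move=> mf fg; apply: le_integrable => //; first exact/measurable_EFinP.
by move=> x _ /=; rewrite lee_fin (le_trans (fg x))// ler_norm.
Qed.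

Lemma rintegrableD f g : rintegrable f -> rintegrable g ->
  rintegrable (fun x => f x + g x).
Proof. by move=> fi gi; apply: (integrableD _ fi gi). Qed.

Lemma rintegrableB f g : rintegrable f -> rintegrable g ->
  rintegrable (fun x => f x - g x).
Proof. by move=> fi gi; apply: (integrableB _ fi gi). Qed.

Lemma rintegrableZ f c : rintegrable f -> rintegrable (fun x => c * f x).
Proof. by move=> fi; apply: (integrableZl _ c fi). Qed.

Lemma rintegrable_norm f : rintegrable f -> rintegrable (fun x => `|f x|).
Proof. by move=> fi; apply: (integrable_norm fi). Qed.

Lemma rintegrableM_le1 f (c : X -> R) : rintegrable f -> measurable_fun setT c ->
  (forall x, `|c x| <= 1) -> rintegrable (fun x => f x * c x).
Proof.
move=> fi mc c1; apply: rintegrable_le (rintegrable_norm fi).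
  by apply: measurable_funM => //; exact: rintegrable_measurable fi.
by move=> x; rewrite normrM ler_piMr.
Qed.

Lemma rintegrable_cos f (theta : X -> R) : rintegrable f -> measurable_fun setT theta ->
  rintegrable (fun x => f x * cos (theta x)).
Proof.
move=> fi mt; apply: rintegrableM_le1 => //; last by move=> x; exact: cos_max.
exact: measurable_cos_comp.
Qed.

Lemma rintegrable_sum (I : Type) (s : seq I) (f : I -> X -> R) :
  (forall i, rintegrable (f i)) -> rintegrable (fun x => \sum_(i <- s) f i x).
Proof.
move=> fi; rewrite /rintegrable (_ : _ \o _ = (fun x => \sum_(i <- s) (f i x)%:E)%E).
  by apply: integrable_sum => // i _; exact: fi.
by apply/funext => x /=; rewrite sumEFin.
Qed.

Lemma rintegral_EFin f : rintegrable f ->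
  ((\int[mu]_x f x)%:E = \int[mu]_x (f x)%:E)%E.
Proof. by move=> fi; rewrite /Rintegral fineK//; exact: integrable_fin_num. Qed.

Lemma rintegral_sum (I : Type) (s : seq I) (f : I -> X -> R) :
  (forall i, rintegrable (f i)) ->
  \int[mu]_x (\sum_(i <- s) f i x) = \sum_(i <- s) \int[mu]_x f i x.
Proof.
move=> fi; elim: s => [|i s IH].
  by under eq_Rintegral do rewrite big_nil; rewrite Rintegral_cst// mul0r big_nil.
under eq_Rintegral do rewrite big_cons.
by rewrite RintegralD ?big_cons ?IH//; [exact: fi|exact: rintegrable_sum].
Qed.

Lemma rintegral_norm f : rintegrable f ->
  (`|\int[mu]_x f x|%:E <= \int[mu]_x `|f x|%:E)%E.
Proof.
move=> fi; rewrite EFin_normr_Rintegral//.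
by apply: le_abse_integral => //; exact: measurable_int fi.
Qed.

Lemma eq_rintegral f g : f =1 g -> \int[mu]_x f x = \int[mu]_x g x.
Proof. by move=> fg; apply: eq_Rintegral => x _; exact: fg. Qed.

End real_integrals.

Section product_sigma_finite.
Context d1 d2 (X : measurableType d1) (Y : measurableType d2) (R : realType).
Variable mu : {sigma_finite_measure set X -> \bar R}.
Variable nu : {sigma_finite_measure set Y -> \bar R}.

(** A product of sigma-finite measures carrying its own sigma-finite structure,
    so that products can be iterated. *)
Definition prod_measure : set (X * Y) -> \bar R := (mu \x nu)%E.

HB.instance Definition _ := Measure.on prod_measure.

Lemma prod_measure_sigma_finite : sigma_finite setT prod_measure.
Proof.
have /sigma_finiteP[F [TF ndF Ffin]] := sigma_finiteT mu.
have /sigma_finiteP[G [TG ndG Gfin]] := sigma_finiteT nu.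
exists (fun n => F n `*` G n); last first.
  move=> n; have [mF Foo] := Ffin n; have [mG Goo] := Gfin n.
  split; first exact: measurableX.
  by rewrite [X in (X < _)%E]product_measure1E// lte_mul_pinfty// ge0_fin_numE.
apply/esym/seteqP; split=> // -[x y] _.
have [n _ Fx] : (\bigcup_n F n) x by rewrite -TF.
have [m _ Gy] : (\bigcup_n G n) y by rewrite -TG.
exists (maxn n m) => //; split.
  exact: (subsetPset _ _ (ndF _ _ (leq_maxl n m))).
exact: (subsetPset _ _ (ndG _ _ (leq_maxr n m))).
Qed.

HB.instance Definition _ :=
  Measure_isSigmaFinite.Build _ _ _ prod_measure prod_measure_sigma_finite.

End product_sigma_finite.

Section real_fubini.
Context d1 d2 (X : measurableType d1) (Y : measurableType d2) (R : realType).
Variable nu : {sigma_finite_measure set Y -> \bar R}.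

Lemma measurable_Rintegral_param (f : X * Y -> R) : measurable_fun setT f ->
  measurable_fun setT (fun x => \int[nu]_y f (x, y)).
Proof.
move=> mf; have mef : measurable_fun setT (EFin \o f) by exact/measurable_EFinP.
apply: (measurableT_comp (f := fine)) => //.
rewrite (_ : (fun x => _) = (fun x => \int[nu]_y (EFin \o f)^\+ (x, y)
    - \int[nu]_y (EFin \o f)^\- (x, y))%E).
  apply: emeasurable_funB.
    apply: (measurable_fun_fubini_tonelli_F (EFin \o f)^\+%E) => //.
    exact: (measurable_funepos mef).
  apply: (measurable_fun_fubini_tonelli_F (EFin \o f)^\-%E) => //.
  exact: (measurable_funeneg mef).
by apply/funext => x; rewrite integralE; congr (_ - _)%E;
  apply: eq_integral => y _; rewrite !unlock.
Qed.

Variable mu : {sigma_finite_measure set X -> \bar R}.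

Lemma rintegrable_tensor (f : X -> R) (g : Y -> R) :
  rintegrable mu f -> rintegrable nu g ->
  rintegrable (mu \x nu)%E (fun p => f p.1 * g p.2).
Proof.
move=> fi gi.
have mf := rintegrable_measurable fi; have mg := rintegrable_measurable gi.
apply/integrable12ltyP.
  by apply/measurable_EFinP; apply: measurable_funM; apply: measurableT_comp.
under eq_integral => x _.
  under eq_integral do rewrite /= normrM EFinM.
  rewrite ge0_integralZl//; last exact/measurable_EFinP/measurableT_comp.
  over.
rewrite ge0_integralZr//; last 2 first.
  exact/measurable_EFinP/measurableT_comp.
  by apply: integral_ge0.
apply: lte_mul_pinfty; first exact: integral_ge0.
  rewrite ge0_fin_numE; last exact: integral_ge0.
  by case/integrableP : fi.
by case/integrableP : gi.
Qed.

Lemma rintegral_fubini1 (f : X * Y -> R) : rintegrable (mu \x nu)%E f ->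
  (forall x, rintegrable nu (fun y => f (x, y))) ->
  \int[(mu \x nu)%E]_p f p = \int[mu]_x \int[nu]_y f (x, y).
Proof.
move=> fi fx; rewrite /Rintegral -(integral12_prod_meas1 fi).
by congr fine; apply: eq_integral => x _; rewrite (rintegral_EFin (fx x)).
Qed.

Lemma rintegral_fubini2 (f : X * Y -> R) : rintegrable (mu \x nu)%E f ->
  (forall y, rintegrable mu (fun x => f (x, y))) ->
  \int[(mu \x nu)%E]_p f p = \int[nu]_y \int[mu]_x f (x, y).
Proof.
move=> fi fx; rewrite /Rintegral -(integral21_prod_meas1 fi).
by congr fine; apply: eq_integral => x _; rewrite (rintegral_EFin (fx x)).
Qed.

Lemma rintegrable_fubini1 (f : X * Y -> R) : rintegrable (mu \x nu)%E f ->
  (forall x, rintegrable nu (fun y => f (x, y))) ->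
  rintegrable mu (fun x => \int[nu]_y f (x, y)).
Proof.
move=> fi fx; rewrite /rintegrable (_ : _ \o _ = fubini_F nu (EFin \o f)).
  exact: integrable_fubini_F.
by apply/funext => x /=; rewrite (rintegral_EFin (fx x)).
Qed.

Lemma rintegral_tensor (f : X -> R) (g : Y -> R) :
  rintegrable mu f -> rintegrable nu g ->
  \int[(mu \x nu)%E]_p (f p.1 * g p.2) = (\int[mu]_x f x) * (\int[nu]_y g y).
Proof.
move=> fi gi; rewrite rintegral_fubini1; last 2 first.
- exact: rintegrable_tensor.
- by move=> x /=; apply: rintegrableZ.
rewrite -RintegralZr//; apply: eq_rintegral => x /=.
by rewrite RintegralZl.
Qed.

End real_fubini.

Section ttstar.
Context d1 d2 (X : measurableType d1) (Y : measurableType d2) (R : realType).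
Variable mu : {sigma_finite_measure set X -> \bar R}.
Variable nu : {sigma_finite_measure set Y -> \bar R}.

Local Notation nn := (prod_measure nu nu).

Section bilinear.
Variables (w : X -> R) (f g : X * Y -> R) (F G : Y -> R).
Hypotheses (wi : rintegrable mu w) (Fi : rintegrable nu F) (Gi : rintegrable nu G).
Hypotheses (mf : measurable_fun setT f) (mg : measurable_fun setT g).
Hypotheses (fF : forall x y, `|f (x, y)| <= F y) (gG : forall x y, `|g (x, y)| <= G y).

Let h (q : (Y * Y) * X) := w q.2 * (f (q.2, q.1.1) * g (q.2, q.1.2)).

Let mw : measurable_fun setT w. Proof. exact: rintegrable_measurable wi. Qed.

Let mh : measurable_fun setT h.
Proof.
apply: measurable_funM; first exact: measurableT_comp.
apply: measurable_funM.
  apply: (measurableT_comp mf); apply: measurable_fun_pair => //.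
  by apply: (measurableT_comp (f := fst)).
apply: (measurableT_comp mg); apply: measurable_fun_pair => //.
by apply: (measurableT_comp (f := snd)).
Qed.

Let hle q : `|h q| <= (F q.1.1 * G q.1.2) * `|w q.2|.
Proof.
by rewrite /h normrM mulrC ler_wpM2r// normrM ler_pM.
Qed.

Let hi : rintegrable (nn \x mu)%E h.
Proof.
apply: (rintegrable_le mh hle).
have FGi : rintegrable nn (fun p => F p.1 * G p.2) by exact: rintegrable_tensor.
exact: (rintegrable_tensor FGi (rintegrable_norm wi)).
Qed.

Let hx p : rintegrable mu (fun x => h (p, x)).
Proof.
apply: (rintegrable_le (g := fun x => (F p.1 * G p.2) * `|w x|)).
- exact: measurableT_comp mh (measurable_pair1 p).
- by move=> x; exact: hle.
- by apply: rintegrableZ; exact: rintegrable_norm.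
Qed.

Let fi x : rintegrable nu (fun y => f (x, y)).
Proof.
apply: rintegrable_le (fF x) Fi.
exact: measurableT_comp mf (measurable_pair1 x).
Qed.

Let gi x : rintegrable nu (fun y => g (x, y)).
Proof.
apply: rintegrable_le (gG x) Gi.
exact: measurableT_comp mg (measurable_pair1 x).
Qed.

Let hp x : rintegrable nn (fun p => h (p, x)).
Proof. exact: (rintegrableZ (w x) (rintegrable_tensor (fi x) (gi x))). Qed.

Let hpE x : \int[nn]_p h (p, x) =
  w x * ((\int[nu]_y f (x, y)) * \int[nu]_y g (x, y)).
Proof. by rewrite -rintegral_tensor// -RintegralZl//; exact: (rintegrable_tensor (fi x) (gi x)). Qed.

Lemma rintegrable_bilinear1 :
  rintegrable mu (fun x => w x * ((\int[nu]_y f (x, y)) * \int[nu]_y g (x, y))).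
Proof.
have wFG : rintegrable mu (fun x => ((\int[nu]_y F y) * (\int[nu]_y G y)) * `|w x|).
  by apply: rintegrableZ; exact: rintegrable_norm.
apply: rintegrable_le wFG.
  apply: measurable_funM => //.
  by apply: measurable_funM; exact: measurable_Rintegral_param.
move=> x; rewrite normrM mulrC ler_wpM2r// normrM ler_pM//.
  apply: (le_trans (le_normr_Rintegral measurableT (fi x))).
  by apply: le_Rintegral => //; exact: rintegrable_norm.
apply: (le_trans (le_normr_Rintegral measurableT (gi x))).
by apply: le_Rintegral => //; exact: rintegrable_norm.
Qed.

Lemma rintegrable_bilinear2 : rintegrable nn
  (fun p => \int[mu]_x (w x * (f (x, p.1) * g (x, p.2)))).
Proof. exact: (rintegrable_fubini1 hi hx). Qed.

Lemma rintegrable_bilinear3 p : rintegrable mu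
  (fun x => w x * (f (x, p.1) * g (x, p.2))).
Proof. exact: (hx p). Qed.

(** Fubini for the quadratic expression that appears when the square of an
    oscillatory integral is expanded; everything is dominated by F(y) G(y') |w(x)|. *)
Lemma rintegral_bilinear :
  \int[mu]_x (w x * ((\int[nu]_y f (x, y)) * \int[nu]_y g (x, y))) =
  \int[nn]_p \int[mu]_x (w x * (f (x, p.1) * g (x, p.2))).
Proof.
rewrite -[RHS](rintegral_fubini1 hi hx) (rintegral_fubini2 hi hp).
by apply: eq_rintegral => x; rewrite hpE.
Qed.

End bilinear.

Section schur.
Variables (I : finType) (a b : I -> Y -> R) (kappa : I -> I -> Y * Y -> R) (M : R).
Hypotheses (ma : forall i, measurable_fun setT (a i)) (mb : forall i, measurable_fun setT (b i)).
Hypothesis M0 : 0 <= M.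
Hypothesis mk : forall i j, measurable_fun setT (kappa i j).
Hypothesis k0 : forall i j p, 0 <= kappa i j p.
Hypothesis ksym : forall i j y y', kappa i j (y, y') = kappa j i (y', y).
Hypothesis kM : forall i y,
  (\sum_j \int[nu]_y' (kappa i j (y, y'))%:E <= M%:E)%E.

Let N i y := a i y ^+ 2 + b i y ^+ 2.

Let mN i : measurable_fun setT (N i).
Proof. by apply: measurable_funD; exact: measurable_funX. Qed.

Let N0 i y : 0 <= N i y. Proof. by rewrite addr_ge0// sqr_ge0. Qed.

(** One half of Schur's test: in the sum of |c_p|^2 kappa(p, q), integrate over
    q first. *)
Lemma schur_left :
  (\sum_i \sum_j \int[nn]_p (N i p.1 * kappa i j p)%:E <=
   M%:E * \sum_i \int[nu]_y (N i y)%:E)%E.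
Proof.
have mk2 i j : measurable_fun setT (fun y => \int[nu]_y' (kappa i j (y, y'))%:E)%E.
  apply: (measurable_fun_fubini_tonelli_F (EFin \o kappa i j)) => //.
    exact/measurable_EFinP.
  by move=> p; rewrite lee_fin.
have mk1 i j y : measurable_fun setT (fun y' => (kappa i j (y, y'))%:E).
  apply/measurable_EFinP; exact: measurableT_comp (mk i j) (measurable_pair1 y).
have ik0 i j y : (0 <= \int[nu]_y' (kappa i j (y, y'))%:E)%E.
  by apply: integral_ge0 => y' _; rewrite lee_fin.
rewrite ge0_sume_distrr; last first.
  by move=> i _; apply: integral_ge0 => y _; rewrite lee_fin.
apply: lee_sum => i _.
have E j : (\int[nn]_p (N i p.1 * kappa i j p)%:E =
    \int[nu]_y ((N i y)%:E * \int[nu]_y' (kappa i j (y, y'))%:E))%E.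
  rewrite fubini_tonelli1/=; last 2 first.
  - apply/measurable_EFinP; apply: measurable_funM => //.
    exact: measurableT_comp.
  - by move=> p; rewrite lee_fin mulr_ge0.
  apply: eq_integral => y _; rewrite /fubini_F/=.
  under eq_integral do rewrite EFinM.
  by rewrite ge0_integralZl ?lee_fin// => *; rewrite lee_fin.
under eq_bigr do rewrite E.
rewrite -ge0_integral_sum//; last 2 first.
- by move=> j; apply: emeasurable_funM => //; exact/measurable_EFinP.
- by move=> j y _; rewrite mule_ge0 ?lee_fin.
rewrite -ge0_integralZl//; last 2 first.
- exact/measurable_EFinP.
- by move=> y _; rewrite lee_fin.
apply: ge0_le_integral => //.
- by move=> y _; apply: sume_ge0 => j _; rewrite mule_ge0 ?lee_fin.
- apply: emeasurable_sum => j; apply: emeasurable_funM => //; exact/measurable_EFinP.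
- by apply: emeasurable_funM => //; exact/measurable_EFinP.
move=> y _; rewrite -ge0_sume_distrr//.
by rewrite muleC lee_wpmul2r ?lee_fin.
Qed.

Lemma schur_right :
  (\sum_i \sum_j \int[nn]_p (N j p.2 * kappa i j p)%:E <=
   M%:E * \sum_i \int[nu]_y (N i y)%:E)%E.
Proof.
apply: le_trans schur_left; rewrite exchange_big/=.
apply: lee_sum => i _; apply: lee_sum => j _.
rewrite fubini_tonelli2/=; last 2 first.
- apply/measurable_EFinP; apply: measurable_funM => //.
  exact: measurableT_comp.
- by move=> p; rewrite lee_fin mulr_ge0.
rewrite fubini_tonelli1/=; last 2 first.
- apply/measurable_EFinP; apply: measurable_funM => //.
  exact: measurableT_comp.
- by move=> p; rewrite lee_fin mulr_ge0.
rewrite /fubini_F /fubini_G/= le_eqVlt; apply/orP; left; apply/eqP.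
apply: eq_integral => y _; apply: eq_integral => y' _ /=.
by rewrite ksym.
Qed.

Variables (w : X -> R) (theta : I -> X * Y -> R).
Hypothesis wi : rintegrable mu w.
Hypotheses (ai : forall i, rintegrable nu (a i)) (bi : forall i, rintegrable nu (b i)).
Hypothesis mtheta : forall i, measurable_fun setT (theta i).
Hypothesis kP : forall i j y y' c,
  `|\int[mu]_x (w x * cos (c + (theta i (x, y) - theta j (x, y'))))| <= kappa i j (y, y').

(** Real and imaginary parts of the integral of (a_i + i b_i) exp(i theta_i). *)
Definition osc_re i x :=
  \int[nu]_y (a i y * cos (theta i (x, y)) - b i y * sin (theta i (x, y))).
Definition osc_im i x :=
  \int[nu]_y (a i y * sin (theta i (x, y)) + b i y * cos (theta i (x, y))).

Let al i (q : X * Y) := a i q.2 * cos (theta i q) - b i q.2 * sin (theta i q).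
Let be i (q : X * Y) := a i q.2 * sin (theta i q) + b i q.2 * cos (theta i q).
Let F i y := `|a i y| + `|b i y|.

Let Fi i : rintegrable nu (F i).
Proof. by apply: rintegrableD; exact: rintegrable_norm. Qed.

Let mcos i : measurable_fun setT (fun q => cos (theta i q)).
Proof.
exact: measurable_cos_comp.
Qed.

Let msin i : measurable_fun setT (fun q => sin (theta i q)).
Proof.
exact: measurable_sin_comp.
Qed.

Let mal i : measurable_fun setT (al i).
Proof.
by apply: measurable_funB; apply: measurable_funM => //; exact: measurableT_comp.
Qed.

Let mbe i : measurable_fun setT (be i).
Proof.
by apply: measurable_funD; apply: measurable_funM => //; exact: measurableT_comp.
Qed.

Let alF i x y : `|al i (x, y)| <= F i y.
Proof.
rewrite /al /F/=; apply: le_trans (ler_normB _ _) _; rewrite !normrM lerD//.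
  by rewrite ler_piMr// cos_max.
by rewrite ler_piMr// sin_max.
Qed.

Let beF i x y : `|be i (x, y)| <= F i y.
Proof.
rewrite /be /F/=; apply: le_trans (ler_normD _ _) _; rewrite !normrM lerD//.
  by rewrite ler_piMr// sin_max.
by rewrite ler_piMr// cos_max.
Qed.

Let T i j (p : Y * Y) := \int[mu]_x (w x * (al i (x, p.1) * al j (x, p.2))) +
  \int[mu]_x (w x * (be i (x, p.1) * be j (x, p.2))).

Let Ti i j : rintegrable nn (T i j).
Proof.
apply: rintegrableD.
  by apply: (rintegrable_bilinear2 wi (Fi i) (Fi j)).
by apply: (rintegrable_bilinear2 wi (Fi i) (Fi j)).
Qed.

(* The phase only enters through the two integrals of w cos and w sin of the
   difference of phases, both controlled by kappa; the amplitudes are split by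
   2 |c c'| <= |c|^2 + |c'|^2. The constant c in the hypothesis on kappa turns
   cosine into sine. *)
Let Tle i j p : `|T i j p| <= (N i p.1 + N j p.2) * kappa i j p.
Proof.
case: p => y y'; rewrite /T /= -RintegralD//; last 2 first.
- exact: (rintegrable_bilinear3 wi (mal i) (mal j) (alF i) (alF j) (y, y')).
- exact: (rintegrable_bilinear3 wi (mbe i) (mbe j) (beF i) (beF j) (y, y')).
pose D x := theta i (x, y) - theta j (x, y').
pose P := a i y * a j y' + b i y * b j y'.
pose Q := b i y * a j y' - a i y * b j y'.
have mD : measurable_fun setT D.
  by apply: measurable_funB; apply: measurableT_comp (measurable_pair2 _).
have mD2 : measurable_fun setT (fun x => pi / 2 + D x) by exact: measurable_funD.
rewrite (eq_rintegral _ (g := fun x => P * (w x * cos (D x)) +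
    Q * (w x * cos (pi / 2 + D x)))); last first.
  move=> x; rewrite /al /be /= [pi / 2 + _]addrC cosDpihalf /D cosB sinB /P /Q.
  by ring.
rewrite RintegralD//; [|exact/rintegrableZ/rintegrable_cos|exact/rintegrableZ/rintegrable_cos].
rewrite !RintegralZl//; [|exact: rintegrable_cos|exact: rintegrable_cos].
apply: le_trans (ler_normD _ _) _; rewrite !normrM.
have k1 : `|\int[mu]_x (w x * cos (D x))| <= kappa i j (y, y').
  by have := kP i j y y' 0; under eq_rintegral do rewrite add0r.
have k2 := kP i j y y' (pi / 2).
apply: (@le_trans _ _ (`|P| * kappa i j (y, y') + `|Q| * kappa i j (y, y'))).
  by rewrite lerD// ler_wpM2l.
rewrite -mulrDl ler_wpM2r// /P /Q /N.
have h (u v : R) r : u <= r -> - u <= r -> v <= r -> - v <= r -> `|u| + `|v| <= r + r.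
  by move=> *; rewrite lerD// ler_norml; apply/andP; split; lra.
have -> : a i y ^+ 2 + b i y ^+ 2 + (a j y' ^+ 2 + b j y' ^+ 2) =
  (a i y ^+ 2 + b i y ^+ 2 + (a j y' ^+ 2 + b j y' ^+ 2)) / 2 +
  (a i y ^+ 2 + b i y ^+ 2 + (a j y' ^+ 2 + b j y' ^+ 2)) / 2 by field.
move: (a i y) (b i y) (a j y') (b j y') => u v u' v'.
apply: h.
- by have := sqr_ge0 (u - u'); have := sqr_ge0 (v - v'); nra.
- by have := sqr_ge0 (u + u'); have := sqr_ge0 (v + v'); nra.
- by have := sqr_ge0 (v - u'); have := sqr_ge0 (u + v'); nra.
- by have := sqr_ge0 (v + u'); have := sqr_ge0 (u - v'); nra.
Qed.

(** The T T^* method. Expanding the square and integrating over x first, the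
    left-hand side is a quadratic form in the amplitudes whose kernel is the
    integral of w against the difference of two phases. This kernel is dominated
    by the symmetric kernel kappa, whose row sums are at most M: Schur's test.
    The factor 2 comes from treating cosine and sine separately. *)
Lemma ttstar :
  (\int[mu]_x (w x * ((\sum_i osc_re i x) ^+ 2 + (\sum_i osc_im i x) ^+ 2))%:E <=
   (2 * M)%:E * \sum_i \int[nu]_y (a i y ^+ 2 + b i y ^+ 2)%:E)%E.
Proof.
have i1 i j : rintegrable mu (fun x => w x * (osc_re i x * osc_re j x)).
  exact: (rintegrable_bilinear1 wi (Fi i) (Fi j) (mal i) (mal j) (alF i) (alF j)).
have i2 i j : rintegrable mu (fun x => w x * (osc_im i x * osc_im j x)).
  exact: (rintegrable_bilinear1 wi (Fi i) (Fi j) (mbe i) (mbe j) (beF i) (beF j)).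
have E x : w x * ((\sum_i osc_re i x) ^+ 2 + (\sum_i osc_im i x) ^+ 2) =
    \sum_i \sum_j (w x * (osc_re i x * osc_re j x) + w x * (osc_im i x * osc_im j x)).
  rewrite !expr2 mulrDr !mulr_suml !mulr_sumr -big_split/=; apply: eq_bigr => i _.
  by rewrite !mulr_sumr -big_split.
have i3 i : rintegrable mu (fun x =>
    \sum_j (w x * (osc_re i x * osc_re j x) + w x * (osc_im i x * osc_im j x))).
  by apply: rintegrable_sum => j; apply: rintegrableD.
under eq_integral do rewrite E.
rewrite -rintegral_EFin; last exact: rintegrable_sum.
have -> : \int[mu]_x (\sum_i \sum_j (w x * (osc_re i x * osc_re j x)
      + w x * (osc_im i x * osc_im j x))) =
    \sum_i \sum_j \int[nn]_p T i j p.
  rewrite rintegral_sum//; apply: eq_bigr => i _.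
  rewrite rintegral_sum//; last by move=> j; exact: rintegrableD.
  apply: eq_bigr => j _.
  rewrite (RintegralD measurableT (i1 i j) (i2 i j)).
  rewrite [RHS](RintegralD measurableT
    (rintegrable_bilinear2 wi (Fi i) (Fi j) (mal i) (mal j) (alF i) (alF j))
    (rintegrable_bilinear2 wi (Fi i) (Fi j) (mbe i) (mbe j) (beF i) (beF j))).
  rewrite -(rintegral_bilinear wi (Fi i) (Fi j) (mal i) (mal j) (alF i) (alF j)).
  by rewrite -(rintegral_bilinear wi (Fi i) (Fi j) (mbe i) (mbe j) (beF i) (beF j)).
apply: (@le_trans _ _ (\sum_i \sum_j (\int[nn]_p (N i p.1 * kappa i j p)%:E
    + \int[nn]_p (N j p.2 * kappa i j p)%:E))%E); last first.
  under eq_bigr do rewrite big_split/=; rewrite big_split/=.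
  rewrite (_ : 2 * M = M + M); last by ring.
  rewrite EFinD ge0_muleDl ?lee_fin//.
  by apply: leeD; [exact: schur_left|exact: schur_right].
rewrite -sumEFin; apply: lee_sum => i _; rewrite -sumEFin; apply: lee_sum => j _.
apply: (@le_trans _ _ (`|\int[nn]_p T i j p|%:E)).
  by rewrite lee_fin ler_norm.
apply: (le_trans (rintegral_norm (Ti i j))).
have m1 : measurable_fun setT (fun p : Y * Y => (N i p.1 * kappa i j p)%:E).
  by apply/measurable_EFinP; apply: measurable_funM => //; exact: measurableT_comp.
have m2 : measurable_fun setT (fun p : Y * Y => (N j p.2 * kappa i j p)%:E).
  by apply/measurable_EFinP; apply: measurable_funM => //; exact: measurableT_comp.
rewrite -ge0_integralD//; last 2 first.
- by move=> p _; rewrite lee_fin mulr_ge0.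
- by move=> p _; rewrite lee_fin mulr_ge0.
apply: ge0_le_integral => //.
- by apply/measurable_EFinP/measurableT_comp => //; apply: rintegrable_measurable (Ti i j).
- exact: emeasurable_funD.
move=> p _; rewrite -EFinD lee_fin -mulrDl; exact: Tle.
Qed.

End schur.

End ttstar.

Lemma measurable_osc d1 d2 (X : measurableType d1) (Y : measurableType d2)
    (R : realType) (nu : {sigma_finite_measure set Y -> \bar R}) (I : finType)
    (a b : I -> Y -> R) (theta : I -> X * Y -> R) (i : I) :
  measurable_fun setT (a i) -> measurable_fun setT (b i) ->
  measurable_fun setT (theta i) ->
  measurable_fun setT (osc_re nu a b theta i) /\
  measurable_fun setT (osc_im nu a b theta i).
Proof.
move=> ma mb mth.
have mc : measurable_fun setT (fun q => cos (theta i q)).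
  exact: measurable_cos_comp.
have ms : measurable_fun setT (fun q => sin (theta i q)).
  exact: measurable_sin_comp.
have m2 (f : Y -> R) : measurable_fun setT f -> measurable_fun setT (fun q : X * Y => f q.2).
  by move=> mf; exact: (measurableT_comp mf measurable_snd).
split.
  apply: (@measurable_Rintegral_param _ _ _ _ _ _ (fun q : X * Y =>
    a i q.2 * cos (theta i q) - b i q.2 * sin (theta i q))).
  by apply: measurable_funB; apply: measurable_funM => //; exact: m2.
apply: (@measurable_Rintegral_param _ _ _ _ _ _ (fun q : X * Y =>
  a i q.2 * sin (theta i q) + b i q.2 * cos (theta i q))).
by apply: measurable_funD; apply: measurable_funM => //; exact: m2.
Qed.

Section dual.
Context d1 d2 (X : measurableType d1) (Y : measurableType d2) (R : realType).
Variable mu : {sigma_finite_measure set X -> \bar R}.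
Variable nu : {sigma_finite_measure set Y -> \bar R}.

Section adjoint.
Variables (a b : X -> R) (g1 g2 : Y -> R) (theta : X * Y -> R).
Hypotheses (ai : rintegrable mu a) (bi : rintegrable mu b).
Hypotheses (g1i : rintegrable nu g1) (g2i : rintegrable nu g2).
Hypothesis mt : measurable_fun setT theta.

Let h (p : X * Y) := g1 p.2 * (a p.1 * cos (theta p) + b p.1 * sin (theta p))
  + g2 p.2 * (b p.1 * cos (theta p) - a p.1 * sin (theta p)).

Let mcos : measurable_fun setT (fun q => cos (theta q)).
Proof.
exact: measurable_cos_comp.
Qed.

Let msin : measurable_fun setT (fun q => sin (theta q)).
Proof.
exact: measurable_sin_comp.
Qed.

Let ma := rintegrable_measurable ai.
Let mb := rintegrable_measurable bi.
Let mg1 := rintegrable_measurable g1i.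
Let mg2 := rintegrable_measurable g2i.

Let mh : measurable_fun setT h.
Proof.
apply: measurable_funD; apply: measurable_funM; try exact: measurableT_comp.
  by apply: measurable_funD; apply: measurable_funM => //; exact: measurableT_comp.
by apply: measurable_funB; apply: measurable_funM => //; exact: measurableT_comp.
Qed.

Let bnd (u v t : R) : `|u * cos t + v * sin t| <= `|u| + `|v|.
Proof.
rewrite (le_trans (ler_normD _ _))// !normrM lerD//.
  by rewrite ler_piMr// cos_max.
by rewrite ler_piMr// sin_max.
Qed.

Let hle p : `|h p| <= (`|a p.1| + `|b p.1|) * (`|g1 p.2| + `|g2 p.2|).
Proof.
rewrite /h (le_trans (ler_normD _ _))// !normrM mulrC mulrDl.
have -> : b p.1 * cos (theta p) - a p.1 * sin (theta p) =
  b p.1 * cos (theta p) + (- a p.1) * sin (theta p) by ring.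
rewrite [leRHS]addrC; apply: le_trans (lerD (ler_wpM2r _ (bnd _ _ _))
   (ler_wpM2l _ (bnd _ _ _))) _ => //.
rewrite normrN; lra.
Qed.

Let hi : rintegrable (mu \x nu)%E h.
Proof.
apply: (rintegrable_le mh hle).
exact: (rintegrable_tensor (rintegrableD (rintegrable_norm ai) (rintegrable_norm bi))
  (rintegrableD (rintegrable_norm g1i) (rintegrable_norm g2i))).
Qed.

Let hx x : rintegrable nu (fun y => h (x, y)).
Proof.
apply: (rintegrable_le (g := fun y => (`|a x| + `|b x|) * (`|g1 y| + `|g2 y|))).
- exact: measurableT_comp mh (measurable_pair1 x).
- by move=> y; exact: hle.
- by apply: rintegrableZ; apply: rintegrableD; exact: rintegrable_norm.
Qed.

Let hy y : rintegrable mu (fun x => h (x, y)).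
Proof.
apply: (rintegrable_le (g := fun x => (`|g1 y| + `|g2 y|) * (`|a x| + `|b x|))).
- exact: measurableT_comp mh (measurable_pair2 y).
- by move=> x; rewrite mulrC; exact: hle.
- by apply: rintegrableZ; apply: rintegrableD; exact: rintegrable_norm.
Qed.

(** The transform of a + i b, with kernel exp(-i theta), from functions on X to
    functions on Y, and the extension of g1 + i g2, with kernel exp(i theta), back
    to X. The two operators are adjoint ([rintegral_adjoint]). *)
Definition fhat_re y := \int[mu]_x (a x * cos (theta (x, y)) + b x * sin (theta (x, y))).
Definition fhat_im y := \int[mu]_x (b x * cos (theta (x, y)) - a x * sin (theta (x, y))).
Definition ext_re x := \int[nu]_y (g1 y * cos (theta (x, y)) - g2 y * sin (theta (x, y))).
Definition ext_im x := \int[nu]_y (g1 y * sin (theta (x, y)) + g2 y * cos (theta (x, y))).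

Let mcx x : measurable_fun setT (fun y => cos (theta (x, y))).
Proof. exact: measurableT_comp mcos (measurable_pair1 x). Qed.
Let msx x : measurable_fun setT (fun y => sin (theta (x, y))).
Proof. exact: measurableT_comp msin (measurable_pair1 x). Qed.
Let mcy y : measurable_fun setT (fun x => cos (theta (x, y))).
Proof. exact: measurableT_comp mcos (measurable_pair2 y). Qed.
Let msy y : measurable_fun setT (fun x => sin (theta (x, y))).
Proof. exact: measurableT_comp msin (measurable_pair2 y). Qed.

Let hyE y : \int[mu]_x h (x, y) = g1 y * fhat_re y + g2 y * fhat_im y.
Proof.
have i1 := rintegrableM_le1 ai (mcy y) (fun x => cos_max _).
have i2 := rintegrableM_le1 bi (msy y) (fun x => sin_max _).
have i3 := rintegrableM_le1 bi (mcy y) (fun x => cos_max _).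
have i4 := rintegrableM_le1 ai (msy y) (fun x => sin_max _).
rewrite /h/= (RintegralD measurableT (rintegrableZ (g1 y) (rintegrableD i1 i2))
  (rintegrableZ (g2 y) (rintegrableB i3 i4))).
by rewrite (RintegralZl _ measurableT (rintegrableD i1 i2))
  (RintegralZl _ measurableT (rintegrableB i3 i4)).
Qed.

Let hxE x : \int[nu]_y h (x, y) = a x * ext_re x + b x * ext_im x.
Proof.
have i1 := rintegrableM_le1 g1i (mcx x) (fun x => cos_max _).
have i2 := rintegrableM_le1 g2i (msx x) (fun x => sin_max _).
have i3 := rintegrableM_le1 g1i (msx x) (fun x => sin_max _).
have i4 := rintegrableM_le1 g2i (mcx x) (fun x => cos_max _).
rewrite (eq_rintegral _ (g := fun y =>
   a x * (g1 y * cos (theta (x, y)) - g2 y * sin (theta (x, y))) +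
   b x * (g1 y * sin (theta (x, y)) + g2 y * cos (theta (x, y))))); last first.
  by move=> y; rewrite /h/=; ring.
rewrite (RintegralD measurableT (rintegrableZ (a x) (rintegrableB i1 i2))
  (rintegrableZ (b x) (rintegrableD i3 i4))).
by rewrite (RintegralZl _ measurableT (rintegrableB i1 i2))
  (RintegralZl _ measurableT (rintegrableD i3 i4)).
Qed.

Lemma rintegrable_adjoint : rintegrable mu (fun x => a x * ext_re x + b x * ext_im x).
Proof. by have := rintegrable_fubini1 hi hx; apply: eq_integrable => // x _ /=; rewrite hxE. Qed.

Lemma rintegral_adjoint :
  \int[nu]_y (g1 y * fhat_re y + g2 y * fhat_im y) =
  \int[mu]_x (a x * ext_re x + b x * ext_im x).
Proof.
rewrite -(eq_rintegral _ hyE) -(eq_rintegral _ hxE).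
by rewrite -(rintegral_fubini1 hi hx) (rintegral_fubini2 hi hy).
Qed.

Let mthetaS : measurable_fun setT (fun q : Y * X => theta (q.2, q.1)).
Proof. by apply: (measurableT_comp mt); apply: measurable_fun_pair. Qed.

Let mcS : measurable_fun setT (fun q : Y * X => cos (theta (q.2, q.1))).
Proof. by apply: (measurableT_comp mcos); apply: measurable_fun_pair. Qed.
Let msS : measurable_fun setT (fun q : Y * X => sin (theta (q.2, q.1))).
Proof. by apply: (measurableT_comp msin); apply: measurable_fun_pair. Qed.

Lemma measurable_fhat_re : measurable_fun setT fhat_re.
Proof.
apply: (@measurable_Rintegral_param _ _ _ _ _ _ (fun q : Y * X =>
  a q.2 * cos (theta (q.2, q.1)) + b q.2 * sin (theta (q.2, q.1)))).
by apply: measurable_funD; apply: measurable_funM => //; exact: measurableT_comp.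
Qed.

Lemma measurable_fhat_im : measurable_fun setT fhat_im.
Proof.
apply: (@measurable_Rintegral_param _ _ _ _ _ _ (fun q : Y * X =>
  b q.2 * cos (theta (q.2, q.1)) - a q.2 * sin (theta (q.2, q.1)))).
by apply: measurable_funB; apply: measurable_funM => //; exact: measurableT_comp.
Qed.

Lemma fhat_re_bound y : `|fhat_re y| <= \int[mu]_x (`|a x| + `|b x|).
Proof.
have i1 := rintegrableM_le1 ai (mcy y) (fun x => cos_max _).
have i2 := rintegrableM_le1 bi (msy y) (fun x => sin_max _).
apply: (le_trans (le_normr_Rintegral measurableT (rintegrableD i1 i2))).
apply: le_Rintegral => //.
- by apply: rintegrable_norm; exact: rintegrableD.
- by apply: rintegrableD; exact: rintegrable_norm.
Qed.

Lemma fhat_im_bound y : `|fhat_im y| <= \int[mu]_x (`|a x| + `|b x|).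
Proof.
have i3 := rintegrableM_le1 bi (mcy y) (fun x => cos_max _).
have i4 := rintegrableM_le1 ai (msy y) (fun x => sin_max _).
apply: (le_trans (le_normr_Rintegral measurableT (rintegrableB i3 i4))).
apply: le_Rintegral => //.
- by apply: rintegrable_norm; exact: rintegrableB.
- by apply: rintegrableD; exact: rintegrable_norm.
move=> x _; rewrite [leRHS]addrC -(normrN (a x)) -mulNr; exact: bnd.
Qed.

End adjoint.

Section bessel.
Variables (I : finType) (kappa : I -> I -> Y * Y -> R) (M : R).
Variables (w : X -> R) (theta : I -> X * Y -> R).
Hypothesis M0 : 0 < M.
Hypothesis mk : forall i j, measurable_fun setT (kappa i j).
Hypothesis k0 : forall i j p, 0 <= kappa i j p.
Hypothesis ksym : forall i j y y', kappa i j (y, y') = kappa j i (y', y).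
Hypothesis kM : forall i y,
  (\sum_j \int[nu]_y' (kappa i j (y, y'))%:E <= M%:E)%E.
Hypothesis wi : rintegrable mu w.
Hypothesis w0 : forall x, 0 <= w x.
Hypothesis mtheta : forall i, measurable_fun setT (theta i).
Hypothesis kP : forall i j y y' c,
  `|\int[mu]_x (w x * cos (c + (theta i (x, y) - theta j (x, y'))))| <= kappa i j (y, y').

Variables (a b : X -> R) (B : set Y).
Hypotheses (mB : measurable B) (Bfin : (nu B < +oo)%E).
Hypotheses (ai : rintegrable mu a) (bi : rintegrable mu b).
Hypothesis abi : rintegrable mu (fun x => a x ^+ 2 + b x ^+ 2).
Hypothesis abw : forall x, w x < 1 / 2 -> a x = 0 /\ b x = 0.

Let F1 i := fhat_re a b (theta i).
Let F2 i := fhat_im a b (theta i).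
Let G1 i y := F1 i y * \1_B y.
Let G2 i y := F2 i y * \1_B y.

Let i1B (f : Y -> R) C : measurable_fun setT f -> (forall y, `|f y| <= C) ->
  rintegrable nu (fun y => f y * \1_B y).
Proof.
move=> mf fC; have iB : rintegrable nu (\1_B : Y -> R).
  apply/integrableP; split; first exact/measurable_EFinP/measurable_indic.
  under eq_integral do rewrite /= ger0_norm//.
  by rewrite integral_indic// setIT.
apply: (rintegrable_le _ _ (rintegrableZ C iB)).
  by apply: measurable_funM => //; exact: measurable_indic.
by move=> y; rewrite normrM (ger0_norm (_ : 0 <= \1_B y))// ler_wpM2r.
Qed.

Let G1i i : rintegrable nu (G1 i).
Proof. exact: i1B (measurable_fhat_re ai bi (mtheta i)) (fhat_re_bound ai bi (mtheta i)). Qed.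
Let G2i i : rintegrable nu (G2 i).
Proof. exact: i1B (measurable_fhat_im ai bi (mtheta i)) (fhat_im_bound ai bi (mtheta i)). Qed.

Let E i := \int[nu]_y (G1 i y ^+ 2 + G2 i y ^+ 2).

Let G12i i : rintegrable nu (fun y => G1 i y ^+ 2 + G2 i y ^+ 2).
Proof.
have C0 : 0 <= \int[mu]_x (`|a x| + `|b x|).
  by apply: Rintegral_ge0 => x _; exact: addr_ge0.
have mF1 : measurable_fun setT (F1 i) := measurable_fhat_re ai bi (mtheta i).
have mF2 : measurable_fun setT (F2 i) := measurable_fhat_im ai bi (mtheta i).
have sq (u C : R) : `|u| <= C -> `|u ^+ 2| <= C ^+ 2.
  by move=> uC; rewrite normrX ler_pXn2r// nnegrE// (le_trans _ uC).
have := rintegrableD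
  (i1B (measurable_funX 2 mF1) (fun y => sq _ _ (fhat_re_bound ai bi (mtheta i) y)))
  (i1B (measurable_funX 2 mF2) (fun y => sq _ _ (fhat_im_bound ai bi (mtheta i) y))).
apply: eq_integrable => // y _ /=; rewrite /G1 /G2 !exprMn.
by rewrite indicE; case: (_ \in _); rewrite ?expr1n ?expr0n ?mulr1 ?mulr0.
Qed.

Let EE i : E i = \int[mu]_x (a x * ext_re (G1 i) (G2 i) (theta i) x
   + b x * ext_im (G1 i) (G2 i) (theta i) x).
Proof.
rewrite -(rintegral_adjoint ai bi (G1i i) (G2i i) (mtheta i)).
apply: eq_rintegral => y; rewrite /G1 /G2 !exprMn.
rewrite -/(F1 i y) -/(F2 i y) indicE.
by case: (_ \in _); rewrite ?expr1n ?expr0n ?mulr1 ?mulr0 ?mul0r.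
Qed.

(** The dual of [ttstar]. Let G be the transform of a + i b, cut off to B to make
    it square integrable. The mass E of G is the pairing of a + i b with the
    extension of G, by adjointness. The inequality
    u v <= 2 M u^2 + v^2 / (8 M) then gives
    E <= 2 M |a + i b|^2 + (4 M)^-1 (2 M E), where the last term is [ttstar] for
    the extension of G, and can be absorbed. The weight is at least 1/2 where
    a + i b lives, so it can be inserted at the cost of a factor 2. *)
Lemma bessel :
  (\sum_i \int[nu]_(y in B) (F1 i y ^+ 2 + F2 i y ^+ 2)%:E <=
   (4 * M)%:E * \int[mu]_x (a x ^+ 2 + b x ^+ 2)%:E)%E.
Proof.
have -> : (\sum_i \int[nu]_(y in B) (F1 i y ^+ 2 + F2 i y ^+ 2)%:E =
    (\sum_i E i)%:E)%E.
  rewrite -sumEFin; apply: eq_bigr => i _.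
  rewrite /E (rintegral_EFin (G12i i)) [LHS]integral_mkcond.
  apply: eq_integral => y _.
  rewrite patchE /G1 /G2 indicE; case: (_ \in _); rewrite ?mulr1 ?mulr0//.
  by rewrite expr0n addr0.
rewrite -rintegral_EFin// -EFinM lee_fin.
set P := \int[mu]_x _.
pose U x := \sum_i ext_re (G1 i) (G2 i) (theta i) x.
pose V x := \sum_i ext_im (G1 i) (G2 i) (theta i) x.
have tt : (\int[mu]_x (w x * (U x ^+ 2 + V x ^+ 2))%:E <= (2 * M * \sum_i E i)%:E)%E.
  have := ttstar (fun i => rintegrable_measurable (G1i i))
    (fun i => rintegrable_measurable (G2i i)) (ltW M0) mk k0 ksym kM wi G1i G2i mtheta kP.
  move=> H; apply: (le_trans H); rewrite [leRHS]EFinM -sumEFin.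
  by under eq_bigr => i _ do rewrite -(rintegral_EFin (G12i i)).
have mosc i := measurable_osc nu (rintegrable_measurable (G1i i))
  (rintegrable_measurable (G2i i)) (mtheta i).
have mU : measurable_fun setT U by apply: measurable_sum => i; exact: (mosc i).1.
have mV : measurable_fun setT V by apply: measurable_sum => i; exact: (mosc i).2.
have mw := rintegrable_measurable wi.
have wUVi : rintegrable mu (fun x => w x * (U x ^+ 2 + V x ^+ 2)).
  apply/integrableP; split.
    apply/measurable_EFinP; apply: measurable_funM => //.
    by apply: measurable_funD; exact: measurable_funX.
  under eq_integral => x _ do
    rewrite /= ger0_norm ?mulr_ge0// ?addr_ge0 ?sqr_ge0//.
  by apply: (le_lt_trans tt); rewrite ltry.
rewrite -rintegral_EFin// lee_fin in tt.
have M4 : 0 <= (4 * M)^-1 by rewrite invr_ge0 mulr_ge0// ltW.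
have M8 : 0 <= (8 * M)^-1 by rewrite invr_ge0 mulr_ge0// ltW.
have Mn0 : M != 0 by rewrite gt_eqF.
have abUV x : a x * U x + b x * V x <=
    2 * M * (a x ^+ 2 + b x ^+ 2) + (4 * M)^-1 * (w x * (U x ^+ 2 + V x ^+ 2)).
  have UV0 : 0 <= U x ^+ 2 + V x ^+ 2 by rewrite addr_ge0 ?sqr_ge0.
  have [wx|wx] := ltP (w x) (1 / 2).
    have [-> ->] := abw wx; rewrite !mul0r addr0 expr0n addr0 mulr0 add0r.
    by apply: mulr_ge0 => //; exact: mulr_ge0.
  have h1 : (8 * M)^-1 * (U x ^+ 2 + V x ^+ 2) <= (4 * M)^-1 * (w x * (U x ^+ 2 + V x ^+ 2)).
    have -> : (8 * M)^-1 * (U x ^+ 2 + V x ^+ 2) =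
      (4 * M)^-1 * (1 / 2 * (U x ^+ 2 + V x ^+ 2)) by field.
    by apply: ler_wpM2l => //; exact: ler_wpM2r.
  apply: le_trans (lerD (lexx _) h1).
  have e (u v : R) : u * v <= 2 * M * u ^+ 2 + (8 * M)^-1 * v ^+ 2.
    have := sqr_ge0 (4 * M * u - v).
    have -> : 2 * M * u ^+ 2 + (8 * M)^-1 * v ^+ 2 =
      (8 * M)^-1 * ((4 * M * u - v) ^+ 2) + u * v by field.
    by move=> h; rewrite lerDr mulr_ge0.
  by have := e (a x) (U x); have := e (b x) (V x); lra.
have EP : \sum_i E i = \int[mu]_x (a x * U x + b x * V x).
  under eq_bigr do rewrite EE.
  rewrite -rintegral_sum; last first.
    by move=> i; exact: (rintegrable_adjoint ai bi (G1i i) (G2i i) (mtheta i)).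
  by apply: eq_rintegral => x; rewrite /U /V !mulr_sumr -big_split.
have iUV : rintegrable mu (fun x => a x * U x + b x * V x).
  have := rintegrable_sum (index_enum I)
    (fun i => rintegrable_adjoint ai bi (G1i i) (G2i i) (mtheta i)).
  by apply: eq_integrable => // x _ /=; rewrite /U /V !mulr_sumr -big_split.
have : \sum_i E i <= 2 * M * P + (4 * M)^-1 * (2 * M * \sum_i E i).
  rewrite {1}EP; apply: (@le_trans _ _ (\int[mu]_x (2 * M * (a x ^+ 2 + b x ^+ 2)
      + (4 * M)^-1 * (w x * (U x ^+ 2 + V x ^+ 2))))).
    by apply: le_Rintegral => //; apply: rintegrableD; exact: rintegrableZ.
  rewrite (RintegralD measurableT (rintegrableZ _ abi) (rintegrableZ _ wUVi)).
  rewrite (RintegralZl _ measurableT abi) (RintegralZl _ measurableT wUVi).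
  by rewrite lerD2l; apply: ler_wpM2l.
have -> : (4 * M)^-1 * (2 * M * \sum_i E i) = (\sum_i E i) / 2.
  by field.
lra.
Qed.

End bessel.
End dual.

(** * Bump weights and their Fourier transforms *)

Section calculus.
Variable R : realType.
Local Notation leb := (@lebesgue_measure R).

Lemma integral_is_derive (F f : R -> R) (a b : R) : a < b -> continuous f ->
  (forall x : R, is_derive x 1 F (f x)) ->
  (\int[leb]_(x in `[a, b]) (f x)%:E = (F b - F a)%:E)%E.
Proof.
move=> ab cf dF; have dF' x : derivable F x 1 by have [] := dF x.
have cF : continuous F.
  by move=> x; apply/differentiable_continuous/derivable1_diffP.
rewrite (@continuous_FTC2 _ _ F)//.
- exact: continuous_subspaceT.
- split=> //.
  + by apply: cvg_at_right_filter; exact: cF.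
  + by apply: cvg_at_left_filter; exact: cF.
- by move=> x _; rewrite derive1E; exact: derive_val.
Qed.

Lemma is_derive_affine (c b x : R) : is_derive x 1 (fun x => c + b * x) b.
Proof.
rewrite (_ : (fun x => _) = cst c + b \*: id); last by apply/funext.
by apply: is_derive_eq; rewrite add0r /GRing.scale/= mulr1.
Qed.

Lemma is_derive_sin_affine (c b x : R) :
  is_derive x 1 (fun x => sin (c + b * x)) (b * cos (c + b * x)).
Proof. by rewrite mulrC; apply: is_derive1_comp (is_derive_affine c b x). Qed.

Lemma is_derive_cos_affine (c b x : R) :
  is_derive x 1 (fun x => cos (c + b * x)) (- (b * sin (c + b * x))).
Proof.
by rewrite -mulrN mulrC; apply: is_derive1_comp (is_derive_affine c b x).
Qed.

Lemma continuous_cos_affine (c b : R) : continuous (fun x : R => cos (c + b * x)).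
Proof.
move=> x; apply/differentiable_continuous/derivable1_diffP.
by have [] := is_derive_cos_affine c b x.
Qed.

(** Integrating twice by parts gives the primitive of the bump against a cosine in
    closed form. *)
Lemma is_derive_bump_primitive (L c b x : R) : L != 0 -> b != 0 ->
  is_derive x 1
    (fun x => (1 - (x / L) ^+ 2) * sin (c + b * x) / b
      - (2 * x / L ^+ 2) * cos (c + b * x) / b ^+ 2
      + 2 / L ^+ 2 * sin (c + b * x) / b ^+ 3)
    ((1 - (x / L) ^+ 2) * cos (c + b * x)).
Proof.
move=> L0 b0.
have h1 : is_derive x 1 (fun x => 1 - (x / L) ^+ 2) (- (2 * x / L ^+ 2)).
  rewrite (_ : (fun x => _) = cst 1 - (L ^- 2 \*: (id ^+ 2))); last first.
    by apply/funext => y /=; rewrite expr_div_n mulrC.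
  by apply: is_derive_eq; rewrite sub0r /GRing.scale/= expr1; field.
have h2 : is_derive x 1 (fun x => 2 * x / L ^+ 2) (2 / L ^+ 2).
  rewrite (_ : (fun x => _) = (fun x => 0 + (2 / L ^+ 2) * x)); last first.
    by apply/funext => y; rewrite add0r mulrAC.
  exact: is_derive_affine.
have hs := is_derive_sin_affine c b x.
have hc := is_derive_cos_affine c b x.
have := is_deriveD (is_deriveB (is_deriveZ b^-1 (is_deriveM h1 hs))
  (is_deriveZ (b ^- 2) (is_deriveM h2 hc))) (is_deriveZ (2 / L ^+ 2 / b ^+ 3) hs).
move=> H.
rewrite (_ : (fun x => _) = (b^-1 \*: ((fun x => 1 - (x / L) ^+ 2) * (fun x => sin (c + b * x)))
  - b ^- 2 \*: ((fun x => 2 * x / L ^+ 2) * (fun x => cos (c + b * x)))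
  + (2 / L ^+ 2 / b ^+ 3) \*: (fun x => sin (c + b * x)))); last first.
  apply/funext => y; rewrite !fctE/= /GRing.scale/=.
  by field; rewrite ?L0 ?b0.
case: H => dH eH; split=> //; rewrite eH /GRing.scale/=; field.
by rewrite ?L0 ?b0.
Qed.

End calculus.

Section bump.
Variable R : realType.
Local Notation leb := (@lebesgue_measure R).

(** The profile 1 - x^2 on [-1, 1] is the simplest weight which is at least a
    constant on a smaller interval and whose Fourier transform decays like b^-2,
    hence is integrable: the boundary values of 1 - x^2 vanish, which gains one
    power over an indicator. *)
Definition bump (L x : R) : R := Num.max 0 (1 - (x / L) ^+ 2).
(** The Poisson kernel of the half-plane at height 1 / L, without its
    normalization by pi^-1. *)
Definition poisson (L x : R) : R := L / (1 + (L * x) ^+ 2).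

Lemma bump_ge0 L x : 0 <= bump L x.
Proof. by rewrite le_max lexx. Qed.

Lemma bump_le1 L x : bump L x <= 1.
Proof. by rewrite ge_max ler01 lerBlDr lerDl sqr_ge0. Qed.

Lemma sqr_div_le1 (L x : R) : 0 < L -> ((x / L) ^+ 2 <= 1) = (x \in `[- L, L]).
Proof.
move=> L0; rewrite -[leLHS]real_normK ?num_real// expr_le1// normrM normfV.
by rewrite (gtr0_norm L0) ler_pdivrMr// mul1r ler_norml in_itv.
Qed.

Lemma bump_in L x : 0 < L -> x \in `[- L, L] -> bump L x = 1 - (x / L) ^+ 2.
Proof. by move=> L0 xL; rewrite /bump max_r// subr_ge0 sqr_div_le1. Qed.

Lemma bump_out L x : 0 < L -> x \notin `[- L, L] -> bump L x = 0.
Proof.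
move=> L0 xL; rewrite /bump max_l//.
by rewrite subr_le0 ltW// ltNge sqr_div_le1.
Qed.

Lemma bump_half L x : 0 < L -> `|x| <= L -> 1 / 2 <= bump (2 * L) x.
Proof.
move=> L0 xL; rewrite le_max; apply/orP; right.
have : (x / (2 * L)) ^+ 2 <= (1 / 2) ^+ 2.
  rewrite -[leLHS]real_normK ?num_real// ler_pXn2r ?nnegrE//.
  rewrite normrM normfV (gtr0_norm (_ : 0 < 2 * L)) ?mulr_gt0//.
  by rewrite ler_pdivrMr ?mulr_gt0//; lra.
lra.
Qed.

Lemma measurable_bump L : measurable_fun setT (bump L).
Proof.
apply: measurable_maxr => //; apply: measurable_funB => //.
by apply: measurable_funX; apply: measurable_funM.
Qed.

Lemma poisson_ge0 L x : 0 <= L -> 0 <= poisson L x.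
Proof. by move=> L0; rewrite divr_ge0// addr_ge0 ?sqr_ge0. Qed.

Lemma poisson_even L x : poisson L (- x) = poisson L x.
Proof. by rewrite /poisson mulrN sqrrN. Qed.

Lemma integral_itv_cst1 (L : R) : 0 < L ->
  (\int[leb]_(x in `[(- L)%R, L]) 1 = (2 * L)%:E)%E.
Proof.
move=> L0; rewrite integral_cst//= mul1e lebesgue_measure_itv/= lte_fin.
by rewrite ifT; [rewrite opprK -mulr2n mulr_natl|lra].
Qed.

Lemma integral_bump_le (L : R) : 0 < L -> (\int[leb]_x (bump L x)%:E <= (2 * L)%:E)%E.
Proof.
move=> L0; rewrite -integral_itv_cst1// [leRHS]integral_mkcond.
apply: ge0_le_integral => //.
- by move=> x _; rewrite lee_fin bump_ge0.
- by apply/measurable_EFinP; exact: measurable_bump.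
- by apply/(measurable_restrictT _ _).1.
move=> x _; rewrite patchE; case: ifPn; rewrite ?inE ?notin_setE/= => xL.
  by rewrite lee_fin bump_le1.
by rewrite lee_fin bump_out//; apply/negP.
Qed.

Lemma rintegrable_bump L : 0 < L -> rintegrable leb (bump L).
Proof.
move=> L0; apply/integrableP; split; first by apply/measurable_EFinP; exact: measurable_bump.
under eq_integral do rewrite /= ger0_norm ?bump_ge0//.
by rewrite (le_lt_trans (integral_bump_le L0))// ltry.
Qed.

(** For |L b| <= 1 the integral is at most 2 L; for larger b the primitive of
    [is_derive_bump_primitive] at the end points x = -L, L leaves terms of size
    L (L b)^-2 and L (L b)^-3. *)
Lemma osc_bump (L b c : R) : 0 < L ->
  `|\int[leb]_x (bump L x * cos (c + b * x))| <= 16 * poisson L b.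
Proof.
move=> L0; have mc : measurable_fun setT (fun x => cos (c + b * x)).
  by apply: continuous_measurable_fun; exact: continuous_cos_affine.
have i1 : rintegrable leb (fun x => bump L x * cos (c + b * x)).
  apply: (rintegrable_le _ _ (rintegrable_bump L0)).
    by apply: measurable_funM => //; exact: measurable_bump.
  by move=> x; rewrite normrM (ger0_norm (bump_ge0 _ _)) ler_piMr ?bump_ge0// cos_max.
have L2 : `|\int[leb]_x (bump L x * cos (c + b * x))| <= 2 * L.
  rewrite -lee_fin; apply: le_trans (rintegral_norm i1) _.
  apply: le_trans (integral_bump_le L0); apply: ge0_le_integral => //.
  - by apply/measurable_EFinP/measurableT_comp => //; exact: rintegrable_measurable i1.
  - by apply/measurable_EFinP; exact: measurable_bump.
  move=> x _; rewrite lee_fin normrM (ger0_norm (bump_ge0 _ _)).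
  by rewrite ler_piMr ?bump_ge0// cos_max.
have den : 0 < 1 + (L * b) ^+ 2 by rewrite ltr_pwDl// sqr_ge0.
have [Lb|Lb] := leP (`|L * b|) 1.
  apply: (le_trans L2); rewrite /poisson mulrA ler_pdivlMr//.
  have : (L * b) ^+ 2 <= 1 by rewrite -[leLHS]real_normK ?num_real// expr_le1.
  by move=> h; have : 2 * L * (1 + (L * b) ^+ 2) <= 2 * L * 2; [rewrite ler_wpM2l//; lra|lra].
have b0 : b != 0 by apply: contraTneq Lb => ->; rewrite mulr0 normr0 -leNgt.
have LL : - L < L by lra.
have intE : (\int[leb]_x (bump L x * cos (c + b * x))%:E =
    \int[leb]_(x in `[(- L)%R, L]) ((1 - (x / L) ^+ 2) * cos (c + b * x))%:E)%E.
  rewrite [RHS]integral_mkcond; apply: eq_integral => x _; rewrite patchE.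
  case: ifPn; rewrite ?inE ?notin_setE/= => xL; first by rewrite bump_in.
  by rewrite bump_out ?mul0r//; apply/negP.
rewrite /Rintegral intE (integral_is_derive LL _
  (fun x => is_derive_bump_primitive c x (lt0r_neq0 L0) b0))/=; last first.
  move=> x; apply: cvgM; last exact: continuous_cos_affine.
  apply: cvgB; first exact: cvg_cst.
  under eq_fun do rewrite expr2.
  by apply: cvgM; apply: cvgM; (exact: cvg_id || exact: cvg_cst).
have -> : (L / L) = 1 by rewrite divff ?gt_eqF.
have -> : (- L / L) = -1 by rewrite mulNr divff ?gt_eqF.
rewrite sqrrN expr1n subrr !mul0r !add0r.
set s1 := sin _; set c1 := cos _; set s2 := sin _; set c2 := cos _.
have [s1b c1b] : `|s1| <= 1 /\ `|c1| <= 1 by rewrite sin_max cos_max.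
have [s2b c2b] : `|s2| <= 1 /\ `|c2| <= 1 by rewrite sin_max cos_max.
pose u := `|L * b|.
have u0 : 0 < u by rewrite /u (lt_trans _ Lb).
have -> : - (2 * L / L ^+ 2 * c1 / b ^+ 2) + 2 / L ^+ 2 * s1 / b ^+ 3 -
   (- (2 * - L / L ^+ 2 * c2 / b ^+ 2) + 2 / L ^+ 2 * s2 / b ^+ 3) =
   (2 * L) * (- (c1 + c2) / (L * b) ^+ 2 + (s1 - s2) / (L * b) ^+ 3).
  by field; rewrite b0 gt_eqF.
rewrite normrM gtr0_norm ?mulr_gt0//.
have h1 : `|- (c1 + c2) / (L * b) ^+ 2 + (s1 - s2) / (L * b) ^+ 3| <= 4 / u ^+ 2.
  apply: le_trans (ler_normD _ _) _.
  rewrite !normrM !normfV normrN !normrX -/u.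
  have -> : 4 / u ^+ 2 = 2 / u ^+ 2 + 2 / u ^+ 2 by rewrite -mulrDl; congr (_ / _); ring.
  rewrite lerD//.
    by rewrite ler_pM2r ?invr_gt0 ?exprn_gt0// (le_trans (ler_normD _ _))//; lra.
  rewrite ler_pM ?invr_ge0 ?exprn_ge0 ?(ltW u0)//.
    by rewrite (le_trans (ler_normB _ _))//; lra.
  by rewrite lef_pV2 ?posrE ?exprn_gt0// ler_eXn2l// ltW.
apply: (@le_trans _ _ (2 * L * (4 / u ^+ 2))); first by rewrite ler_pM2l ?mulr_gt0.
rewrite /poisson.
have -> : (L * b) ^+ 2 = u ^+ 2 by rewrite real_normK ?num_real.
have u1 : 1 <= u ^+ 2 by rewrite expr_ge1 ?(ltW u0)// ltW.
have -> : 2 * L * (4 / u ^+ 2) = 16 * (L / (2 * u ^+ 2)).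
  by field; rewrite gt_eqF.
rewrite ler_pM2l// ler_pM2l// lef_pV2 ?posrE ?mulr_gt0 ?exprn_gt0 ?ltr_pwDl ?exprn_ge0 ?(ltW u0)//.
lra.
Qed.

End bump.

(** A bound for the integral of w exp(i theta). Allowing every constant c in the
    phase makes the bound stable under products ([osc_bound_prod]), since it
    controls cosine and sine together. *)
Definition osc_bound d (X : measurableType d) (R : realType)
    (mu : {measure set X -> \bar R}) (w theta : X -> R) (K : R) :=
  forall c, `|\int[mu]_x (w x * cos (c + theta x))| <= K.

Section osc_product.
Context d1 d2 (X : measurableType d1) (Y : measurableType d2) (R : realType).
Variables (mu : {sigma_finite_measure set X -> \bar R}).
Variables (nu : {sigma_finite_measure set Y -> \bar R}).

(** The cosine of a sum is a difference of two products, each of which integrates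
    to a product of integrals: hence the factor 2. *)
Lemma osc_bound_prod (w1 t1 : X -> R) (w2 t2 : Y -> R) K1 K2 :
  rintegrable mu w1 -> rintegrable nu w2 ->
  measurable_fun setT t1 -> measurable_fun setT t2 ->
  osc_bound mu w1 t1 K1 -> osc_bound nu w2 t2 K2 ->
  osc_bound (mu \x nu)%E (fun p => w1 p.1 * w2 p.2) (fun p => t1 p.1 + t2 p.2)
    (2 * (K1 * K2)).
Proof.
move=> w1i w2i m1 m2 o1 o2 c.
have m1c c' : measurable_fun setT (fun x => c' + t1 x) by exact: measurable_funD.
have m2c c' : measurable_fun setT (fun x => c' + t2 x) by exact: measurable_funD.
have i1 c' := rintegrable_cos w1i (m1c c').
have i2 c' := rintegrable_cos w2i (m2c c').
have -> : \int[(mu \x nu)%E]_p (w1 p.1 * w2 p.2 * cos (c + (t1 p.1 + t2 p.2))) =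
  \int[(mu \x nu)%E]_p ((w1 p.1 * cos (c + t1 p.1)) * (w2 p.2 * cos (0 + t2 p.2)) -
     (w1 p.1 * cos (c - pi / 2 + t1 p.1)) * (w2 p.2 * cos (0 - pi / 2 + t2 p.2))).
  apply: eq_rintegral => p; rewrite addrA (cosD (c + t1 p.1)) add0r.
  by rewrite (addrAC c (- _)) (addrAC 0) add0r !cosBpihalf; ring.
rewrite RintegralB//; last 2 first.
- exact: (rintegrable_tensor (i1 c) (i2 0)).
- exact: (rintegrable_tensor (i1 (c - pi / 2)) (i2 (0 - pi / 2))).
rewrite (rintegral_tensor (i1 c) (i2 0)).
rewrite (rintegral_tensor (i1 (c - pi / 2)) (i2 (0 - pi / 2))).
have -> : 2 * (K1 * K2) = K1 * K2 + K1 * K2 by ring.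
rewrite (le_trans (ler_normB _ _))// !normrM lerD// ler_pM//.
Qed.

End osc_product.

Section torus.
Variable R : realType.
Local Notation leb := (@lebesgue_measure R).
Local Notation rline := (measurableTypeR R).

Definition circle : probability rline R := uniform_prob (@ltr01 R).

Lemma sin_periodic_int (a : R) (k : int) : sin (a + 2 * pi * k%:~R) = sin a.
Proof.
have h n b : sin (b + 2 * pi * n%:R) = sin b :> R.
  have := periodicn (@sinD2pi R) n b.
  by rewrite -[pi *+ 2]mulr_natl -[_ *+ n]mulr_natr.
case: k => n; first exact: h.
by rewrite NegzE mulrNz mulrN -[LHS](h n.+1) subrK.
Qed.

(** The orthogonality of characters of the circle. The mean of the cosine is
    computed from that of the nonnegative 1 + cos, to which the integral formula
    for the uniform probability applies. *)
Lemma osc_circle (k : int) :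
  osc_bound circle (cst 1) (fun x : rline => 2 * pi * ((x : R) * k%:~R)) (k == 0)%:R.
Proof.
move=> c; under eq_rintegral do rewrite mul1r.
have mc : measurable_fun setT (fun x : rline => cos (c + 2 * pi * ((x : R) * k%:~R))).
  under eq_fun do rewrite mulrCA mulrC.
  by apply: continuous_measurable_fun; exact: continuous_cos_affine.
have ci : rintegrable circle (fun x : rline => cos (c + 2 * pi * ((x : R) * k%:~R))).
  apply: (rintegrable_le (g := cst 1)) => //; last exact: finite_measure_integrable_cst.
  by move=> x; rewrite cos_max.
have [_|k0] := eqVneq k 0.
  rewrite -lee_fin; apply: (le_trans (rintegral_norm ci)).
  apply: (@le_trans _ _ (\int[circle]_x (cst 1 x))%E).
    apply: ge0_le_integral => //.
    - by apply/measurable_EFinP/measurableT_comp.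
    - by move=> x _; rewrite lee_fin cos_max.
  by rewrite integral_cst//= probability_setT mule1.
suff -> : \int[circle]_x cos (c + 2 * pi * (x * k%:~R)) = 0 by rewrite normr0.
have c1 : rintegrable circle (cst 1) by exact: finite_measure_integrable_cst.
have : \int[circle]_x (1 + cos (c + 2 * pi * (x * k%:~R))) = 1.
  rewrite /Rintegral integral_uniform//; last first.
    by apply/measurable_EFinP; apply: measurable_funD.
  rewrite subr0 invr1 mul1e.
  pose b : R := 2 * pi * k%:~R.
  have b0 : b != 0 by rewrite !mulf_neq0 ?intr_eq0// gt_eqF// pi_gt0.
  have E x : 1 + cos (c + 2 * pi * (x * k%:~R)) = 1 + cos (c + b * x).
    by rewrite /b -!mulrA (mulrC x).
  under eq_integral do rewrite E.
  have dF (x : R) : is_derive x 1 (fun x => x + b^-1 * sin (c + b * x))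
      (1 + cos (c + b * x)).
    have := is_deriveD (is_derive_id x 1) (is_deriveZ b^-1 (is_derive_sin_affine c b x)).
    by case=> dH eH; split=> //; rewrite eH /GRing.scale/= mulKf.
  rewrite (integral_is_derive (@ltr01 R) _ dF)/=.
    by rewrite mulr1 mulr0 addr0 add0r /b sin_periodic_int; ring.
  move=> x; apply: cvgD; first exact: cvg_cst.
  exact: continuous_cos_affine.
rewrite RintegralD// Rintegral_cst//= probability_setT mul1r/=; lra.
Qed.

Definition torus_phase n (k : Zn n) (y : n.-tuple rline) : R :=
  2 * pi * \sum_(j < n) tnth y j * (tnth k j)%:~R.

Lemma measurable_torus_phase n (k : Zn n) : measurable_fun setT (torus_phase k).
Proof.
apply: measurable_funM => //; apply: measurable_sum => j.
by apply: measurable_funM => //; exact: measurable_tnth.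
Qed.

(** Characters of T^n are orthogonal; the induction on the dimension loses 2 ^ n
    through [osc_bound_prod]. *)
Lemma osc_torus n (k : Zn n) :
  osc_bound (torus_measure R n) (cst 1) (torus_phase k)
    (2 ^+ n * (k == [tuple 0 | _ < n])%:R).
Proof.
elim: n k => [|n IH] k c.
  rewrite expr0 mul1r (_ : k == _); last by apply/eqP; apply: eq_from_tnth => -[].
  rewrite /Rintegral/= integral_dirac//.
    by rewrite diracE in_setT mul1e/= mul1r cos_max.
  apply/measurable_EFinP; apply: (@rintegrable_measurable _ _ _ (torus_measure R 0)).
  by apply: rintegrable_cos; [exact: finite_measure_integrable_cst|
    exact: measurable_funD (measurable_torus_phase k)].
pose k' : Zn n := [tuple of behead k].
have mc : measurable_fun setT (fun y => (cst 1 y * cos (c + torus_phase k y))%:E).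
  apply/measurable_EFinP; apply: (@rintegrable_measurable _ _ _ (torus_measure R n.+1)).
  by apply: rintegrable_cos; [exact: finite_measure_integrable_cst|
    exact: measurable_funD (measurable_torus_phase k)].
pose t1 (x : rline) : R := 2 * pi * (x * (tnth k ord0)%:~R).
pose cst1 d (Z : measurableType d) : Z -> R := cst 1.
have mt1 : measurable_fun setT t1.
  by apply: measurable_funM => //; apply: measurable_funM.
have i1 : rintegrable circle (cst1 _ _) by exact: finite_measure_integrable_cst.
have i2 : rintegrable (torus_measure R n) (cst1 _ _).
  exact: finite_measure_integrable_cst.
have pE z : torus_phase k (cons_pair z) = t1 z.1 + torus_phase k' z.2.
  rewrite /torus_phase /t1 -mulrDr big_ord_recl !tnth0; congr (_ * (_ * _ + _)).
  apply: eq_bigr => j _; rewrite tnthS /k' tnth_behead.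
  congr (_ * (tnth k _)%:~R); apply: val_inj.
  by rewrite /= inordK// /bump/= ltnS ltn_ord.
have := osc_bound_prod i1 i2 mt1 (measurable_torus_phase k') (osc_circle (tnth k ord0))
  (IH k') c.
have -> : 2 * ((tnth k ord0 == 0)%:R * (2 ^+ n * (k' == [tuple 0 | _ < n])%:R)) =
    2 ^+ n.+1 * (k == [tuple 0 | _ < n.+1])%:R :> R.
  suff -> : (k == [tuple 0 | _ < n.+1]) =
      (tnth k ord0 == 0) && (k' == [tuple 0 | _ < n]).
    by rewrite -mulnb natrM exprS; ring.
  apply/eqP/andP => [kE|[/eqP k0 /eqP k'0]]; last first.
    apply: eq_from_tnth => j; rewrite tnth_mktuple.
    case: (unliftP ord0 j) => [i|] ->; last by [].
    have := congr1 (fun t => tnth t i) k'0; rewrite tnth_mktuple => <-.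
    rewrite tnth_behead; congr (tnth k _); apply: val_inj.
    by rewrite /= inordK// /bump/= ltnS ltn_ord.
  split; first by rewrite kE tnth_mktuple.
  apply/eqP; apply: eq_from_tnth => j; rewrite tnth_mktuple.
  by rewrite /k' tnth_behead kE tnth_mktuple.
apply: le_trans; rewrite le_eqVlt; apply/orP; left; apply/eqP; congr `|_|.
congr fine; rewrite /=.
rewrite [LHS](integral_pushforward (@measurable_cons_pair R n) mc)//.
  by apply: eq_integral => z _ /=; rewrite pE /cst1/= !mul1r.
rewrite preimage_setT.
have mt : measurable_fun setT (fun z => c + torus_phase k (@cons_pair R n z)).
  apply: measurable_funD => //.
  exact: measurableT_comp (measurable_torus_phase k) (@measurable_cons_pair R n).
have := rintegrable_cos (rintegrable_tensor i1 i2) mt.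
by apply: eq_integrable => // z _ /=; rewrite /cst1/= !mul1r.
Qed.

(** The factor 2 pi in the frequency only helps, as [poisson L] decreases away from
    the origin. *)
Lemma osc_bump_2pi (L xi : R) : 0 < L ->
  osc_bound leb (bump L) (fun x : rline => 2 * pi * xi * (x : R)) (16 * poisson L xi).
Proof.
move=> L0 c; apply: (le_trans (osc_bump _ _ L0)).
rewrite ler_pM2l// /poisson ler_pM2l// lef_pV2 ?posrE ?ltr_pwDl ?sqr_ge0//.
rewrite lerD2l !exprMn ler_pM2l ?exprn_gt0// ler_peMl ?sqr_ge0//.
rewrite -exprMn expr_ge1 ?mulr_ge0 ?pi_ge0//.
by have := pi_ge2 R; lra.
Qed.

Lemma osc_RT n (L : R) (xi : R) (k : Zn n) : 0 < L ->
  osc_bound (@RT_measure R n) (fun z => bump L z.1)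
    (fun z => 2 * pi * pairing z xi k)
    (2 ^+ n.+1 * (k == [tuple 0 | _ < n])%:R * (16 * poisson L xi)).
Proof.
move=> L0 c.
have i2 : rintegrable (torus_measure R n) (cst 1 : n.-tuple rline -> R).
  exact: finite_measure_integrable_cst.
have mt1 : measurable_fun setT (fun x : rline => 2 * pi * xi * (x : R)).
  exact: measurable_funM.
have := osc_bound_prod (rintegrable_bump L0) i2 mt1 (measurable_torus_phase k)
  (osc_bump_2pi xi L0) (osc_torus k) c.
have -> : 2 ^+ n.+1 * (k == [tuple 0 | _ < n])%:R * (16 * poisson L xi) =
  2 * (16 * poisson L xi * (2 ^+ n * (k == [tuple 0 | _ < n])%:R)).
  by rewrite exprS; ring.
apply: le_trans; rewrite le_eqVlt; apply/orP; left; apply/eqP; congr `|_|.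
apply: eq_rintegral => z /=; rewrite mulr1; congr (_ * cos (_ + _)).
by rewrite /pairing /torus_phase; ring.
Qed.

Lemma rintegrable_bump_RT n (L : R) : 0 < L ->
  rintegrable (@RT_measure R n) (fun z => bump L z.1).
Proof.
move=> L0.
have i2 : rintegrable (torus_measure R n) (cst 1 : n.-tuple rline -> R).
  exact: finite_measure_integrable_cst.
have := rintegrable_tensor (rintegrable_bump L0) i2.
by apply: eq_integrable => // z _ /=; rewrite mulr1.
Qed.

Lemma measurable_pairing n (xi : R) (k : Zn n) :
  measurable_fun setT (fun z : RT R n => pairing z xi k).
Proof.
apply: measurable_funD; first exact: measurable_funM.
apply: measurable_sum => j; apply: measurable_funM => //.
exact: (measurableT_comp (measurable_tnth j) measurable_snd).
Qed.

Lemma osc_slab n (T L : R) (tau xi : R) (k : Zn n) : 0 < T -> 0 < L ->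
  osc_bound (prod_measure leb (@RT_measure R n))
    (fun p => bump T p.1 * bump L p.2.1)
    (fun p => 2 * pi * (pairing p.2 xi k - p.1 * tau))
    (2 ^+ n.+2 * (k == [tuple 0 | _ < n])%:R * (256 * (poisson T tau * poisson L xi))).
Proof.
move=> T0 L0 c.
have mt1 : measurable_fun setT (fun x : rline => 2 * pi * - tau * (x : R)).
  exact: measurable_funM.
have mt2 : measurable_fun setT (fun z : RT R n => 2 * pi * pairing z xi k).
  by apply: measurable_funM => //; exact: measurable_pairing.
have := osc_bound_prod (rintegrable_bump T0) (rintegrable_bump_RT n L0) mt1 mt2
  (osc_bump_2pi (- tau) T0) (osc_RT xi k L0) c.
have -> : 2 ^+ n.+2 * (k == [tuple 0 | _ < n])%:R * (256 * (poisson T tau * poisson L xi)) =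
  2 * (16 * poisson T tau * (2 ^+ n.+1 * (k == [tuple 0 | _ < n])%:R * (16 * poisson L xi))).
  by rewrite !exprS; ring.
rewrite -(poisson_even T tau); apply: le_trans; rewrite le_eqVlt; apply/orP; left; apply/eqP; congr `|_|.
apply: eq_rintegral => z /=; congr (_ * cos (_ + _)).
by ring.
Qed.

End torus.

(** * Row sums over pairs of frequencies *)

Section poisson_integrals.
Variable R : realType.
Local Notation leb := (@lebesgue_measure R).

Lemma ge0_integral_affine (b c : R) (G : R -> R) : 0 < b -> continuous G ->
  (forall x, 0 <= G x) ->
  (\int[leb]_x (G x)%:E = \int[leb]_x (G (c + b * x) * b)%:E)%E.
Proof.
move=> b0 cG G0.
have dF (x : R) := is_derive_affine c b x.
have F'E : derive1 (fun x : R => c + b * x) = cst b.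
  by apply/funext => x; rewrite derive1E; exact: derive_val.
rewrite (@increasing_ge0_integration_by_substitutionT _ (fun x => c + b * x) G)//.
- by rewrite F'E.
- by move=> x y xy; rewrite ltrD2l ltr_pM2l.
- by rewrite F'E => x; exact: cvg_cst.
- by rewrite F'E; exact: is_cvg_cst.
- by rewrite F'E; exact: is_cvg_cst.
- apply/cvgrNyPle => A.
  apply: filterS (nbhs_ninfty_le (num_real ((A - c) / b))) => x.
  by rewrite ler_pdivlMr// mulrC lerBrDl.
- apply/cvgryPge => A.
  apply: filterS (nbhs_pinfty_ge (num_real ((A - c) / b))) => x.
  by rewrite ler_pdivrMr// mulrC lerBlDl.
Qed.

Lemma ge0_integral_translate (c : R) (G : R -> R) : continuous G ->
  (forall x, 0 <= G x) ->
  (\int[leb]_x (G (c + x))%:E = \int[leb]_x (G x)%:E)%E.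
Proof.
move=> cG G0; rewrite [RHS](ge0_integral_affine c (@ltr01 R))//.
by apply: eq_integral => x _; rewrite mul1r mulr1.
Qed.

Lemma integral_poisson (L s : R) : 0 < L ->
  (\int[leb]_x (poisson L (x - s))%:E = pi%:E)%E.
Proof.
move=> L0; transitivity (\int[leb]_x ((oneDsqr x)^-1)%:E)%E; last first.
  rewrite ge0_symfun_integralT.
  - by rewrite -set_itvcy integral0y_oneDsqr -EFinM; congr _%:E; field.
  - by move=> x; rewrite invr_ge0.
  - exact: continuous_oneDsqrV.
  - by move=> x /=; rewrite /oneDsqr sqrrN.
rewrite [RHS](ge0_integral_affine (- (L * s)) L0).
- apply: eq_integral => x _; rewrite /poisson /oneDsqr.
  by rewrite mulrC mulrBr (addrC (- _)).
- exact: continuous_oneDsqrV.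
- by move=> x; rewrite invr_ge0.
Qed.

Lemma continuous_poisson (L : R) (g : R -> R) : continuous g ->
  continuous (fun x => poisson L (g x)).
Proof.
move=> cg x; rewrite /poisson; under eq_fun do rewrite expr2.
apply: cvgM; first exact: cvg_cst.
apply: cvgV; first by rewrite gt_eqF// -expr2 ltr_pwDl// sqr_ge0.
apply: cvgD; first exact: cvg_cst.
by apply: cvgM; apply: cvgM; (exact: cvg_cst || exact: cg).
Qed.

(** The size of the integral of [poisson T] along a parabola with vertex at height
    rho, which is larger when the vertex is within reach of the peak of the
    kernel. The threshold is 1, rather than the width 1 / T of the kernel,
    because rho is only resolved by integer steps in [sum_spike]. *)
Definition spike (T rho : R) : R :=
  if `|rho| < 1 then Num.sqrt T else (Num.sqrt `|rho|)^-1.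

Lemma spike_ge0 T rho : 0 <= spike T rho.
Proof. by rewrite /spike; case: ifP => _; rewrite ?invr_ge0 sqrtr_ge0. Qed.

(** The roots of rho = 2 v^2 are v = c and v = -c, with c = sqrt(|rho| / 2) (when
    rho < 0 there is no root, and the bounds are easier). In
    rho - 2 v^2 = 2 (c - v) (c + v), use c + v >= |v - c|, which is good for small
    rho, or c + v >= c, which is good for large rho. *)
Lemma sqr_level (rho c v : R) : 0 <= c -> 0 <= v -> `|rho| = 2 * c ^+ 2 ->
  (v - c) ^+ 2 * (v - c) ^+ 2 <= (rho - 2 * v ^+ 2) ^+ 2 /\
  c ^+ 2 * (v - c) ^+ 2 <= (rho - 2 * v ^+ 2) ^+ 2.
Proof.
move=> c0 v0; have cv : 0 <= c * v by rewrite mulr_ge0.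
have [rho0 rhoE|rho0 rhoE] := leP 0 rho.
  have -> : rho = 2 * c ^+ 2 by rewrite -rhoE ger0_norm.
  have -> : (2 * c ^+ 2 - 2 * v ^+ 2) ^+ 2 = (4 * (v + c) ^+ 2) * (v - c) ^+ 2 by ring.
  by split; rewrite ler_wpM2r ?sqr_ge0//; nra.
have -> : rho = - (2 * c ^+ 2) by rewrite -rhoE ltr0_norm// opprK.
have -> : (- (2 * c ^+ 2) - 2 * v ^+ 2) ^+ 2 = 4 * ((c ^+ 2 + v ^+ 2) * (c ^+ 2 + v ^+ 2)) by ring.
have h1 : (v - c) ^+ 2 <= c ^+ 2 + v ^+ 2 by nra.
have h2 : c ^+ 2 <= c ^+ 2 + v ^+ 2 by rewrite lerDl sqr_ge0.
have h3 : 0 <= (c ^+ 2 + v ^+ 2) * (c ^+ 2 + v ^+ 2) by rewrite mulr_ge0 ?addr_ge0 ?sqr_ge0.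
split.
  have := ler_pM (sqr_ge0 _) (sqr_ge0 _) h1 h1; lra.
have := ler_pM (sqr_ge0 _) (sqr_ge0 _) h2 h1; lra.
Qed.

(** The function has a peak at each of v0 + c and v0 - c. *)
Lemma integral_le_two_poisson (B v0 c k : R) (f : R -> R) : 0 < B -> 0 <= k ->
  measurable_fun setT f ->
  (forall x, 0 <= f x <= k * poisson B (`|x - v0| - c)) ->
  (\int[leb]_x (f x)%:E <= (2 * k * pi)%:E)%E.
Proof.
move=> B0 k0 mf fk.
have cP (s : R) : continuous (fun x : R => poisson B (x - s)).
  by apply: continuous_poisson => x; apply: cvgB; [exact: cvg_id|exact: cvg_cst].
have mP (s : R) : measurable_fun setT (fun x : R => (poisson B (x - s))%:E).
  by apply/measurable_EFinP; exact: continuous_measurable_fun.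
apply: (@le_trans _ _ (\int[leb]_x (k%:E * ((poisson B (x - (v0 + c)))%:E
     + (poisson B (x - (v0 - c)))%:E)))%E); last first.
  rewrite ge0_integralZl//.
  - rewrite ge0_integralD//.
    + by rewrite !integral_poisson// -EFinD -EFinM lee_fin; lra.
    + by move=> x _; rewrite lee_fin poisson_ge0// ltW.
    + exact: mP.
    + by move=> x _; rewrite lee_fin poisson_ge0// ltW.
    + exact: mP.
  - by apply: emeasurable_funD; exact: mP.
  - by move=> x _; rewrite -EFinD lee_fin addr_ge0// poisson_ge0// ltW.
apply: ge0_le_integral => //.
- by move=> x _; rewrite lee_fin; have /andP[] := fk x.
- exact/measurable_EFinP.
- by apply: emeasurable_funM => //; apply: emeasurable_funD; exact: mP.
move=> x _; rewrite -EFinD -EFinM lee_fin.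
have /andP[_ /le_trans] := fk x; apply; rewrite ler_wpM2l//.
have [xv|xv] := ger0P (x - v0).
  have -> : x - v0 - c = x - (v0 + c) by ring.
  by rewrite lerDl poisson_ge0// ltW.
have -> : - (x - v0) - c = - (x - (v0 - c)) by ring.
by rewrite poisson_even lerDr poisson_ge0// ltW.
Qed.

(** Completing the square, tau - (a - x)^2 - x^2 = rho - 2 (x - a / 2)^2. By
    [sqr_level] the integrand is then at most c^-1 P_(T c) (|x - a / 2| - c); when
    c may vanish, the other bound of [sqr_level] gives sqrt(T) P_(sqrt T) instead,
    up to a factor 2. *)
Lemma integral_poisson_parabola (T tau a : R) : 1 <= T ->
  (\int[leb]_x (poisson T (tau - (a - x) ^+ 2 - x ^+ 2))%:E <=
   (4 * pi * spike T (tau - a ^+ 2 / 2))%:E)%E.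
Proof.
move=> T1; have T0 : 0 < T by lra.
set rho := tau - _; pose v0 := a / 2; pose c := Num.sqrt (`|rho| / 2).
have c0 : 0 <= c by rewrite sqrtr_ge0.
have cE : `|rho| = 2 * c ^+ 2 by rewrite sqr_sqrtr ?divr_ge0//; field.
have qE x : tau - (a - x) ^+ 2 - x ^+ 2 = rho - 2 * `|x - v0| ^+ 2.
  by rewrite real_normK ?num_real// /rho /v0; field.
have mf : measurable_fun setT (fun x : R => poisson T (tau - (a - x) ^+ 2 - x ^+ 2)).
  apply: continuous_measurable_fun; apply: continuous_poisson.
  under eq_fun do rewrite !expr2.
  move=> x; apply: cvgB; last by apply: cvgM; exact: cvg_id.
  apply: cvgB; first exact: cvg_cst.
  by apply: cvgM; apply: cvgB; (exact: cvg_cst || exact: cvg_id).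
have f0 x : 0 <= poisson T (tau - (a - x) ^+ 2 - x ^+ 2).
  by rewrite poisson_ge0// ltW.
rewrite /spike; case: ifPn => [_|].
  have sT0 : 0 < Num.sqrt T by rewrite sqrtr_gt0.
  have -> : 4 * pi * Num.sqrt T = 2 * (2 * Num.sqrt T) * pi by ring.
  apply: (@integral_le_two_poisson (Num.sqrt T) v0 c); rewrite ?mulr_ge0 ?(ltW sT0)//.
  move=> x; rewrite f0/= qE; set v := `|x - v0|.
  have [h _] := sqr_level c0 (normr_ge0 (x - v0)) cE.
  rewrite /poisson -/v in h *; set w := (v - c) ^+ 2 in h *.
  have sE : Num.sqrt T ^+ 2 = T by rewrite sqr_sqrtr// ltW.
  rewrite [(Num.sqrt T * (v - c)) ^+ 2]exprMn sE -/w.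
  have -> : 2 * Num.sqrt T * (Num.sqrt T / (1 + T * w)) =
    2 * Num.sqrt T ^+ 2 / (1 + T * w) by ring.
  rewrite sE.
  rewrite exprMn.
  have w0 : 0 <= w by exact: sqr_ge0.
  have Tw0 : 0 <= T * w by rewrite mulr_ge0// ltW.
  have h2 : T ^+ 2 * (w * w) <= T ^+ 2 * (rho - 2 * v ^+ 2) ^+ 2.
    by rewrite ler_wpM2l ?sqr_ge0.
  have -> : 2 * T / (1 + T * w) = T * (2 / (1 + T * w)) by ring.
  have den : 0 < 1 + T ^+ 2 * (rho - 2 * v ^+ 2) ^+ 2.
    by rewrite ltr_pwDl// -exprMn sqr_ge0.
  rewrite ler_pM2l// -[leLHS]mul1r ler_pdivrMr//.
  rewrite mulrAC ler_pdivlMr ?ltr_pwDl// mul1r.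
  have := sqr_ge0 (T * w - 1); nra.
rewrite -leNgt => rho1.
have c1 : 0 < c by rewrite sqrtr_gt0; lra.
have sE : (Num.sqrt `|rho|)^-1 = (Num.sqrt 2)^-1 * c^-1.
  by rewrite cE sqrtrM// sqrtr_sqr ger0_norm// invfM.
apply: (@le_trans _ _ (2 * c^-1 * pi)%:E); last first.
  rewrite lee_fin sE.
  have -> : 4 * pi * ((Num.sqrt 2)^-1 * c^-1) = (4 / Num.sqrt 2) * c^-1 * pi by ring.
  rewrite ler_pM2r ?pi_gt0// ler_pM2r ?invr_gt0// ler_pdivlMr ?sqrtr_gt0//.
  have : Num.sqrt 2 ^+ 2 = 2 :> R by rewrite sqr_sqrtr.
  have := sqrtr_ge0 (2 : R); nra.
apply: (@integral_le_two_poisson (T * c) v0 c); rewrite ?mulr_gt0 ?invr_ge0//.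
move=> x; rewrite f0/= qE; set v := `|x - v0|.
have [_ h] := sqr_level c0 (normr_ge0 (x - v0)) cE.
rewrite /poisson -/v in h *.
rewrite (mulrC T c) -[c * T / _]mulrA mulKf ?gt_eqF//.
rewrite ler_pM2l// lef_pV2 ?posrE ?ltr_pwDl ?sqr_ge0// lerD2l.
rewrite (mulrC c) -(mulrA T) !exprMn ler_wpM2l ?sqr_ge0//.
Qed.

End poisson_integrals.

Section spike_sum.
Variable R : realType.
Implicit Types T x rho : R.

Lemma spike_even T rho : spike T (- rho) = spike T rho.
Proof. by rewrite /spike normrN. Qed.

Lemma spike_le_sqrt T rho : 1 <= T -> spike T rho <= Num.sqrt T.
Proof.
move=> T1; rewrite /spike; case: ifPn => //; rewrite -leNgt => r1.
apply: (@le_trans _ _ 1); last by rewrite -sqrtr1 ler_sqrt// (le_trans ler01).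
by rewrite invf_le1 ?sqrtr_gt0 ?(lt_le_trans ltr01)// -sqrtr1 ler_sqrt// (le_trans ler01).
Qed.

(** One term is at most sqrt(T), the others are compared with the integral of
    x^(-1/2), by induction on the number of terms. *)
Lemma sum_spike_half T x m : 1 <= T -> 0 <= x ->
  \sum_(l < m) spike T (x + l%:R) <= Num.sqrt T + 2 * Num.sqrt m%:R.
Proof.
move=> T1 x0; case: m => [|m].
  by rewrite big_ord0 sqrtr0 mulr0 addr0 sqrtr_ge0.
apply: (@le_trans _ _ (Num.sqrt T + 2 * Num.sqrt m%:R)); last first.
  by rewrite lerD2l ler_pM2l// ler_sqrt// ler_nat.
elim: m => [|m IH].
  by rewrite big_ord1 sqrtr0 mulr0 !addr0 spike_le_sqrt.
rewrite big_ord_recr/=; apply: (le_trans (lerD IH (lexx _))).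
rewrite -addrA lerD2l.
set s := Num.sqrt m%:R; set t := Num.sqrt m.+1%:R.
have s0 : 0 <= s by rewrite sqrtr_ge0.
have t0 : 0 < t by rewrite sqrtr_gt0.
have st : t ^+ 2 = s ^+ 2 + 1 by rewrite !sqr_sqrtr// -natr1.
have sp : spike T (x + m.+1%:R) <= t^-1.
  rewrite /spike ifF; last first.
    by apply/negbTE; rewrite -leNgt ger0_norm ?addr_ge0// -natr1; have := ler0n R m; lra.
  rewrite lef_pV2 ?posrE// ?sqrtr_gt0 ?normr_gt0.
    by rewrite ler_sqrt// ger0_norm ?addr_ge0// lerDr.
  by rewrite gt_eqF// ltr_wpDl.
apply: (@le_trans _ _ (2 * s + t^-1)); first by rewrite lerD2l.
have tt : t^-1 * t = 1 by rewrite mulVf// gt_eqF.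
rewrite -(ler_pM2r t0) mulrDl tt.
have : 0 <= (t - s) ^+ 2 by exact: sqr_ge0.
nra.
Qed.

(** Split the sum at l = rho and count from there in both directions. *)
Lemma sum_spike T rho m : 1 <= T ->
  \sum_(l < m) spike T (rho - l%:R) <= 2 * Num.sqrt T + 4 * Num.sqrt m%:R.
Proof.
move=> T1; have sT : 0 <= Num.sqrt T by rewrite sqrtr_ge0.
have sm : 0 <= Num.sqrt m%:R :> R by rewrite sqrtr_ge0.
have [rho0|rho0] := ltP rho 0.
  under eq_bigr do rewrite -spike_even opprB addrC.
  apply: (le_trans (sum_spike_half m T1 (_ : 0 <= - rho))); lra.
have down p : (p <= m)%N -> p%:R <= rho + 1 ->
    \sum_(l < p) spike T (rho - l%:R) <= Num.sqrt T + 2 * Num.sqrt m%:R.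
  case: p => [|p] pm prho; first by rewrite big_ord0 addr_ge0// mulr_ge0.
  rewrite (reindex_inj rev_ord_inj)/=.
  under eq_bigr => l _.
    rewrite subSS natrB -1?ltnS// opprB addrA (addrC rho) -addrA (addrC (l%:R)).
    over.
  apply: (le_trans (sum_spike_half p.+1 T1 (_ : 0 <= rho - p%:R))).
    by move: prho; rewrite -natr1; lra.
  by rewrite lerD2l ler_pM2l// ler_sqrt// ler_nat.
have [mr|mr] := leP m%:R (rho + 1); first by have := down _ (leqnn m) mr; lra.
pose p := (Num.truncn rho).+1.
have /andP[p1 p2] : p.-1%:R <= rho < p%:R by rewrite truncn_itv.
have p1' : p%:R <= rho + 1 by rewrite /p -natr1 lerD2r.
have pm : (p <= m)%N by rewrite -(ler_nat R); lra.
rewrite -(big_mkord xpredT (fun l => spike T (rho - l%:R))) (big_cat_nat _ pm)//=.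
rewrite big_mkord (_ : \sum_(p <= l < m) _ =
  \sum_(l < m - p) spike T (rho - (l + p)%:R)); last first.
  by rewrite -{1}(add0n p) big_addn big_mkord.
have h1 := down _ pm p1'.
have : \sum_(l < m - p) spike T (rho - (l + p)%:R) <= Num.sqrt T + 2 * Num.sqrt m%:R.
  under eq_bigr => l _ do rewrite -spike_even opprB natrD -addrA addrC.
  apply: (le_trans (sum_spike_half _ T1 (_ : 0 <= p%:R - rho))); first by lra.
  by rewrite lerD2l ler_pM2l// ler_sqrt// ler_nat leq_subr.
lra.
Qed.

End spike_sum.

(** Group the pairs by the value l of |k1|^2 + |k2|^2. *)
Lemma sum_spike_pairs (R : realType) n K B
    (q : (n.+2.-tuple 'I_(K.*2.+1)) * (n.+2.-tuple 'I_(K.*2.+1))) (T rho : R) :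
  1 <= T ->
  few_two_squares K B ->
  \sum_p (same_freq q p)%:R * spike T (rho - (nsq p.1 + nsq p.2)%:R) <=
  (B * K.*2.+1 ^ n)%:R * (2 * Num.sqrt T + 4 * Num.sqrt ((n.+2 * K ^ 2).*2.+1)%:R).
Proof.
move=> T1 BP; set m := (n.+2 * K ^ 2).*2.+1.
apply: (@le_trans _ _ ((B * K.*2.+1 ^ n)%:R * \sum_(l < m) spike T (rho - l%:R))); last first.
  by rewrite ler_wpM2l// sum_spike.
have lm (p : n.+2.-tuple 'I_(K.*2.+1) * n.+2.-tuple 'I_(K.*2.+1)) : (nsq p.1 + nsq p.2 < m)%N.
  rewrite /m ltnS -[leqRHS]addnn.
  by apply: leq_add; exact: nsq_le.
rewrite (bigID (same_freq q))/= [X in _ + X]big1 ?addr0; last first.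
  by move=> p /negbTE ->; rewrite mul0r.
rewrite (partition_big (fun p => Ordinal (lm p)) xpredT)//=.
rewrite mulr_sumr; apply: ler_sum => l _.
rewrite (eq_bigr (fun=> spike T (rho - l%:R))); last first.
  by move=> p /andP[-> /eqP <-]; rewrite mul1r.
rewrite sumr_const -[leLHS]mulr_natl ler_wpM2r ?spike_ge0// ler_nat.
apply: leq_trans (card_pairs q l BP); rewrite cardsE; apply: eq_leq.
by apply: eq_card => p; rewrite !unfold_in/= -val_eqE.
Qed.

Section schur_poisson.
Variable R : realType.
Local Notation rline := (measurableTypeR R).
Local Notation leb := (@lebesgue_measure R).

Lemma measurable_poisson d (X : measurableType d) (L : R) (g : X -> R) :
  measurable_fun setT g -> measurable_fun setT (fun x => poisson L (g x)).
Proof.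
move=> mg; apply: (measurableT_comp (f := poisson L)) => //.
by apply: continuous_measurable_fun; apply: continuous_poisson => x; exact: cvg_id.
Qed.

Variables (J : finType) (c tau : J -> R) (S T A : R).
Hypotheses (T1 : 1 <= T) (A0 : 0 < A) (c0 : forall j, 0 <= c j).
Hypothesis cS : forall rho, \sum_j c j * spike T (rho + tau j) <= S.

Let T0 : 0 < T. Proof. exact: lt_le_trans T1. Qed.

Let pT x : 0 <= poisson T x. Proof. exact: poisson_ge0 (ltW T0). Qed.

Let pA x : 0 <= poisson A x. Proof. exact: poisson_ge0 (ltW A0). Qed.

(** In the variables a = xi1 + xi2 and xi2, the integral over xi2 is that of
    [integral_poisson_parabola], and the sum over j of the resulting spikes is at
    most S, uniformly in a. The remaining integral over a is the mass pi of the
    kernel at scale A, whatever A is. *)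
Lemma schur_poisson (s : R) :
  (\sum_j \int[(leb \x leb)%E]_p (c j * (poisson T (tau j - p.1 ^+ 2 - p.2 ^+ 2)
      * poisson A (s - (p.1 + p.2))))%:E <= (4 * pi ^+ 2 * S)%:E)%E.
Proof.
pose f j (p : rline * rline) := c j * (poisson T (tau j - (p.1 - p.2) ^+ 2 - p.2 ^+ 2)
      * poisson A (s - p.1)).
have f0 j p : 0 <= f j p.
  by apply: mulr_ge0 => //; exact: mulr_ge0.
have mf j : measurable_fun setT (f j).
  apply: measurable_funM => //; apply: measurable_funM; apply: measurable_poisson.
    apply: measurable_funB; last by apply: measurable_funX.
    apply: measurable_funB => //; apply: measurable_funX.
    exact: measurable_funB.
  exact: measurable_funB.
have fE j : (\int[(leb \x leb)%E]_p (c j * (poisson T (tau j - p.1 ^+ 2 - p.2 ^+ 2)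
      * poisson A (s - (p.1 + p.2))))%:E = \int[leb]_a \int[leb]_y (f j (a, y))%:E)%E.
  rewrite fubini_tonelli2; last 2 first.
  - apply/measurable_EFinP.
    apply: measurable_funM => //; apply: measurable_funM; apply: measurable_poisson.
      apply: measurable_funB; last by apply: measurable_funX.
      by apply: measurable_funB => //; apply: measurable_funX.
    by apply: measurable_funB => //; exact: measurable_funD.
  - by move=> p; rewrite lee_fin; apply: mulr_ge0 => //; exact: mulr_ge0.
  rewrite (fubini_tonelli (EFin \o f j)); last 2 first.
  - exact/measurable_EFinP.
  - by move=> p; rewrite lee_fin.
  apply: eq_integral => y _; rewrite /fubini_G/=.
  rewrite -(ge0_integral_translate y (G := fun a => f j (a, y))).
  - apply: eq_integral => x _; rewrite /f /=.
    by rewrite (addrC y) addrK.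
  - have c1 : continuous (fun a : R => poisson T (tau j - (a - y) ^+ 2 - y ^+ 2)).
      apply: continuous_poisson => x; under eq_fun do rewrite expr2.
      apply: cvgB; last exact: cvg_cst.
      apply: cvgB; first exact: cvg_cst.
      by apply: cvgM; apply: cvgB; (exact: cvg_cst || exact: cvg_id).
    have c2 : continuous (fun a : R => poisson A (s - a)).
      by apply: continuous_poisson => x; apply: cvgB; [exact: cvg_cst|exact: cvg_id].
    rewrite /f/= => x; apply: cvgM; first exact: cvg_cst.
    by apply: cvgM; [exact: c1|exact: c2].
  - by move=> x; exact: f0.
under eq_bigr do rewrite fE.
have mF j : measurable_fun setT (fun a => \int[leb]_y (f j (a, y))%:E)%E.
  apply: (measurable_fun_fubini_tonelli_F (EFin \o f j)) => //.
    exact/measurable_EFinP.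
  by move=> p; rewrite lee_fin.
rewrite -ge0_integral_sum//; last first.
  by move=> j a _; apply: integral_ge0 => y _; rewrite lee_fin.
have mP : measurable_fun setT (fun a : R => (poisson A (a - s))%:E).
  apply/measurable_EFinP; apply: measurable_poisson; exact: measurable_funB.
apply: (@le_trans _ _ (\int[leb]_a ((4 * pi * S)%:E * (poisson A (a - s))%:E))%E); last first.
  have S0 : 0 <= S.
    apply: le_trans (cS 0); apply: sumr_ge0 => j _.
    by rewrite mulr_ge0 ?spike_ge0.
  rewrite ge0_integralZl//.
  - by rewrite integral_poisson// -EFinM lee_fin; lra.
  - by move=> a _; rewrite lee_fin.
  - by rewrite lee_fin !mulr_ge0// pi_ge0.
apply: ge0_le_integral => //.
- move=> a _; apply: sume_ge0 => j _; apply: integral_ge0 => y _.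
  by rewrite lee_fin.
- by apply: emeasurable_sum => j.
- exact: emeasurable_funM.
move=> a _.
apply: (@le_trans _ _ (\sum_j (4 * pi * poisson A (a - s) *
    (c j * spike T (- (a ^+ 2 / 2) + tau j)))%:E)%E); last first.
  rewrite sumEFin -EFinM lee_fin -mulr_sumr.
  rewrite [leRHS]mulrAC; apply: ler_wpM2l; last exact: cS.
  by apply: mulr_ge0 => //; rewrite mulr_ge0// pi_ge0.
apply: lee_sum => j _.
have mg : measurable_fun setT (fun y : R => (poisson T (tau j - (a - y) ^+ 2 - y ^+ 2))%:E).
  apply/measurable_EFinP; apply: measurable_poisson.
  apply: measurable_funB; last by apply: measurable_funX.
  by apply: measurable_funB => //; apply: measurable_funX; exact: measurable_funB.
have E y : ((f j (a, y))%:E = (c j * poisson A (a - s))%:E *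
    (poisson T (tau j - (a - y) ^+ 2 - y ^+ 2))%:E)%E.
  rewrite -EFinM /f/= -(opprB a s) poisson_even; congr _%:E; ring.
under eq_integral do rewrite E.
rewrite ge0_integralZl//; last 2 first.
- by move=> y _; rewrite lee_fin.
- by rewrite lee_fin; exact: mulr_ge0.
have -> : 4 * pi * poisson A (a - s) * (c j * spike T (- (a ^+ 2 / 2) + tau j)) =
  (c j * poisson A (a - s)) * (4 * pi * spike T (tau j - a ^+ 2 / 2)).
  by rewrite (addrC (- _)); ring.
rewrite [leRHS]EFinM; apply: lee_wpmul2l; last exact: integral_poisson_parabola.
by rewrite lee_fin; exact: mulr_ge0.
Qed.

End schur_poisson.

(** * The transform of a square integrable function *)

Section complex_norms.
Variable R : realType.
Local Notation normc := ComplexField.Normc.normc.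

Lemma normc_sq (z : R[i]) : normc z ^+ 2 = complex.Re z ^+ 2 + complex.Im z ^+ 2.
Proof. by case: z => a b /=; rewrite sqr_sqrtr// addr_ge0 ?sqr_ge0. Qed.

Lemma normc_ge0 (z : R[i]) : 0 <= normc z.
Proof. by case: z => a b; exact: sqrtr_ge0. Qed.

Lemma cLnormE d (X : measurableType d) (mu : {measure set X -> \bar R}) (n : nat)
    (f : X -> R[i]) :
  cLnorm mu n%:R f = ((\int[mu]_x (normc (f x) ^+ n)%:E) `^ (n%:R^-1))%E.
Proof.
rewrite /cLnorm unlock; congr (_ `^ _)%E; apply: eq_integral => x _.
by rewrite /= ger0_norm ?normc_ge0// powR_mulrn// normc_ge0.
Qed.

Lemma Re_mul (x y : R[i]) :
  complex.Re (x * y) = complex.Re x * complex.Re y - complex.Im x * complex.Im y.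
Proof. by case: x y => [a b] [c e]. Qed.

Lemma Im_mul (x y : R[i]) :
  complex.Im (x * y) = complex.Re x * complex.Im y + complex.Im x * complex.Re y.
Proof. by case: x y => [a b] [c e]. Qed.

End complex_norms.

Section plancherel.
Variables (R : realType) (n K : nat).
Local Notation rline := (measurableTypeR R).
Local Notation leb := (@lebesgue_measure R).
Local Notation normc := ComplexField.Normc.normc.
Local Notation box := (n.-tuple 'I_(K.*2.+1)).
Local Notation mu := (@RT_measure R n).

Definition phase_RT (i : box) (p : RT R n * rline) : R :=
  2 * pi * pairing p.1 p.2 (box_int i).

Lemma measurable_phase_RT i : measurable_fun setT (phase_RT i).
Proof.
apply: measurable_funM => //; apply: measurable_funD.
  by apply: measurable_funM => //; exact: measurableT_comp.
apply: measurable_sum => j; apply: measurable_funM => //.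
apply: (measurableT_comp (measurable_tnth j)).
exact: measurableT_comp.
Qed.

Definition bessel_cst : R := 2 ^+ n.+1 * 16 * pi.

Lemma bessel_cst_gt0 : 0 < bessel_cst.
Proof. by rewrite /bessel_cst !mulr_gt0 ?pi_gt0// exprn_gt0. Qed.

Let kappa (L : R) (i j : box) (p : rline * rline) : R :=
  (i == j)%:R * (2 ^+ n.+1 * 16 * poisson L (p.1 - p.2)).

Variables (phi : RT R n -> R[i]).
Hypothesis mphi : cmeasurable phi.
Hypothesis phi2 : (\int[mu]_z (normc (phi z) ^+ 2)%:E < +oo)%E.

Let Re z := complex.Re (phi z).
Let Im z := complex.Im (phi z).

(** The kernel for [bessel] is the diagonal matrix of Poisson kernels in the
    frequency variable of R, as the characters of T^n are orthogonal; its rows have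
    mass [bessel_cst]. The weight is at least 1/2 on the support [-A, A] of the
    truncation. *)
Lemma bessel_trunc (A B : R) : 0 < A ->
  (\sum_(i : box) \int[leb]_(xi in `[(- B)%R, B])
     (normc (trunc_fourier phi A xi (box_int i)) ^+ 2)%:E <=
   (4 * bessel_cst)%:E * \int[mu]_z (normc (phi z) ^+ 2)%:E)%E.
Proof.
move=> A0; have LA0 : 0 < 2 * A by rewrite mulr_gt0.
pose D : set (RT R n) := `[- A, A] `*` setT.
have mD : measurable D by exact: measurableX.
have muD : (mu D < +oo)%E.
  have lA : (leb `[(- A)%R, A]%classic < +oo)%E.
    by rewrite lebesgue_measure_itv/=; case: ifP => _; rewrite ltry.
  rewrite /RT_measure product_measure1E// lte_mul_pinfty//.
    by rewrite ge0_fin_numE.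
  by apply: (le_lt_trans (probability_le1 _ measurableT)); rewrite ltry.
pose a := Re \_ D; pose b := Im \_ D.
have [mRe mIm] := mphi.
have ma : measurable_fun setT a.
  by apply/(measurable_restrictT _ _).1 => //; exact: measurable_funTS.
have mb : measurable_fun setT b.
  by apply/(measurable_restrictT _ _).1 => //; exact: measurable_funTS.
have i2 : rintegrable mu (fun z => Re z ^+ 2 + Im z ^+ 2).
  apply/integrableP; split.
    by apply/measurable_EFinP; apply: measurable_funD; exact: measurable_funX.
  under eq_integral do rewrite /= ger0_norm ?addr_ge0 ?sqr_ge0// -normc_sq.
  exact: phi2.
have iD : rintegrable mu (\1_D : RT R n -> R).
  apply/integrableP; split; first exact/measurable_EFinP/measurable_indic.
  under eq_integral do rewrite /= ger0_norm//.
  by rewrite integral_indic// setIT.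
have iab : rintegrable mu (fun z => (Re z ^+ 2 + Im z ^+ 2) + \1_D z) by exact: rintegrableD.
have am (f : RT R n -> R) z : f z ^+ 2 <= Re z ^+ 2 + Im z ^+ 2 ->
    `|(f \_ D) z| <= (Re z ^+ 2 + Im z ^+ 2) + \1_D z.
  move=> fz; rewrite patchE indicE; case: (z \in D) => /=; last first.
    by rewrite normr0 addr0 addr_ge0 ?sqr_ge0.
  have := sqr_ge0 (`|f z| - 1); rewrite sqrrB1 real_normK ?num_real//.
  by have := sqr_ge0 (f z); lra.
have ai : rintegrable mu a.
  by apply: rintegrable_le iab => // z; apply: am; rewrite lerDl sqr_ge0.
have bi : rintegrable mu b.
  by apply: rintegrable_le iab => // z; apply: am; rewrite lerDr sqr_ge0.
have abi : rintegrable mu (fun z => a z ^+ 2 + b z ^+ 2).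
  apply: rintegrable_le i2.
    by apply: measurable_funD; exact: measurable_funX.
  move=> z; rewrite ger0_norm ?addr_ge0 ?sqr_ge0//.
  by rewrite /a /b !patchE; case: ifP => //; rewrite expr0n/= addr0 addr_ge0 ?sqr_ge0.
have mk i j : measurable_fun setT (kappa (2 * A) i j).
  apply: measurable_funM => //; apply: measurable_funM => //.
  by apply: measurable_poisson; exact: measurable_funB.
have k0 i j p : 0 <= kappa (2 * A) i j p.
  apply: mulr_ge0; first by case: (_ == _).
  by apply: mulr_ge0; [rewrite mulr_ge0// exprn_ge0|exact: poisson_ge0 (ltW LA0)].
have ksym i j y y' : kappa (2 * A) i j (y, y') = kappa (2 * A) j i (y', y).
  by rewrite /kappa/= eq_sym -(opprB y' y) poisson_even.
have kM i y : (\sum_j \int[leb]_y' (kappa (2 * A) i j (y, y'))%:E <= bessel_cst%:E)%E.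
  rewrite (bigD1 i)//= big1 ?adde0; last first.
    move=> j /negbTE ji; rewrite integral0_eq// => y' _.
    by rewrite /kappa eq_sym ji mul0r.
  under eq_integral => y' _.
    rewrite /kappa eqxx mul1r/= -(opprB y' y) poisson_even EFinM. over.
  rewrite ge0_integralZl//.
  - by rewrite integral_poisson// /bessel_cst -EFinM.
  - by apply/measurable_EFinP; apply: measurable_poisson; exact: measurable_funB.
  - by move=> y' _; rewrite lee_fin; exact: poisson_ge0 (ltW LA0).
have kP i j y y' c : `|\int[mu]_z (bump (2 * A) z.1 *
    cos (c + (phase_RT i (z, y) - phase_RT j (z, y'))))| <= kappa (2 * A) i j (y, y').
  pose k : Zn n := [tuple tnth (box_int i) l - tnth (box_int j) l | l < n].
  have := osc_RT (y - y') k LA0 c.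
  have -> : (k == [tuple 0 | _ < n]) = (i == j).
    apply/eqP/eqP => [k0'|ij].
      apply: box_int_inj; apply: eq_from_tnth => l.
      have := congr1 (fun t => tnth t l) k0'; rewrite !tnth_mktuple => /eqP.
      by rewrite subr_eq0 => /eqP.
    by apply: eq_from_tnth => l; rewrite !tnth_mktuple ij subrr.
  move=> H; apply: (le_trans _ (le_trans H _)); last first.
    by rewrite /kappa/= le_eqVlt; apply/orP; left; apply/eqP; ring.
  rewrite le_eqVlt; apply/orP; left; apply/eqP; congr `|_|.
  apply: eq_rintegral => z; congr (_ * cos (_ + _)).
  rewrite /phase_RT /pairing/= -mulrBr; congr (_ * _).
  have -> : \sum_(l < n) tnth z.2 l * (tnth k l)%:~R =
    \sum_(l < n) tnth z.2 l * (tnth (box_int i) l)%:~R -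
    \sum_(l < n) tnth z.2 l * (tnth (box_int j) l)%:~R :> R.
    rewrite -sumrB; apply: eq_bigr => l _.
    by rewrite tnth_mktuple intrB; ring.
  by ring.
have abw z : bump (2 * A) z.1 < 1 / 2 -> a z = 0 /\ b z = 0.
  move=> wz; have zD : z \notin D.
    apply: contraTN wz; rewrite inE -leNgt => -[/= + _].
    by rewrite in_itv/= -ler_norml => zA; exact: bump_half.
  by rewrite /a /b !patchE (negbTE zD).
have mB : measurable (`[- B, B]%classic : set rline) by exact: measurable_itv.
have Bfin : (leb `[(- B)%R, B]%classic < +oo)%E.
  by rewrite lebesgue_measure_itv/=; case: ifP => _; rewrite ltry.
have := bessel bessel_cst_gt0 mk k0 ksym kM (rintegrable_bump_RT n LA0)
  (fun z => bump_ge0 _ _) measurable_phase_RT kP mB Bfin ai bi abi abw.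
move=> H; apply: (le_trans _ (le_trans H _)).
  apply: lee_sum => i _; rewrite le_eqVlt; apply/orP; left; apply/eqP.
  apply: eq_integral => xi _; rewrite normc_sq /trunc_fourier /cintegral/=; congr (_ ^+ 2 + _ ^+ 2)%:E.
    rewrite [LHS]Rintegral_mkcond; apply: eq_rintegral => z.
    rewrite /a /b !patchE; case: ifP => _; last by rewrite !mul0r addr0.
    by rewrite Re_mul/= cosN sinN mulrN opprK.
  rewrite [LHS]Rintegral_mkcond; apply: eq_rintegral => z.
  rewrite /a /b !patchE; case: ifP => _; last by rewrite !mul0r subr0.
  by rewrite Im_mul/= cosN sinN mulrN addrC.
apply: lee_wpmul2l; first by rewrite lee_fin mulr_ge0// ltW// bessel_cst_gt0.
apply: ge0_le_integral => //.
- by move=> z _; rewrite lee_fin addr_ge0 ?sqr_ge0.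
- by apply/measurable_EFinP; apply: measurable_funD; exact: measurable_funX.
- under eq_fun do rewrite normc_sq.
  by apply/measurable_EFinP; apply: measurable_funD; exact: measurable_funX.
move=> z _; rewrite lee_fin normc_sq /a /b !patchE; case: ifP => // _.
by rewrite expr0n/= addr0 addr_ge0 ?sqr_ge0.
Qed.

End plancherel.

Section plancherel.
Variables (R : realType) (n K : nat).
Local Notation rline := (measurableTypeR R).
Local Notation leb := (@lebesgue_measure R).
Local Notation normc := ComplexField.Normc.normc.
Local Notation box := (n.-tuple 'I_(K.*2.+1)).
Local Notation mu := (@RT_measure R n).
Variables (phi : RT R n -> R[i]).
Hypothesis mphi : cmeasurable phi.

Lemma measurable_normc_sq d (X : measurableType d) (f : X -> R[i]) :
  cmeasurable f -> measurable_fun setT (fun x => (normc (f x) ^+ 2)%:E).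
Proof.
move=> [mr mi]; apply/measurable_EFinP; under eq_fun do rewrite normc_sq.
by apply: measurable_funD; exact: measurable_funX.
Qed.

Lemma cmeasurable_trunc_fourier (A : R) (k : Zn n) :
  cmeasurable (fun xi => trunc_fourier phi A xi k).
Proof.
have [mr mi] := mphi.
pose D : set (RT R n) := `[- A, A] `*` setT.
have mD : measurable D by exact: measurableX.
pose th (q : rline * RT R n) : R := - (2 * pi * pairing q.2 q.1 k).
have mth : measurable_fun setT th.
  apply: measurableT_comp => //; apply: measurable_funM => //.
  apply: measurable_funD.
    apply: measurable_funM; last exact: measurable_fst.
    exact: (measurableT_comp measurable_fst measurable_snd).
  apply: measurable_sum => j; apply: measurable_funM => //.
  apply: (measurableT_comp (measurable_tnth j)).
  exact: (measurableT_comp measurable_snd measurable_snd).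
have mc : measurable_fun setT (fun q => cos (th q)).
  exact: measurable_cos_comp.
have ms : measurable_fun setT (fun q => sin (th q)).
  exact: measurable_sin_comp.
have mr2 : measurable_fun setT (fun q : rline * RT R n => complex.Re (phi q.2)).
  exact: (measurableT_comp mr measurable_snd).
have mi2 : measurable_fun setT (fun q : rline * RT R n => complex.Im (phi q.2)).
  exact: (measurableT_comp mi measurable_snd).
have mD2 : measurable_fun setT (fun q : rline * RT R n => \1_D q.2 : R).
  apply: (measurableT_comp _ measurable_snd); exact: measurable_indic.
split; rewrite /trunc_fourier /cintegral/=.
  rewrite (_ : (fun xi => _) = (fun xi => \int[mu]_z ((complex.Re (phi z) * cos (th (xi, z)) -
      complex.Im (phi z) * sin (th (xi, z))) * \1_D z))).
    apply: (@measurable_Rintegral_param _ _ _ _ _ _ (fun q : rline * RT R n =>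
       (complex.Re (phi q.2) * cos (th q) - complex.Im (phi q.2) * sin (th q)) * \1_D q.2)).
    apply: measurable_funM => //.
    by apply: measurable_funB; exact: measurable_funM.
  apply/funext => xi; rewrite [LHS]Rintegral_mkcond; apply: eq_rintegral => z.
  by rewrite patchE indicE Re_mul/=; case: (_ \in _); rewrite ?mulr1 ?mulr0.
rewrite (_ : (fun xi => _) = (fun xi => \int[mu]_z ((complex.Re (phi z) * sin (th (xi, z)) +
      complex.Im (phi z) * cos (th (xi, z))) * \1_D z))).
  apply: (@measurable_Rintegral_param _ _ _ _ _ _ (fun q : rline * RT R n =>
     (complex.Re (phi q.2) * sin (th q) + complex.Im (phi q.2) * cos (th q)) * \1_D q.2)).
  apply: measurable_funM => //.
  by apply: measurable_funD; exact: measurable_funM.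
apply/funext => xi; rewrite [LHS]Rintegral_mkcond; apply: eq_rintegral => z.
by rewrite patchE indicE Im_mul/=; case: (_ \in _); rewrite ?mulr1 ?mulr0.
Qed.

Hypothesis phi2 : (\int[mu]_z (normc (phi z) ^+ 2)%:E < +oo)%E.

Lemma freq_L2sq_box (h : rline -> Zn n -> R[i]) :
  (\sum_(i : box) \int[leb]_xi (normc (h xi (box_int i)) ^+ 2)%:E <= freq_L2sq h)%E.
Proof.
apply: esum_ge; pose r := [seq box_int i | i <- enum {: box}].
exists [set` r]; first by split=> //; exact: finite_seq.
rewrite -fsbig_seq/=; last by rewrite map_inj_uniq ?enum_uniq//; exact: box_int_inj.
by rewrite big_map big_enum.
Qed.

(** The bound of [bessel_trunc] does not depend on the truncation, so it passes to
    the limit in L^2. The constant doubles because of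
    |u|^2 <= 2 |u - v|^2 + 2 |v|^2. *)
Lemma plancherel_le (g : rline -> Zn n -> R[i]) (B : R) : is_fourier phi g ->
  (\sum_(i : box) \int[leb]_(xi in `[(- B)%R, B]) (normc (g xi (box_int i)) ^+ 2)%:E <=
   (8 * bessel_cst R n)%:E * \int[mu]_z (normc (phi z) ^+ 2)%:E)%E.
Proof.
move=> [mg gfin gcvg]; apply/lee_addgt0Pr => e e0.
(* A truncation whose transform is close to g in L^2. *)
have [A [A0 Ae]] : exists A, 0 < A /\
    (freq_L2sq (fun xi k => (g xi k - trunc_fourier phi A xi k)%R) < (e / 2)%:E)%E.
  have e20 : (0 < (e / 2)%:E :> \bar R)%E by rewrite lte_fin divr_gt0.
  have H : \forall A \near +oo,
    (freq_L2sq (fun xi k => (g xi k - trunc_fourier phi A xi k)%R) < (e / 2)%:E)%E.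
    exact: (gcvg _ (open_ereal_lt' e20)).
  by have [A [? ?]] := filter_ex (filterI (nbhs_pinfty_gt (@real0 R)) H); exists A.
have mT k := cmeasurable_trunc_fourier A k.
have mgT k : cmeasurable (fun xi => g xi k - trunc_fourier phi A xi k).
  have [g1 g2] := mg k; have [t1 t2] := mT k; split.
    rewrite (_ : (fun xi => _) = (fun xi => complex.Re (g xi k) -
       complex.Re (trunc_fourier phi A xi k))); first exact: measurable_funB.
    by apply/funext => xi; case: (g _ _) (trunc_fourier _ _ _ _) => [a b] [c d].
  rewrite (_ : (fun xi => _) = (fun xi => complex.Im (g xi k) -
       complex.Im (trunc_fourier phi A xi k))); first exact: measurable_funB.
  by apply/funext => xi; case: (g _ _) (trunc_fourier _ _ _ _) => [a b] [c d].
have mB : measurable (`[- B, B]%classic : set rline) by exact: measurable_itv.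
apply: (@le_trans _ _ (\sum_(i : box) (2%:E * \int[leb]_(xi in `[(- B)%R, B])
       (normc (g xi (box_int i) - trunc_fourier phi A xi (box_int i)) ^+ 2)%:E +
     2%:E * \int[leb]_(xi in `[(- B)%R, B])
       (normc (trunc_fourier phi A xi (box_int i)) ^+ 2)%:E))%E).
  apply: lee_sum => i _.
  have m1 := measurable_funTS (D := `[- B, B]%classic) (measurable_normc_sq (mgT (box_int i))).
  have m2 := measurable_funTS (D := `[- B, B]%classic) (measurable_normc_sq (mT (box_int i))).
  have m3 := measurable_funTS (D := `[- B, B]%classic) (measurable_normc_sq (mg (box_int i))).
  rewrite -ge0_integralZl ?lee_fin//; last first.
    by move=> xi _; rewrite lee_fin sqr_ge0.
  rewrite -ge0_integralZl ?lee_fin//; last first.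
    by move=> xi _; rewrite lee_fin sqr_ge0.
  rewrite -ge0_integralD//; last 4 first.
  - by move=> xi _; rewrite -EFinM lee_fin mulr_ge0// sqr_ge0.
  - exact: emeasurable_funM.
  - by move=> xi _; rewrite -EFinM lee_fin mulr_ge0// sqr_ge0.
  - exact: emeasurable_funM.
  apply: ge0_le_integral => //.
  - by move=> xi _; rewrite lee_fin sqr_ge0.
  - by apply: emeasurable_funD; exact: emeasurable_funM.
  move=> xi _; rewrite -!EFinM -EFinD lee_fin !normc_sq.
  case: (g _ _) (trunc_fourier _ _ _ _) => [a b] [c d] /=.
  have := sqr_ge0 (a - c - c); have := sqr_ge0 (b - d - d); nra.
rewrite big_split/= addeC; apply: leeD.
  rewrite -ge0_sume_distrr; last by move=> i _; apply: integral_ge0 => xi _; rewrite lee_fin sqr_ge0.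
  rewrite (_ : 8 * bessel_cst R n = 2 * (4 * bessel_cst R n)); last by ring.
  rewrite EFinM -muleA; apply: lee_wpmul2l; first by rewrite lee_fin.
  exact: bessel_trunc.
rewrite -ge0_sume_distrr; last by move=> i _; apply: integral_ge0 => xi _; rewrite lee_fin sqr_ge0.
rewrite (_ : e = 2 * (e / 2)) ?EFinM; last by field.
apply: lee_wpmul2l; first by rewrite lee_fin.
apply: le_trans (ltW Ae).
apply: le_trans (freq_L2sq_box _).
apply: lee_sum => i _; apply: ge0_subset_integral => //.
  exact: measurable_normc_sq.
by move=> xi _; rewrite lee_fin sqr_ge0.
Qed.

End plancherel.

(** * The bilinear estimate and the slab *)

Section bilinear_extension.
Context d1 d2 (X : measurableType d1) (Y : measurableType d2) (R : realType).
Variable nu : {sigma_finite_measure set Y -> \bar R}.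
Variables (I : finType) (a b : I -> Y -> R) (theta : I -> X * Y -> R).
Hypotheses (ai : forall i, rintegrable nu (a i)) (bi : forall i, rintegrable nu (b i)).
Hypothesis mtheta : forall i, measurable_fun setT (theta i).

(** Amplitude and phase of the square of an extension operator, as an extension
    operator indexed by pairs. *)
Definition sq_re (p : I * I) (y : Y * Y) := a p.1 y.1 * a p.2 y.2 - b p.1 y.1 * b p.2 y.2.
Definition sq_im (p : I * I) (y : Y * Y) := a p.1 y.1 * b p.2 y.2 + b p.1 y.1 * a p.2 y.2.
Definition sq_phase (p : I * I) (q : X * (Y * Y)) :=
  theta p.1 (q.1, q.2.1) + theta p.2 (q.1, q.2.2).

Lemma rintegrable_sq_re p : rintegrable (prod_measure nu nu) (sq_re p).
Proof.
exact: (rintegrableB (rintegrable_tensor (ai p.1) (ai p.2))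
  (rintegrable_tensor (bi p.1) (bi p.2))).
Qed.

Lemma rintegrable_sq_im p : rintegrable (prod_measure nu nu) (sq_im p).
Proof.
exact: (rintegrableD (rintegrable_tensor (ai p.1) (bi p.2))
  (rintegrable_tensor (bi p.1) (ai p.2))).
Qed.

Lemma measurable_sq_phase p : measurable_fun setT (sq_phase p).
Proof.
apply: measurable_funD.
  apply: (measurableT_comp (mtheta p.1)); apply: measurable_fun_pair => //.
  exact: (measurableT_comp measurable_fst measurable_snd).
apply: (measurableT_comp (mtheta p.2)); apply: measurable_fun_pair => //.
exact: (measurableT_comp measurable_snd measurable_snd).
Qed.

Let mcos i : measurable_fun setT (fun q => cos (theta i q)).
Proof.
exact: measurable_cos_comp.
Qed.

Let msin i : measurable_fun setT (fun q => sin (theta i q)).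
Proof.
exact: measurable_sin_comp.
Qed.

Let mcx i x : measurable_fun setT (fun y => cos (theta i (x, y))).
Proof. exact: measurableT_comp (mcos i) (measurable_pair1 x). Qed.

Let msx i x : measurable_fun setT (fun y => sin (theta i (x, y))).
Proof. exact: measurableT_comp (msin i) (measurable_pair1 x). Qed.

Let re_int i x : rintegrable nu (fun y => a i y * cos (theta i (x, y)) - b i y * sin (theta i (x, y))).
Proof.
apply: rintegrableB; apply: rintegrableM_le1 => // y; [exact: cos_max|exact: sin_max].
Qed.

Let im_int i x : rintegrable nu (fun y => a i y * sin (theta i (x, y)) + b i y * cos (theta i (x, y))).
Proof.
apply: rintegrableD; apply: rintegrableM_le1 => // y; [exact: sin_max|exact: cos_max].
Qed.

Lemma osc_re_sq p x : osc_re (prod_measure nu nu) sq_re sq_im sq_phase p x =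
  osc_re nu a b theta p.1 x * osc_re nu a b theta p.2 x -
  osc_im nu a b theta p.1 x * osc_im nu a b theta p.2 x.
Proof.
rewrite /osc_re /osc_im -(rintegral_tensor (re_int p.1 x) (re_int p.2 x)).
rewrite -(rintegral_tensor (im_int p.1 x) (im_int p.2 x)).
rewrite -(RintegralB measurableT (rintegrable_tensor (re_int p.1 x) (re_int p.2 x))
  (rintegrable_tensor (im_int p.1 x) (im_int p.2 x))).
apply: eq_rintegral => y; rewrite /sq_re /sq_im /sq_phase/= cosD sinD; ring.
Qed.

Lemma osc_im_sq p x : osc_im (prod_measure nu nu) sq_re sq_im sq_phase p x =
  osc_re nu a b theta p.1 x * osc_im nu a b theta p.2 x +
  osc_im nu a b theta p.1 x * osc_re nu a b theta p.2 x.
Proof.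
rewrite /osc_re /osc_im -(rintegral_tensor (re_int p.1 x) (im_int p.2 x)).
rewrite -(rintegral_tensor (im_int p.1 x) (re_int p.2 x)).
rewrite -(RintegralD measurableT (rintegrable_tensor (re_int p.1 x) (im_int p.2 x))
  (rintegrable_tensor (im_int p.1 x) (re_int p.2 x))).
apply: eq_rintegral => y; rewrite /sq_re /sq_im /sq_phase/= cosD sinD; ring.
Qed.

Lemma sum_osc_sq x :
  (\sum_p osc_re (prod_measure nu nu) sq_re sq_im sq_phase p x) ^+ 2 +
  (\sum_p osc_im (prod_measure nu nu) sq_re sq_im sq_phase p x) ^+ 2 =
  ((\sum_i osc_re nu a b theta i x) ^+ 2 + (\sum_i osc_im nu a b theta i x) ^+ 2) ^+ 2.
Proof.
under eq_bigr do rewrite osc_re_sq.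
under [X in _ + X ^+ 2]eq_bigr do rewrite osc_im_sq.
rewrite sumrB big_split/=.
rewrite -(pair_bigA _ (fun i j => osc_re nu a b theta i x * osc_re nu a b theta j x))/=.
rewrite -(pair_bigA _ (fun i j => osc_im nu a b theta i x * osc_im nu a b theta j x))/=.
rewrite -(pair_bigA _ (fun i j => osc_re nu a b theta i x * osc_im nu a b theta j x))/=.
rewrite -(pair_bigA _ (fun i j => osc_im nu a b theta i x * osc_re nu a b theta j x))/=.
under eq_bigr do rewrite -mulr_sumr. rewrite -mulr_suml.
under [X in (_ - X) ^+ 2 + _]eq_bigr do rewrite -mulr_sumr.
under [X in _ + (X + _) ^+ 2]eq_bigr do rewrite -mulr_sumr.
under [X in _ + (_ + X) ^+ 2]eq_bigr do rewrite -mulr_sumr.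
rewrite -!mulr_suml; ring.
Qed.

Hypothesis abi : forall i, rintegrable nu (fun y => a i y ^+ 2 + b i y ^+ 2).

Lemma sum_sq_mass :
  (\sum_p \int[prod_measure nu nu]_y (sq_re p y ^+ 2 + sq_im p y ^+ 2)%:E =
   ((\sum_i \int[nu]_y (a i y ^+ 2 + b i y ^+ 2)) ^+ 2)%:E)%E.
Proof.
have E p y : sq_re p y ^+ 2 + sq_im p y ^+ 2 =
    (a p.1 y.1 ^+ 2 + b p.1 y.1 ^+ 2) * (a p.2 y.2 ^+ 2 + b p.2 y.2 ^+ 2).
  by rewrite /sq_re /sq_im; ring.
under eq_bigr => p _.
  under eq_integral do rewrite E.
  rewrite -(rintegral_EFin (rintegrable_tensor (abi p.1) (abi p.2))).
  rewrite (rintegral_tensor (abi p.1) (abi p.2)). over.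
rewrite sumEFin; congr _%:E.
rewrite -(pair_bigA _ (fun i j => (\int[nu]_y (a i y ^+ 2 + b i y ^+ 2)) *
   (\int[nu]_y (a j y ^+ 2 + b j y ^+ 2))))/=.
by under eq_bigr do rewrite -mulr_sumr; rewrite -mulr_suml expr2.
Qed.

End bilinear_extension.

Section L4.
Variables (R : realType) (n K B : nat).
Local Notation rline := (measurableTypeR R).
Local Notation leb := (@lebesgue_measure R).
Local Notation box := (n.+2.-tuple 'I_(K.*2.+1)).
Local Notation mu := (prod_measure leb (@RT_measure R n.+2)).
Local Notation leb2 := (prod_measure leb leb).

Hypothesis BP : few_two_squares K B.

(** The space-time phase of the Schrodinger evolution at frequency (xi, box_int i). *)
Definition phase_ST (i : box) (q : (rline * RT R n.+2) * rline) : R :=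
  2 * pi * (pairing q.1.2 q.2 (box_int i) - q.1.1 * ((q.2 : R) ^+ 2 + (nsq i)%:R)).

Lemma measurable_phase_ST i : measurable_fun setT (phase_ST i).
Proof.
have m11 : measurable_fun setT (fun q : (rline * RT R n.+2) * rline => q.1.1).
  exact: (measurableT_comp measurable_fst measurable_fst).
have m12 : measurable_fun setT (fun q : (rline * RT R n.+2) * rline => q.1.2).
  exact: (measurableT_comp measurable_snd measurable_fst).
apply: measurable_funM => //; apply: measurable_funB; last first.
  apply: measurable_funM => //; apply: measurable_funD => //.
  exact: measurable_funX.
apply: measurable_funD.
  by apply: measurable_funM => //; exact: (measurableT_comp measurable_fst m12).
apply: measurable_sum => j; apply: measurable_funM => //.
apply: (measurableT_comp (measurable_tnth j)).
exact: (measurableT_comp measurable_snd m12).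
Qed.

(** The constant of [osc_slab] in dimension n.+2. *)
Definition slab_cst : R := 2 ^+ n.+4 * 256.

(** The bound for row sums which [schur_poisson] and [sum_spike_pairs] give. *)
Definition schur_cst (T : R) : R := 4 * pi ^+ 2 * (slab_cst *
  ((B * K.*2.+1 ^ n)%:R * (2 * Num.sqrt T + 4 * Num.sqrt ((n.+2 * K ^ 2).*2.+1)%:R))).

Lemma slab_cst_ge0 : 0 <= slab_cst.
Proof. by rewrite mulr_ge0// exprn_ge0. Qed.

Lemma schur_cst_ge0 T : 0 <= schur_cst T.
Proof.
apply: mulr_ge0; first by rewrite mulr_ge0// sqr_ge0.
apply: mulr_ge0; first exact: slab_cst_ge0.
exact: mulr_ge0.
Qed.

Variables (T A : R).
Hypotheses (T1 : 1 <= T) (A0 : 0 < A).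

Let T0 : 0 < T. Proof. exact: lt_le_trans T1. Qed.

Let pT x : 0 <= poisson T x. Proof. exact: poisson_ge0 (ltW T0). Qed.

Let pA x : 0 <= poisson A x. Proof. exact: poisson_ge0 (ltW A0). Qed.

Let en (p : box * box) (y : rline * rline) : R :=
  y.1 ^+ 2 + y.2 ^+ 2 + (nsq p.1 + nsq p.2)%:R.

Let kappa (p q : box * box) (yy : (rline * rline) * (rline * rline)) : R :=
  slab_cst * (same_freq p q)%:R *
  (poisson T (en p yy.1 - en q yy.2) *
   poisson A (yy.1.1 + yy.1.2 - (yy.2.1 + yy.2.2))).

Let men p d (Z : measurableType d) (f : Z -> rline * rline) :
  measurable_fun setT f -> measurable_fun setT (fun z => en p (f z)).
Proof.
move=> mf; apply: measurable_funD => //; apply: measurable_funD; apply: measurable_funX.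
  exact: (measurableT_comp measurable_fst mf).
exact: (measurableT_comp measurable_snd mf).
Qed.

Let mkappa p q : measurable_fun setT (kappa p q).
Proof.
apply: measurable_funM => //; apply: measurable_funM; apply: measurable_poisson.
  by apply: measurable_funB; exact: men.
by apply: measurable_funB; apply: measurable_funD;
  apply: measurableT_comp => //; exact: measurableT_comp.
Qed.

Let kappa_ge0 p q yy : 0 <= kappa p q yy.
Proof.
apply: mulr_ge0; last exact: mulr_ge0.
by apply: mulr_ge0; [exact: slab_cst_ge0|case: same_freq].
Qed.

Let kappa_sym p q y y' : kappa p q (y, y') = kappa q p (y', y).
Proof.
rewrite /kappa/= same_freq_sym -(opprB (en q y')) poisson_even.
by rewrite -(opprB (y'.1 + y'.2)) poisson_even.
Qed.

Let kappa_schur p y :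
  (\sum_q \int[leb2]_y' (kappa p q (y, y'))%:E <= (schur_cst T)%:E)%E.
Proof.
have := @schur_poisson R _ (fun q => slab_cst * (same_freq p q)%:R)
  (fun q => en p y - (nsq q.1 + nsq q.2)%:R)
  (slab_cst * ((B * K.*2.+1 ^ n)%:R *
     (2 * Num.sqrt T + 4 * Num.sqrt ((n.+2 * K ^ 2).*2.+1)%:R)))
  T A T1 A0 _ _ (y.1 + y.2).
move=> H; apply: (le_trans _ (H _ _)).
- apply: lee_sum => q _; rewrite le_eqVlt; apply/orP; left; apply/eqP.
  apply: eq_integral => y' _; rewrite /kappa/=; congr (_ * (poisson T _ * _))%:E.
  by rewrite /en; ring.
- by move=> q; apply: mulr_ge0; [exact: slab_cst_ge0|case: same_freq].
- move=> rho; under eq_bigr => q _ do rewrite addrA -mulrA.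
  rewrite -mulr_sumr; apply: ler_wpM2l; first exact: slab_cst_ge0.
  exact: sum_spike_pairs.
Qed.

Let kappa_osc p q y y' c :
  `|\int[mu]_x (bump T x.1 * bump A x.2.1 *
     cos (c + (sq_phase phase_ST p (x, y) - sq_phase phase_ST q (x, y'))))|
  <= kappa p q (y, y').
Proof.
pose k : Zn n.+2 := [tuple freq2 p j - freq2 q j | j < n.+2].
pose tau := en p y - en q y'; pose xi : R := y.1 + y.2 - (y'.1 + y'.2).
have H := osc_slab tau xi k T0 A0 c.
apply: (le_trans _ (le_trans H _)); last first.
  rewrite /kappa /slab_cst/= /same_freq -/k le_eqVlt; apply/orP; left; apply/eqP.
  by rewrite -/tau -/xi; ring.
rewrite le_eqVlt; apply/orP; left; apply/eqP; congr `|_|.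
apply: eq_rintegral => x; congr (_ * cos (_ + _)).
rewrite /sq_phase /phase_ST /pairing/= /tau /xi /en.
have -> : \sum_(l < n.+2) tnth x.2.2 l * (tnth k l)%:~R =
    \sum_(l < n.+2) tnth x.2.2 l * (tnth (box_int p.1) l)%:~R +
    \sum_(l < n.+2) tnth x.2.2 l * (tnth (box_int p.2) l)%:~R -
    (\sum_(l < n.+2) tnth x.2.2 l * (tnth (box_int q.1) l)%:~R +
    \sum_(l < n.+2) tnth x.2.2 l * (tnth (box_int q.2) l)%:~R) :> R.
  rewrite -!big_split/= -sumrB; apply: eq_bigr => l _.
  by rewrite tnth_mktuple /freq2 intrB !intrD; ring.
by rewrite !natrD; ring.
Qed.

Variables (a b : box -> rline -> R).
Hypotheses (ai : forall i, rintegrable leb (a i)) (bi : forall i, rintegrable leb (b i)).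
Hypothesis abi : forall i, rintegrable leb (fun y => a i y ^+ 2 + b i y ^+ 2).

(** Schur's test for the square of the extension operator. The kernel comes from
    [osc_slab]; its row sums are bounded by [schur_poisson] and [sum_spike_pairs],
    uniformly in A. *)
Lemma bilinear_L4 :
  (\int[mu]_x (bump T x.1 * bump A x.2.1 *
     ((\sum_i osc_re leb a b phase_ST i x) ^+ 2 +
      (\sum_i osc_im leb a b phase_ST i x) ^+ 2) ^+ 2)%:E <=
   (2 * schur_cst T * (\sum_i \int[leb]_y (a i y ^+ 2 + b i y ^+ 2)) ^+ 2)%:E)%E.
Proof.
have wi : rintegrable mu (fun x => bump T x.1 * bump A x.2.1).
  exact: (rintegrable_tensor (rintegrable_bump T0) (rintegrable_bump_RT n.+2 A0)).
have := ttstar (mu := mu) (nu := leb2)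
  (fun p => rintegrable_measurable (rintegrable_sq_re ai bi p))
  (fun p => rintegrable_measurable (rintegrable_sq_im ai bi p))
  (schur_cst_ge0 T) mkappa kappa_ge0 kappa_sym kappa_schur wi
  (rintegrable_sq_re ai bi) (rintegrable_sq_im ai bi)
  (measurable_sq_phase measurable_phase_ST) kappa_osc.
rewrite sum_sq_mass// -EFinM => H; apply: (le_trans _ H).
rewrite le_eqVlt; apply/orP; left; apply/eqP; apply: eq_integral => x _.
by rewrite (sum_osc_sq ai bi measurable_phase_ST).
Qed.

End L4.

Section slab.
Variable R : realType.
Local Notation rline := (measurableTypeR R).
Local Notation leb := (@lebesgue_measure R).

Lemma ge0_integral_mrestr d (X : measurableType d) (mu : {measure set X -> \bar R})
    (D : set X) (mD : measurable D) (f : X -> \bar R) :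
  measurable_fun setT f -> (forall x, 0 <= f x)%E ->
  (\int[mrestr mu mD]_x f x = \int[mu]_(x in D) f x)%E.
Proof.
move=> mf f0; have mDc : measurable (~` D) by exact: measurableC.
rewrite -(setUv D) ge0_integral_setU//; last 2 first.
- by rewrite setUv.
- by apply/disj_set2P; exact: setICr.
rewrite [X in (_ + X)%E](_ : _ = 0)%E ?adde0.
  apply: eq_measure_integral => E mE ED.
  by rewrite /= /mrestr setIidl.
rewrite (eq_measure_integral mzero) ?integral_measure_zero// => E mE ED.
rewrite /= /mrestr /mzero; suff -> : E `&` D = set0 by rewrite measure0.
by apply/seteqP; split=> // x [/ED].
Qed.

(** The weight is at least 1/4 on [0, T] x [-A, A] x T^n, and these sets exhaust
    the slab as A grows: monotone convergence. *)
Lemma slab_integral_le n (T C : R) (F : rline * RT R n -> R) : 0 < T ->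
  measurable_fun setT F -> (forall w, 0 <= F w) ->
  (forall A, 0 < A -> (\int[prod_measure leb (@RT_measure R n)]_w
      (bump (2 * T) w.1 * bump (2 * A) w.2.1 * F w)%:E <= C%:E)%E) ->
  (\int[slab_measure n T]_w (F w)%:E <= (4 * C)%:E)%E.
Proof.
move=> T0 mF F0 FC.
have mEF : measurable_fun setT (EFin \o F) by exact/measurable_EFinP.
pose D (l : nat) : set (rline * RT R n) := [set w | `|w.2.1 : R| <= l.+1%:R].
have mD l : measurable (D l).
  have m21 : measurable_fun setT (fun w : rline * RT R n => w.2.1).
    exact: (measurableT_comp measurable_fst measurable_snd).
  have mI : measurable (`[- l.+1%:R, l.+1%:R]%classic : set rline).
    exact: measurable_itv.
  have := m21 measurableT _ mI; congr (measurable _).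
  by rewrite setTI; apply/seteqP; split => w; rewrite /D/= in_itv/= ler_norml.
have UD : \bigcup_l D l = setT.
  apply/seteqP; split=> // w _; exists (Num.truncn `|w.2.1 : R|) => //.
  by rewrite /D/= ltW// truncnS_gt.
have ndD : nondecreasing_seq D.
  apply/nondecreasing_seqP => l; rewrite subsetEset => w; rewrite /D/= => /le_trans; apply.
  by rewrite ler_nat.
have cv := ge0_nondecreasing_set_cvg_integral (mu := slab_measure n T)
  (f := EFin \o F) ndD mD (fun i => measurable_funTS mEF) (fun i w _ => F0 w).
rewrite UD in cv; rewrite -(cvg_lim _ cv)//.
apply: lime_le; first by apply/cvg_ex; eexists; exact: cv.
apply: nearW => l.
rewrite integral_mkcond.
pose I0T : set rline := `[0, T]%classic.
have mI : measurable I0T by exact: measurable_itv.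
have lI : (leb I0T < +oo)%E.
  by rewrite lebesgue_measure_itv/=; case: ifP => _; rewrite ltry.
pose m1 : {finite_measure set rline -> \bar R} := @mfrestr _ rline R I0T leb mI lI.
have mFD : measurable_fun setT ((EFin \o F) \_ (D l)).
  by apply/(measurable_restrictT _ _).1 => //; exact: measurable_funTS.
have FD0 w : (0 <= ((EFin \o F) \_ (D l)) w)%E.
  by rewrite patchE; case: ifP => // _; rewrite lee_fin.
rewrite [leLHS](_ : _ = \int[(m1 \x @RT_measure R n)%E]_w ((EFin \o F) \_ (D l)) w)%E; last by [].
rewrite fubini_tonelli1// /fubini_F.
have mG : measurable_fun setT (fun t => \int[@RT_measure R n]_z ((EFin \o F) \_ (D l)) (t, z))%E.
  exact: (measurable_fun_fubini_tonelli_F ((EFin \o F) \_ (D l))).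
have G0 t : (0 <= \int[@RT_measure R n]_z ((EFin \o F) \_ (D l)) (t, z))%E.
  exact: integral_ge0.
rewrite [leLHS](ge0_integral_mrestr leb mI mG G0) integral_mkcond.
pose H (w : rline * RT R n) : R := 4 * (bump (2 * T) w.1 * bump (2 * l.+1%:R) w.2.1 * F w).
have mw : measurable_fun setT (fun w : rline * RT R n =>
    bump (2 * T) w.1 * bump (2 * l.+1%:R) w.2.1 * F w).
  apply: measurable_funM => //; apply: measurable_funM.
    exact: (measurableT_comp (@measurable_bump R (2 * T)) measurable_fst).
  apply: (measurableT_comp (@measurable_bump R (2 * l.+1%:R))).
  exact: (measurableT_comp measurable_fst measurable_snd).
have w0 w : 0 <= bump (2 * T) w.1 * bump (2 * l.+1%:R) w.2.1 * F w.
  by rewrite mulr_ge0// mulr_ge0// bump_ge0.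
have mH : measurable_fun setT (EFin \o H).
  by apply/measurable_EFinP; exact: measurable_funM.
have H0 w : 0 <= H w by rewrite /H mulr_ge0.
have mK : measurable_fun setT (fun t => \int[@RT_measure R n]_z (EFin \o H) (t, z))%E.
  have HE0 w : (0 <= (EFin \o H) w)%E by rewrite lee_fin.
  exact: (measurable_fun_fubini_tonelli_F (EFin \o H)).
apply: (@le_trans _ _ (\int[leb]_t \int[@RT_measure R n]_z (H (t, z))%:E)%E).
  apply: ge0_le_integral => //.
  - by move=> t _; rewrite patchE; case: ifP.
  - by apply/(measurable_restrictT _ _).1 => //; exact: measurable_funTS.
  move=> t _; rewrite patchE; case: ifPn => tI; last by apply: integral_ge0 => z _; rewrite lee_fin.
  apply: ge0_le_integral => //.
  - exact: measurableT_comp mFD (measurable_pair1 t).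
  - exact: measurableT_comp mH (measurable_pair1 t).
  move=> z _; rewrite patchE; case: ifPn => zD; last by rewrite lee_fin.
  rewrite /= lee_fin /H/=.
  have tT : `|t : R| <= T.
    by move: tI; rewrite inE /I0T/= in_itv/= => /andP[t0 tT]; rewrite ger0_norm.
  have zl : `|z.1 : R| <= l.+1%:R by move: zD; rewrite inE.
  have b1 := bump_half T0 tT.
  have b2 := bump_half (ltr0Sn R l) zl.
  have b12 : 1 / 2 * (1 / 2) <= bump (2 * T) t * bump (2 * l.+1%:R) z.1.
    by apply: ler_pM => //; lra.
  rewrite mulrA; apply: ler_peMl => //; lra.
have -> : (\int[leb]_t \int[@RT_measure R n]_z (H (t, z))%:E =
    \int[prod_measure leb (@RT_measure R n)]_w (H w)%:E)%E.
  by rewrite [RHS](fubini_tonelli1 (EFin \o H))//.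
rewrite /H; under eq_integral do rewrite EFinM.
rewrite ge0_integralZl//; last by move=> w _; rewrite lee_fin.
  by rewrite EFinM; apply: lee_wpmul2l => //; exact: FC.
exact/measurable_EFinP.
Qed.

End slab.

Section localized.
Variables (R : realType) (n K : nat).
Local Notation rline := (measurableTypeR R).
Local Notation leb := (@lebesgue_measure R).
Local Notation normc := ComplexField.Normc.normc.
Local Notation box := (n.+2.-tuple 'I_(K.*2.+1)).
Variables (eta : R -> R) (N : R).
Hypothesis heta : LP_profile eta.
Hypothesis N0 : 0 < N.
Hypothesis KN : K%:R = 2 * N.
Variable g : rline -> Zn n.+2 -> R[i].
Hypothesis mg : forall k, cmeasurable (g^~ k).

(** The amplitudes of the localized solution: the Littlewood-Paley cutoff times the
    transform g, at the frequency (xi, box_int i). The cutoff vanishes outside the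
    box of size K = 2 N. *)
Definition cutoff (i : box) (xi : rline) : R := eta (freq_norm xi (box_int i) / N).
Definition amp_re i xi := cutoff i xi * complex.Re (g xi (box_int i)).
Definition amp_im i xi := cutoff i xi * complex.Im (g xi (box_int i)).

Lemma freq_norm_tnth (xi : rline) (k : Zn n.+2) j :
  `|(tnth k j)%:~R : R| <= freq_norm xi k.
Proof.
rewrite /freq_norm -!sqrtr_sqr; apply: ler_wsqrtr.
rewrite (bigD1 j)//= addrCA lerDl addr_ge0 ?sqr_ge0//.
by apply: sumr_ge0 => l _; exact: sqr_ge0.
Qed.

Lemma eta_far (r : R) : 2 * N <= r -> eta (r / N) = 0.
Proof. by case: heta => _ _ _ e0 rN; apply: e0; rewrite ler_pdivlMr. Qed.

Lemma freq_norm_xi (xi : rline) (k : Zn n.+2) : `|xi : R| <= freq_norm xi k.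
Proof.
have s0 : 0 <= \sum_(l < n.+2) (tnth k l)%:~R ^+ 2 :> R.
  by apply: sumr_ge0 => l _; exact: sqr_ge0.
by rewrite /freq_norm -sqrtr_sqr; apply: ler_wsqrtr; rewrite lerDl.
Qed.

Lemma cutoff_ge0_le1 i xi : 0 <= cutoff i xi <= 1.
Proof. by case: heta => _ + _ _; exact. Qed.

Lemma measurable_cutoff i : measurable_fun setT (cutoff i).
Proof.
have ce : continuous eta.
  move=> x; apply/differentiable_continuous/derivable1_diffP.
  by case: heta => /(_ 0%N x).
have m1 : measurable_fun setT (fun xi : rline => freq_norm xi (box_int i) : R).
  apply: (@measurableT_comp _ _ _ _ _ _ (@Num.sqrt R) _ (fun xi : rline =>
    (xi : R) ^+ 2 + \sum_(j < n.+2) ((tnth (box_int i) j)%:~R) ^+ 2)).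
    by apply: continuous_measurable_fun; exact: sqrt_continuous.
  by apply: measurable_funD => //; exact: measurable_funX.
apply: (@measurableT_comp _ _ _ _ _ _ eta _ (fun xi : rline =>
    freq_norm xi (box_int i) / N)).
  exact: continuous_measurable_fun.
exact: measurable_funM.
Qed.

Lemma measurable_amp_re i : measurable_fun setT (amp_re i).
Proof. by apply: measurable_funM; [exact: measurable_cutoff|exact: (mg _).1]. Qed.

Lemma measurable_amp_im i : measurable_fun setT (amp_im i).
Proof. by apply: measurable_funM; [exact: measurable_cutoff|exact: (mg _).2]. Qed.

Let J : set rline := `[- (2 * N), 2 * N]%classic.

Lemma amp_sq_le i xi : amp_re i xi ^+ 2 + amp_im i xi ^+ 2 <=
  (((fun xi => normc (g xi (box_int i)) ^+ 2) \_ J) xi).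
Proof.
rewrite patchE; case: ifPn => xJ.
  rewrite normc_sq /amp_re /amp_im !exprMn -mulrDr.
  have /andP[c0 c1] := cutoff_ge0_le1 i xi.
  by rewrite ler_piMl ?addr_ge0 ?sqr_ge0// expr_le1.
have c0 : cutoff i xi = 0.
  apply: eta_far; apply: le_trans (freq_norm_xi _ _).
  rewrite ltW// ltNge; apply: contraNN xJ => xN.
  by rewrite inE /J/= in_itv/= -ler_norml.
by rewrite /amp_re /amp_im c0 !mul0r expr0n addr0.
Qed.

Lemma rintegrable_amp_sq i : (\int[leb]_(xi in J) (normc (g xi (box_int i)) ^+ 2)%:E < +oo)%E ->
  rintegrable leb (fun xi => amp_re i xi ^+ 2 + amp_im i xi ^+ 2) /\
  (rintegrable leb (amp_re i) /\ rintegrable leb (amp_im i)).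
Proof.
move=> gJ; have mJ : measurable J by exact: measurable_itv.
have lJ : (leb J < +oo)%E.
  by rewrite lebesgue_measure_itv/=; case: ifP => _; rewrite ltry.
have mar := measurable_amp_re i; have mai := measurable_amp_im i.
have m2 : measurable_fun setT (fun xi => amp_re i xi ^+ 2 + amp_im i xi ^+ 2).
  by apply: measurable_funD; exact: measurable_funX.
have i2 : rintegrable leb (fun xi => amp_re i xi ^+ 2 + amp_im i xi ^+ 2).
  apply/integrableP; split; first exact/measurable_EFinP.
  apply: le_lt_trans gJ; rewrite [leRHS]integral_mkcond.
  apply: ge0_le_integral => //.
  - by apply/measurable_EFinP/measurableT_comp.
  - have mf := measurable_normc_sq (mg (box_int i)).
    have mf' : measurable_fun J (fun xi => (normc (g xi (box_int i)) ^+ 2)%:E).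
      exact: measurable_funTS mf.
    exact: ((measurable_restrictT _ mJ).1 mf').
  move=> xi _; have := amp_sq_le i xi; rewrite /= ger0_norm ?addr_ge0 ?sqr_ge0//.
  by rewrite !patchE; case: ifP => _; rewrite lee_fin.
have iJ : rintegrable leb (fun xi => amp_re i xi ^+ 2 + amp_im i xi ^+ 2 + \1_J xi).
  apply: rintegrableD => //; apply/integrableP; split.
    exact/measurable_EFinP/measurable_indic.
  under eq_integral do rewrite /= ger0_norm//.
  by rewrite integral_indic// setIT.
(* On the bounded interval J, |u| <= u^2 + 1 deduces integrability from square
   integrability. *)
have bnd (u v : R) xi : u ^+ 2 + v ^+ 2 <= amp_re i xi ^+ 2 + amp_im i xi ^+ 2 ->
    `|u| <= amp_re i xi ^+ 2 + amp_im i xi ^+ 2 + \1_J xi.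
  move=> uv; have := amp_sq_le i xi; rewrite patchE indicE; case: ifPn => _ le.
    apply: (le_trans _ (lerD uv (lexx _))) => /=.
    have := sqr_ge0 (`|u| - 1); rewrite sqrrB1 real_normK ?num_real//.
    by have := sqr_ge0 u; have := sqr_ge0 v; lra.
  have {}le : amp_re i xi ^+ 2 + amp_im i xi ^+ 2 <= 0 := le.
  have u0 : u ^+ 2 = 0.
    apply/eqP; rewrite eq_le sqr_ge0 andbT.
    by have := sqr_ge0 v; move: (le_trans uv le); lra.
  move/eqP: u0; rewrite sqrf_eq0 => /eqP ->.
  by rewrite normr0 addr0 addr_ge0 ?sqr_ge0.
split=> //; split; apply: rintegrable_le iJ => // xi.
  exact: (bnd _ (amp_im i xi)).
by apply: (bnd _ (amp_re i xi)); rewrite addrC.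
Qed.

(** The multiplier vanishes outside the box, which makes the sum over Z^n finite. *)
Lemma schrodinger_LP_box (phi : RT R n.+2 -> R[i]) (w : rline * RT R n.+2) :
  fourier phi = g ->
  complex.Re (schrodinger_LP eta N phi w) =
    \sum_i osc_re leb amp_re amp_im (@phase_ST R n K) i w /\
  complex.Im (schrodinger_LP eta N phi w) =
    \sum_i osc_im leb amp_re amp_im (@phase_ST R n K) i w.
Proof.
move=> gE; rewrite /schrodinger_LP /fourier_multiplier gE.
pose r := [seq box_int i | i <- enum {: box}].
rewrite (fsbigE r)//=; last 2 first.
- by rewrite map_inj_uniq ?enum_uniq//; exact: box_int_inj.
- move=> k _ kr.
  have [j kj] : exists j, K%:Z < `|tnth k j|.
    apply: contrapT => H; move/negP: kr; apply.
    have [i ->] : exists i, k = @box_int n.+2 K i.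
      apply: box_int_surj => j; rewrite leNgt; apply/negP => kj; apply: H.
      by exists j.
    by apply/mapP; exists i => //; rewrite mem_enum.
  have L0 xi : LP_symbol eta N xi k = 0.
    rewrite /LP_symbol eta_far//; apply: le_trans (freq_norm_tnth xi k j); rewrite -KN -intr_norm -[K%:R]/((K%:Z)%:~R) ler_int.
    exact: ltW.
  have E (f : rline -> R[i]) : (forall xi, f xi = 0) -> cintegral leb setT f = 0.
    move=> f0; rewrite /cintegral.
    rewrite (eq_rintegral leb (f := fun x => complex.Re (f x)) (g := cst 0)); last first.
      by move=> xi; rewrite f0.
    rewrite (eq_rintegral leb (f := fun x => complex.Im (f x)) (g := cst 0)); last first.
      by move=> xi; rewrite f0.
    by rewrite Rintegral_cst// mul0r.
  by apply: E => xi; rewrite L0 mulr0 !mul0r.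
rewrite (eq_bigl xpredT); last by move=> k; rewrite in_setT.
rewrite big_map big_enum/=.
have nE i xi : freq_norm xi (box_int i) ^+ 2 = (xi : R) ^+ 2 + (nsq i)%:R.
  rewrite /freq_norm sqr_sqrtr; first by rewrite nsqRE.
  by rewrite addr_ge0 ?sqr_ge0// sumr_ge0// => l _; exact: sqr_ge0.
rewrite (big_morph (@complex.Re R) (id1 := 0) (op1 := +%R)); [|by case=> ? ? []|by []].
rewrite (big_morph (@complex.Im R) (id1 := 0) (op1 := +%R)); [|by case=> ? ? []|by []].
split; apply: eq_bigr => i _; rewrite /= /osc_re /osc_im; apply: eq_rintegral => xi.
  rewrite !(Re_mul, Im_mul)/= nE /amp_re /amp_im /cutoff /phase_ST/=.
  by rewrite cosN sinN mulrBr cosB sinB; ring.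
rewrite !(Re_mul, Im_mul)/= nE /amp_re /amp_im /cutoff /phase_ST/=.
by rewrite cosN sinN mulrBr cosB sinB; ring.
Qed.

End localized.

(** * The Strichartz estimate *)

Section constants.
Variable R : realType.

(** An N^eps bound from [two_squares_bound] with k > 2 / eps, as then
    N^2 <= N^(k eps). *)
Lemma two_squares_powR (eps : R) : 0 < eps -> exists2 D : R, 1 <= D &
  forall m : nat, exists2 B : nat, B%:R <= D * (2 ^+ m) `^ eps &
    few_two_squares (2 ^ m.+1) B.
Proof.
move=> eps0; pose k := (Num.truncn (2 / eps)).+1.
have keps : 2 <= k%:R * eps.
  by rewrite -ler_pdivrMr// ltW// truncnS_gt.
have [C CP] := @two_squares_bound k isT.
(* |M| + 1 <= 32 (2 N)^2 + 1 <= 129 N^2. *)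
pose D : R := (129 * C.+1)%:R; have D1 : 1 <= D by rewrite ler1n.
exists D => // m; pose N : R := 2 ^+ m.
have N1 : 1 <= N by rewrite exprn_ege1// ler1n.
have N0 : 0 < N by exact: lt_le_trans N1.
have X0 : 0 <= D * N `^ eps by rewrite mulr_ge0 ?powR_ge0// (le_trans _ D1).
exists (Num.truncn (D * N `^ eps)); first by rewrite truncn_le.
move=> M s us sP MK; rewrite truncn_ge_nat//.
have := CP M s us sP; rewrite -(ler_nat R) natrX => h.
rewrite -(@ler_pXn2r _ k)// ?nnegrE//.
apply: (le_trans h); rewrite exprMn.
have -> : (N `^ eps) ^+ k = N `^ (k%:R * eps).
  by rewrite -powR_mulrn ?powR_ge0// -powRrM mulrC.
apply: (@le_trans _ _ (D * N ^+ 2)).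
  have -> : N ^+ 2 = ((2 ^ m) ^ 2)%:R by rewrite !natrX.
  rewrite /D -natrM ler_nat.
  apply: (@leq_trans (C * (129 * (2 ^ m) ^ 2)))%N.
    rewrite leq_mul2l; apply/orP; right.
    have : (0 < (2 ^ m) ^ 2)%N by rewrite !expn_gt0.
    by move: MK; rewrite [(2 ^ m.+1)%N]expnS expnMn; lia.
  by rewrite mulnCA mulnA leq_mul2r leq_mul2l leqnSn !orbT.
apply: ler_pM => //.
- by rewrite exprn_ge0// ltW.
- by rewrite ler_eXnr.
by rewrite -powR_mulrn ?ler_powR// ltW.
Qed.

Lemma schur_cst_le (n K B : nat) (N T D X : R) : 1 <= T -> 1 <= N ->
  K%:R = 2 * N -> 0 <= X -> B%:R <= D * X ->
  schur_cst n K B (2 * T) <=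
  (4 * pi ^+ 2 * slab_cst R n * 5 ^+ n * (12 * n.+2%:R) * D) *
   (X * (N ^+ n * (Num.sqrt T + N))).
Proof.
move=> T1 N1 KN X0 BD; have T0 : 0 < T by exact: lt_le_trans T1.
have N0 : 0 < N by exact: lt_le_trans N1.
have n1 : 2 <= n.+2%:R :> R by rewrite ler_nat.
have sT : 0 <= Num.sqrt T by exact: sqrtr_ge0.
have DX : 0 <= D * X by apply: le_trans BD; exact: ler0n.
have h1 : (B * K.*2.+1 ^ n)%:R <= D * X * (5 ^+ n * N ^+ n).
  rewrite natrM natrX -exprMn; apply: ler_pM => //.
  apply: lerXn2r; rewrite ?nnegrE//; first by rewrite mulr_ge0// ltW.
  by rewrite -natr1 -muln2 natrM KN; lra.
have h2 : 2 * Num.sqrt (2 * T) <= 12 * n.+2%:R * Num.sqrt T.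
  have : Num.sqrt (2 * T) <= 2 * Num.sqrt T.
    by rewrite sqrtrM// ler_wpM2r// -[leRHS]ger0_norm// -sqrtr_sqr ler_wsqrtr//; lra.
  by have := ler_pM _ _ n1 (lexx (Num.sqrt T)); nra.
have h3 : 4 * Num.sqrt ((n.+2 * K ^ 2).*2.+1)%:R <= 12 * n.+2%:R * N.
  have : Num.sqrt ((n.+2 * K ^ 2).*2.+1)%:R <= 3 * n.+2%:R * N.
    have p0 : 0 <= 3 * n.+2%:R * N by rewrite !mulr_ge0// ltW.
    rewrite -[leRHS]ger0_norm// -sqrtr_sqr ler_wsqrtr//.
    rewrite -natr1 -muln2 !natrM KN.
    have : 1 <= N ^+ 2 by rewrite exprn_ege1.
    have : n.+2%:R * 2 <= n.+2%:R * n.+2%:R :> R by rewrite ler_wpM2l.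
    nra.
  lra.
have h4 : 2 * Num.sqrt (2 * T) + 4 * Num.sqrt ((n.+2 * K ^ 2).*2.+1)%:R <=
   12 * n.+2%:R * (Num.sqrt T + N) by lra.
have lc : 0 <= 4 * pi ^+ 2 * slab_cst R n.
  apply: mulr_ge0; first by rewrite mulr_ge0// sqr_ge0.
  by rewrite mulr_ge0// exprn_ge0.
rewrite /schur_cst [leLHS]mulrA.
have -> : (4 * pi ^+ 2 * slab_cst R n * 5 ^+ n * (12 * n.+2%:R) * D) *
   (X * (N ^+ n * (Num.sqrt T + N))) =
  (4 * pi ^+ 2 * slab_cst R n) * ((D * X * (5 ^+ n * N ^+ n)) *
    (12 * n.+2%:R * (Num.sqrt T + N))) by ring.
apply: ler_wpM2l => //; apply: ler_pM => //.
Qed.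

Lemma powR_fourth (x y : R) : (x `^ y) ^+ 4 = x `^ (4 * y).
Proof. by rewrite -powR_mulrn ?powR_ge0// -powRrM mulrC. Qed.

(** N^n (sqrt T + N) is the sum of the fourth powers of the two terms on the right,
    hence at most the fourth power of their sum. *)
Lemma strichartz_factor (n : nat) (N T eps C Y : R) : 1 <= T -> 1 <= N ->
  0 <= Y -> Y <= C ->
  Y * (N `^ (4 * eps) * (N ^+ n * (Num.sqrt T + N))) <=
  ((1 + C) * N `^ eps * (T `^ (1 / 8) * N `^ ((n.+2%:R - 2) / 4)
     + N `^ ((n.+2%:R - 1) / 4))) ^+ 4.
Proof.
move=> T1 N1 Y0 YC; have T0 : 0 < T by exact: lt_le_trans T1.
have N0 : 0 < N by exact: lt_le_trans N1.
rewrite !exprMn powR_fourth.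
set a := T `^ _ * _; set b := N `^ ((_ - 1) / 4).
have a0 : 0 <= a by rewrite mulr_ge0 ?powR_ge0.
have b0 : 0 <= b by rewrite powR_ge0.
have aE : a ^+ 4 = Num.sqrt T * N ^+ n.
  rewrite exprMn !powR_fourth; congr (_ * _).
    by rewrite -powR12_sqrt ?(ltW T0)//; congr (_ `^ _); field.
  rewrite -powR_mulrn ?(ltW N0)//; congr (_ `^ _).
  by rewrite -[n.+2]addn2 natrD; field.
have bE : b ^+ 4 = N ^+ n * N.
  rewrite powR_fourth -exprSr -powR_mulrn ?(ltW N0)//; congr (_ `^ _).
  by rewrite -[n.+2]addn1 natrD; field.
have ab : N ^+ n * (Num.sqrt T + N) <= (a + b) ^+ 4.
  have -> : N ^+ n * (Num.sqrt T + N) = a ^+ 4 + b ^+ 4 by rewrite aE bE; ring.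
  rewrite (_ : (a + b) ^+ 4 = a ^+ 4 + b ^+ 4 +
    a * b * (4 * a ^+ 2 + 6 * (a * b) + 4 * b ^+ 2)); last by ring.
  have ab0 : 0 <= a * b by exact: mulr_ge0.
  rewrite lerDl; apply: mulr_ge0 => //.
  by have := sqr_ge0 a; have := sqr_ge0 b; lra.
have Np : 0 <= N `^ (4 * eps) by exact: powR_ge0.
rewrite -mulrA; apply: ler_pM => //.
- by rewrite mulr_ge0// mulr_ge0 ?exprn_ge0 ?(ltW N0)// addr_ge0 ?sqrtr_ge0// ltW.
- apply: (@le_trans _ _ (1 + C)); first lra.
  by rewrite ler_eXnr//; lra.
by apply: ler_wpM2l.
Qed.

End constants.

Section strichartz.
Variables (R : realType) (n : nat).
Local Notation rline := (measurableTypeR R).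
Local Notation leb := (@lebesgue_measure R).
Local Notation normc := ComplexField.Normc.normc.

(** [fourier phi] is either a transform of phi, bounded by [plancherel_le], or the
    default value 0 of the choice operator. *)
Lemma fourier_box_le (phi : RT R n -> R[i]) : cmeasurable phi ->
  (\int[@RT_measure R n]_z (normc (phi z) ^+ 2)%:E < +oo)%E ->
  (forall k, cmeasurable ((fourier phi)^~ k)) /\
  forall (K : nat) (B : R), (\sum_(i : n.-tuple 'I_(K.*2.+1))
     \int[leb]_(xi in `[(- B)%R, B]) (normc (fourier phi xi (box_int i)) ^+ 2)%:E <=
   (8 * bessel_cst R n)%:E * \int[@RT_measure R n]_z (normc (phi z) ^+ 2)%:E)%E.
Proof.
move=> mphi phi2; have [ex|nex] := pselect (exists g, is_fourier phi g).
  have gP : is_fourier phi (fourier phi) := xgetPex _ ex.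
  by split=> [|K B]; [case: gP|exact: plancherel_le].
have -> : fourier phi = (fun _ _ => 0).
  by apply: xgetPN => g gP; apply: nex; exists g.
split=> [k|K B]; first by split; exact: measurable_cst.
rewrite big1 => [|i _].
  apply: mule_ge0; first by rewrite lee_fin mulr_ge0// ltW// bessel_cst_gt0.
  by apply: integral_ge0 => z _; rewrite lee_fin sqr_ge0.
by apply: integral0_eq => xi _; rewrite normc_sq/= !expr0n/= addr0.
Qed.

End strichartz.

Section strichartz4.
Variables (R : realType) (n K B : nat) (eta : R -> R) (N T : R).
Local Notation rline := (measurableTypeR R).
Local Notation leb := (@lebesgue_measure R).
Local Notation normc := ComplexField.Normc.normc.
Hypothesis heta : LP_profile eta.
Hypotheses (N0 : 0 < N) (KN : K%:R = 2 * N) (T1 : 1 <= T).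
Hypothesis BP : few_two_squares K B.
Variables (phi : RT R n.+2 -> R[i]) (q : R).
Hypothesis mphi : cmeasurable phi.
Hypothesis phi2 : (\int[@RT_measure R n.+2]_z (normc (phi z) ^+ 2)%:E = q%:E)%E.

(** The cutoff is supported in the box of size K = 2 N. As [slab_integral_le] uses
    bumps at scale 2 T, the bilinear estimate enters with 2 T in place of T. *)
Lemma strichartz_fourth_power :
  (\int[slab_measure n.+2 T]_w (normc (schrodinger_LP eta N phi w) ^+ 4)%:E <=
   (4 * (2 * schur_cst n K B (2 * T) * (8 * bessel_cst R n.+2 * q) ^+ 2))%:E)%E.
Proof.
have T0 : 0 < T by exact: lt_le_trans T1.
have T2 : 1 <= 2 * T by apply: (le_trans T1); rewrite ler_peMl ?ler1n ?(ltW T0).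
have [mg gle] : _ /\ _ := fourier_box_le mphi (eq_ind_r (fun z => z < +oo)%E (ltry q) phi2).
have {gle} := gle K (2 * N); rewrite phi2 -EFinM => gle.
set g := fourier phi in mg gle.
pose J : set rline := `[- (2 * N), 2 * N]%classic.
have gJ i : (\int[leb]_(xi in J) (normc (g xi (@box_int n.+2 K i)) ^+ 2)%:E < +oo)%E.
  apply: (le_lt_trans _ (ltry (8 * bessel_cst R n.+2 * q))).
  apply: (le_trans _ gle); rewrite (bigD1 i)//= leeDl//.
  apply: sume_ge0 => j _; apply: integral_ge0 => xi _.
  by rewrite lee_fin sqr_ge0.
have ab i := rintegrable_amp_sq heta N0 mg (gJ i).
have mass : \sum_(i : n.+2.-tuple 'I_(K.*2.+1)) \int[leb]_y (amp_re eta N g i y ^+ 2 + amp_im eta N g i y ^+ 2)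
    <= 8 * bessel_cst R n.+2 * q.
  rewrite -lee_fin -sumEFin; apply: (le_trans _ gle); apply: lee_sum => i _.
  rewrite rintegral_EFin; last by case: (ab i).
  rewrite [leRHS]integral_mkcond.
  have mJ : measurable J by exact: measurable_itv.
  have [abi _] := ab i; have mab := rintegrable_measurable abi.
  apply: ge0_le_integral => //.
  - by move=> xi _; rewrite lee_fin addr_ge0 ?sqr_ge0.
  - exact/measurable_EFinP.
  - have mf := measurable_funTS (D := J) (measurable_normc_sq (mg (box_int i))).
    exact: ((measurable_restrictT _ mJ).1 mf).
  move=> xi _; have := amp_sq_le heta N0 g i xi; rewrite /= !patchE.
  by case: ifP => _; rewrite lee_fin.
pose U w := \sum_i osc_re leb (amp_re eta N g) (amp_im eta N g) (@phase_ST R n K) i w.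
pose V w := \sum_i osc_im leb (amp_re eta N g) (amp_im eta N g) (@phase_ST R n K) i w.
have uE w : normc (schrodinger_LP eta N phi w) ^+ 4 = (U w ^+ 2 + V w ^+ 2) ^+ 2.
  have [re im] := schrodinger_LP_box heta N0 KN w (erefl g).
  by rewrite -[4%N]/(2 * 2)%N exprM normc_sq re im.
under eq_integral do rewrite uE.
have mosc i := measurable_osc leb (measurable_amp_re N heta mg i)
  (measurable_amp_im N heta mg i) (@measurable_phase_ST R n K i).
have mU : measurable_fun setT U by apply: measurable_sum => i; exact: (mosc i).1.
have mV : measurable_fun setT V by apply: measurable_sum => i; exact: (mosc i).2.
apply: slab_integral_le => //.
- by apply: measurable_funX; apply: measurable_funD; exact: measurable_funX.
- by move=> w; exact: sqr_ge0.
move=> A A0; have A2 : 0 < 2 * A by rewrite mulr_gt0.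
have := bilinear_L4 BP T2 A2 (fun i => (ab i).2.1) (fun i => (ab i).2.2) (fun i => (ab i).1).
move=> H; apply: (le_trans H); rewrite lee_fin.
apply: ler_wpM2l; first by rewrite mulr_ge0// schur_cst_ge0// ltW// mulr_gt0.
apply: lerXn2r; rewrite ?nnegrE//.
  by apply: sumr_ge0 => i _; apply: Rintegral_ge0 => y _; rewrite addr_ge0 ?sqr_ge0.
apply: le_trans mass; apply: sumr_ge0 => i _.
by apply: Rintegral_ge0 => y _; rewrite addr_ge0 ?sqr_ge0.
Qed.

End strichartz4.

Theorem theorem1p3 (R : realType) (n : nat) (hn : (2 <= n)%N)
    (eta : R -> R) (heta : LP_profile eta) (eps : R) (heps : 0 < eps) :
  exists C : R, forall (T : R) (m : nat) (phi : RT R n -> R[i]),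
    1 <= T -> in_L2 (@RT_measure R n) phi ->
    let N : R := 2 ^+ m in
    (cLnorm (slab_measure n T) 4 (schrodinger_LP eta N phi) <=
     (C * N `^ eps *
        (T `^ (1 / 8) * N `^ ((n%:R - 2) / 4) + N `^ ((n%:R - 1) / 4)))%:E
     * cLnorm (@RT_measure R n) 2 phi)%E.
Proof.
case: n hn => [//|[//|n]] _.
(* The fourth power of the norm is estimated, hence the exponent 4 eps. *)
have [D D1 DP] := two_squares_powR (mulr_gt0 (ltr0Sn R 3) heps).
pose c1 : R := 4 * pi ^+ 2 * slab_cst R n * 5 ^+ n * (12 * n.+2%:R) * D.
pose X : R := 8 * (8 * bessel_cst R n.+2) ^+ 2 * c1.
have X0 : 0 <= X.
  apply: mulr_ge0; first by rewrite mulr_ge0// sqr_ge0.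
  apply: mulr_ge0; last lra.
  rewrite mulr_ge0// mulr_ge0 ?exprn_ge0//.
  by rewrite mulr_ge0 ?slab_cst_ge0// mulr_ge0// sqr_ge0.
exists (1 + X) => T m phi T1 [mphi phiL2]; lazy zeta; set N : R := 2 ^+ m.
have N1 : 1 <= N by rewrite exprn_ege1// ler1n.
have N0 : 0 < N by exact: lt_le_trans N1.
have KN : (2 ^ m.+1)%:R = 2 * N by rewrite natrX exprS.
have [B BD BP] := DP m; have T0 : 0 < T by exact: lt_le_trans T1.
set mu := @RT_measure R n.+2; set Q := (\int[mu]_z (ComplexField.Normc.normc (phi z) ^+ 2)%:E)%E.
have Q0 : (0 <= Q)%E by apply: integral_ge0 => z _; rewrite lee_fin sqr_ge0.
have [q q0 Qq] : exists2 q : R, 0 <= q & Q = q%:E.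
  move: phiL2 Q0; rewrite (cLnormE _ 2) -/mu -/Q.
  case: Q => [q _ q0||]//; first by exists q.
  by rewrite poweRyr ?invr_eq0.
rewrite (cLnormE _ 4) (cLnormE _ 2) -/mu -/Q Qq poweR_EFin -EFinM.
have H4 := strichartz_fourth_power heta N0 KN T1 BP mphi Qq.
have S := schur_cst_le n T1 N1 KN (powR_ge0 N (4 * eps)) BD.
have F := strichartz_factor n eps T1 N1 X0 (lexx X).
set Z := (1 + X) * _ * _ in F *.
have Z0 : 0 <= Z.
  rewrite /Z mulr_ge0//; first by rewrite mulr_ge0 ?powR_ge0// addr_ge0.
  by rewrite addr_ge0// ?mulr_ge0 ?powR_ge0.
have bnd : 4 * (2 * schur_cst n (2 ^ m.+1) B (2 * T) * (8 * bessel_cst R n.+2 * q) ^+ 2)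
    <= (Z * q `^ 2^-1) ^+ 4.
  apply: (@le_trans _ _ (X * (N `^ (4 * eps) * (N ^+ n * (Num.sqrt T + N))) * q ^+ 2)).
    rewrite (_ : 4 * _ = 8 * (8 * bessel_cst R n.+2) ^+ 2 * q ^+ 2 *
      schur_cst n (2 ^ m.+1) B (2 * T)); last by ring.
    rewrite (_ : X * _ * _ = 8 * (8 * bessel_cst R n.+2) ^+ 2 * q ^+ 2 *
      (c1 * (N `^ (4 * eps) * (N ^+ n * (Num.sqrt T + N))))); last by rewrite /X; ring.
    by apply: ler_wpM2l => //; rewrite mulr_ge0 ?sqr_ge0// mulr_ge0 ?sqr_ge0.
  rewrite [leRHS]exprMn powR_fourth (_ : 4 * 2^-1 = 2%:R); last by field.
  by rewrite powR_mulrn// ler_wpM2r// sqr_ge0.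
apply: (@le_trans _ _ ((((Z * q `^ 2^-1) ^+ 4)%:E) `^ 4^-1)%E).
  apply: gt0_ler_poweR; rewrite ?invr_ge0//.
  - by rewrite in_itv/= leey andbT; apply: integral_ge0 => w _; rewrite lee_fin exprn_ge0// normc_ge0.
  - by rewrite in_itv/= leey andbT lee_fin exprn_ge0// mulr_ge0// powR_ge0.
  by apply: (le_trans H4); rewrite lee_fin.
rewrite poweR_EFin lee_fin -powR_mulrn; last by rewrite mulr_ge0// powR_ge0.
by rewrite -powRrM mulfV// powRr1// mulr_ge0// powR_ge0.
Qed.
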